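(* Let $S_g$ be a closed oriented surface of genus $g\ge2$ with fundamental group $\Gamma_g$ and universal cover $\widetilde{S_g}$, let $V=\mathbb{R}^{2n}$ and let $\mathcal{Q}=S^2V^*$. Let $\rho:\Gamma_g\to \mathrm{SL}(2n,\mathbb{R})$ be a representation that admits a $\rho$-equivariant fitting immersion $u:\widetilde{S_g}\to \mathrm{Gr}_2^{(n,n)}(\mathcal{Q})$. Then $\rho$ is $\{n\}$-Anosov.
   Context: $\mathcal{Q}=S^2V^*$ is the space of symmetric bilinear forms (''quadrics'') on $V$, on which $\mathrm{SL}(V)$ acts by $(g\cdot q)(v,w)=q(g^{-1}v,g^{-1}w)$. ''Positive'' means positive definite. $\mathrm{Gr}_2(\mathcal{Q})$ is the Grassmannian of planes in $\mathcal{Q}$ (pencils of quadrics), and $\mathrm{Gr}_2^{(n,n)}(\mathcal{Q})$ is the set of pencils all of whose non-zero elements have signature $(n,n)$. Identify $T_P\mathrm{Gr}_2(\mathcal{Q})=\mathrm{Hom}(P,\mathcal{Q}/P)$. A tangent vector $\mathrm{v}$ is fitting if its image in $\mathcal{Q}/P$ contains the class $[q]$ of some positive $q\in\mathcal{Q}$. A smooth immersion $u$ of a surface into the set of pencils containing no non-zero positive semi-definite form is a fitting immersion if $\mathrm{d}u(w)$ is fitting for every non-zero tangent vector $w$. A representation $\rho:\Gamma\to\mathrm{SL}(2n,\mathbb{R})$ of a finitely generated group with word metric $|\cdot|$ is $\{n\}$-Anosov if there are $A,B>0$ with $\sigma_n(\rho(\gamma))/\sigma_{n+1}(\rho(\gamma))\ge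 e^{A|\gamma|-B}$ for all $\gamma\in\Gamma$, where $\sigma_1\ge\dots\ge\sigma_{2n}$ are the singular values. *)

(* Defs.v *)
From HB Require Import structures.
From Stdlib Require Import Relations.
From mathcomp Require Import all_boot all_order all_algebra.
From mathcomp Require Import all_classical all_reals all_analysis.

Set Implicit Arguments.
Unset Strict Implicit.
Unset Printing Implicit Defensive.

Import Order.TTheory GRing.Theory Num.Theory numFieldNormedType.Exports.
Local Open Scope classical_set_scope.
Local Open Scope ring_scope.

Fixpoint Ck_on (R : realType) (k : nat) (U : set 'rV[R]_2)
    (f : 'rV[R]_2 -> R) : Prop :=
  match k with
  | 0 => forall x, U x -> {for x, continuous f}
  | k'.+1 => (forall x, U x -> differentiable f x) /\
             (forall v, Ck_on k' U (fun x => 'D_v f x))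
  end.

Definition Cinfty_on (R : realType) (U : set 'rV[R]_2) (f : 'rV[R]_2 -> R) :=
  forall k, Ck_on k U f.

(* Only the values of [fwd] on [dom] and of [bwd] on [fwd @` dom] matter. *)
Record chart (R : realType) (M : topologicalType) := Chart {
  dom : set M;
  fwd : M -> 'rV[R]_2;
  bwd : 'rV[R]_2 -> M;
  dom_open : open dom;
  img_open : open (fwd @` dom);
  fwd_cont : forall x, dom x -> {for x, continuous fwd};
  bwd_cont : forall y, (fwd @` dom) y -> {for y, continuous bwd};
  fwdK : forall x, dom x -> bwd (fwd x) = x }.

Definition oriented_compatible (R : realType) (M : topologicalType)
    (c d : chart R M) : Prop :=
  let U := fwd c @` (dom c `&` dom d) in
  let t := fwd d \o bwd c in
  (forall j, Cinfty_on U (fun y => t y 0 j)) /\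
  (forall y, U y -> 0 < \det ('J t y)).

Definition oriented_smooth_atlas (R : realType) (M : topologicalType)
    (A : set (chart R M)) : Prop :=
  (forall x, exists2 c, A c & dom c x) /\
  (forall c d, A c -> A d -> oriented_compatible c d).

(* Second countability is automatic for a compact, locally Euclidean space. *)
Definition closed_oriented_surface (R : realType) (S : topologicalType)
    (A : set (chart R S)) : Prop :=
  [/\ hausdorff_space S, compact [set: S], connected [set: S]
    & oriented_smooth_atlas A].

Definition unit_disc (R : realType) : set (R * R) :=
  [set z | z.1 ^+ 2 + z.2 ^+ 2 <= 1].

Definition circle_pt (R : realType) (t : R) : R * R :=
  (cos (2 * pi * t), sin (2 * pi * t)).

(* The boundary circle of the disc is cut into 4g edges labelled by
   a_1 b_1 a_1^-1 b_1^-1 ... a_g b_g a_g^-1 b_g^-1, and edge j = 4k + i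
   (i = 0, 1) is glued to edge j + 2 with reversed direction. *)
Definition polygon_glue (R : realType) (g : nat) (x y : R * R) : Prop :=
  exists (k i : nat) (s : R),
    [/\ (k < g)%N, (i < 2)%N, 0 <= s <= 1,
        x = circle_pt (((4 * k + i)%:R + s) / (4 * g)%:R)
      & y = circle_pt (((4 * k + i + 3)%:R - s) / (4 * g)%:R)].

(* S is homeomorphic to the glued 4g-gon: for S Hausdorff, a continuous
   surjection from the disc is a quotient map. *)
Definition has_genus (R : realType) (g : nat) (S : topologicalType) : Prop :=
  exists f : R * R -> S,
    [/\ {within @unit_disc R, continuous f},
        f @` @unit_disc R = setT
      & forall x y, unit_disc x -> unit_disc y ->
          (f x = f y <-> clos_refl_sym_trans _ (@polygon_glue R g) x y)].

Definition covering_map (X S : topologicalType) (p : X -> S) : Prop :=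
  [/\ continuous p,
      (forall s, exists x, p x = s)
    & forall s, exists (U : set S) (F : set (set X)),
      [/\ open U, U s, p @^-1` U = \bigcup_(W in F) W,
          trivIset F id
        & forall W, F W ->
          [/\ open W, p @` W = U, set_inj W p
            & forall W', open W' -> W' `<=` W -> open (p @` W')]]].

Definition simply_connected (R : realType) (X : topologicalType) : Prop :=
  (forall x y : X, exists f : R -> X,
     [/\ {within [set` `[0, 1]], continuous f}, f 0 = x & f 1 = y]) /\
  (forall f : R -> X, {within [set` `[0, 1]], continuous f} -> f 0 = f 1 ->
     exists H : R * R -> X,
       [/\ {within [set` `[0, 1]] `*` [set` `[0, 1]], continuous H},
           (forall t, 0 <= t <= 1 -> H (0, t) = f t),
           (forall t, 0 <= t <= 1 -> H (1, t) = f 0)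
         & (forall s, 0 <= s <= 1 -> H (s, 0) = f 0 /\ H (s, 1) = f 0)]).

Definition universal_cover (R : realType) (X S : topologicalType)
    (p : X -> S) : Prop :=
  simply_connected R X /\ covering_map p.

(* The smooth structure on X for which p is a local diffeomorphism. *)
Definition lift_atlas (R : realType) (X S : topologicalType) (p : X -> S)
    (A : set (chart R S)) : set (chart R X) :=
  [set c | exists2 d, A d &
     forall x, dom c x -> dom d (p x) /\ fwd c x = fwd d (p x)].

Definition deck_transformation (X S : topologicalType) (p : X -> S)
    (f : X -> X) : Prop :=
  [/\ continuous f, p \o f = p
    & exists f' : X -> X, [/\ continuous f', cancel f f' & cancel f' f]].

(* [act] identifies G with the deck group of p; for p the universal cover
   of S, this is the fundamental group of S with its action on the cover. *)
Definition deck_group (X S : topologicalType) (p : X -> S) (G : groupType)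
    (act : G -> X -> X) : Prop :=
  [/\ act 1%g = id,
      (forall a b, act (a * b)%g = act a \o act b),
      injective act
    & forall f, deck_transformation p f <-> exists a, act a = f].

(* Quadrics on R^m are represented by their Gram matrices, q(v, w) = v^T q w,
   so that (g . q)(v, w) = q(g^-1 v, g^-1 w) reads as follows. *)
Definition quadric_act (R : realType) (m : nat) (g q : 'M[R]_m) : 'M[R]_m :=
  (invmx g)^T *m q *m invmx g.

Definition posdef (R : realType) (m : nat) (q : 'M[R]_m) : Prop :=
  q^T = q /\ forall v : 'cV[R]_m, v != 0 -> 0 < (v^T *m q *m v) 0 0.

Definition possemidef (R : realType) (m : nat) (q : 'M[R]_m) : Prop :=
  q^T = q /\ forall v : 'cV[R]_m, 0 <= (v^T *m q *m v) 0 0.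

Definition has_signature (R : realType) (a b m : nat) (q : 'M[R]_m) : Prop :=
  (a + b <= m)%N /\
  exists2 B : 'M[R]_m, B \in unitmx &
    B^T *m q *m B =
      diag_mx (\row_i (if (i < a)%N then 1 else if (i < a + b)%N then -1 else 0)).

Definition pencil (R : realType) (m : nat) (P : {vspace 'M[R]_m}) : Prop :=
  \dim P = 2 /\ forall q, q \in P -> q^T = q.

Definition pencil_of_signature (R : realType) (a b m : nat)
    (P : {vspace 'M[R]_m}) : Prop :=
  pencil P /\ forall q, q \in P -> q != 0 -> has_signature a b q.

Definition smooth_on (R : realType) (M : topologicalType)
    (A : set (chart R M)) (m : nat) (W : set M) (s : M -> 'M[R]_m) : Prop :=
  forall c, A c -> forall i j,
    Cinfty_on (fwd c @` (dom c `&` W)) (fun y => s (bwd c y) i j).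

(* A tangent vector at x is given by its coordinates w in a chart c at x. *)
Definition tangent_deriv (R : realType) (M : topologicalType) (c : chart R M)
    (w : 'rV[R]_2) (x : M) (m : nat) (s : M -> 'M[R]_m) : 'M[R]_m :=
  \matrix_(i, j) 'D_w (fun y => s (bwd c y) i j) (fwd c x).

(* The Grassmannian carries the quotient smooth structure of the space of
   frames: a map to it is smooth iff it locally admits smooth frames. *)
Definition smooth_pencil_map (R : realType) (M : topologicalType)
    (A : set (chart R M)) (m : nat) (u : M -> {vspace 'M[R]_m}) : Prop :=
  forall x, exists (W : set M) (q1 q2 : M -> 'M[R]_m),
    [/\ open W, W x, smooth_on A W q1, smooth_on A W q2
      & forall y, W y -> u y = <<[:: q1 y; q2 y]>>%VS].

(* Graph of the differential at x, as an element of Hom(P, Q/P) with P = u x: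
   [pencil_diff A u c w x q r] says that du(w) maps q in P to the class of r.
   Under T_P Gr = Hom(P, Q/P), the image of q is the class of the derivative
   of any smooth local section of u through q. *)
Definition pencil_diff (R : realType) (M : topologicalType)
    (A : set (chart R M)) (m : nat) (u : M -> {vspace 'M[R]_m})
    (c : chart R M) (w : 'rV[R]_2) (x : M) (q r : 'M[R]_m) : Prop :=
  exists (W : set M) (s : M -> 'M[R]_m),
    [/\ open W, W x, smooth_on A W s,
        forall y, W y -> s y \in u y
      & s x = q /\ r - tangent_deriv c w x s \in u x].

(* T is the graph of a tangent vector in Hom(P, Q/P), as in [pencil_diff]. *)
Definition fitting (R : realType) (m : nat) (T : 'M[R]_m -> 'M[R]_m -> Prop) :
    Prop :=
  exists q r, T q r /\ posdef r.

Definition immersion (R : realType) (M : topologicalType)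
    (A : set (chart R M)) (m : nat) (u : M -> {vspace 'M[R]_m}) : Prop :=
  smooth_pencil_map A u /\
  forall c x w, A c -> dom c x -> w != 0 ->
    exists q r, pencil_diff A u c w x q r /\ r \notin u x.

Definition fitting_immersion (R : realType) (M : topologicalType)
    (A : set (chart R M)) (m : nat) (u : M -> {vspace 'M[R]_m}) : Prop :=
  [/\ forall x, pencil (u x),
      forall x q, q \in u x -> possemidef q -> q = 0,
      immersion A u
    & forall c x w, A c -> dom c x -> w != 0 ->
        fitting (pencil_diff A u c w x)].

Definition SL_representation (R : realType) (G : groupType) (m : nat)
    (rho : G -> 'M[R]_m) : Prop :=
  [/\ rho 1%g = 1%:M,
      (forall a b, rho (a * b)%g = rho a *m rho b)
    & forall a, \det (rho a) = 1].

Definition equivariant (R : realType) (X : Type) (G : groupType)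
    (act : G -> X -> X) (m : nat) (rho : G -> 'M[R]_m)
    (u : X -> {vspace 'M[R]_m}) : Prop :=
  forall a x, [set` u (act a x)] = quadric_act (rho a) @` [set` u x].

Definition is_word (G : groupType) (gens : seq G) (k : nat) (a : G) : Prop :=
  exists w : seq G,
    [/\ size w = k,
        all (fun x => (x \in gens) || (x^-1%g \in gens)) w
      & a = foldr (fun x y => (x * y)%g) 1%g w].

Definition generates (G : groupType) (gens : seq G) : Prop :=
  forall a, exists k, `[< is_word gens k a >].

Definition word_length (G : groupType) (gens : seq G) (Hgen : generates gens)
    (a : G) : nat :=
  ex_minn (Hgen a).

Definition is_singular_values (R : realType) (m : nat) (M : 'M[R]_m)
    (s : seq R) : Prop :=
  [/\ sorted (fun x y : R => y <= x) s, all (fun x : R => 0 <= x) s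
    & char_poly (M^T *m M) = \prod_(x <- s) ('X - (x ^+ 2)%:P)].

(* Indexed from 1, in decreasing order. *)
Definition sigma (R : realType) (m : nat) (k : nat) (M : 'M[R]_m) : R :=
  (xget [::] [set s | is_singular_values M s])`_k.-1.

(* The condition does not depend on the choice of the finite generating set,
   so it is required for the word metric of every one of them. *)
Definition anosov (R : realType) (G : groupType) (m : nat) (k : nat)
    (rho : G -> 'M[R]_m) : Prop :=
  (exists gens : seq G, generates gens) /\
  forall (gens : seq G) (Hgen : generates gens),
    exists A B : R, [/\ 0 < A, 0 < B & forall a : G,
      expR (A * (word_length Hgen a)%:R - B)
        <= sigma k (rho a) / sigma k.+1 (rho a)].

(* Main.v *)
(* Say that x is a zero of a positive semi-definite A <> 0 in S^2 V when A is
   orthogonal to the pencil u(x) for the pairing tr(A q). Fitting makes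
   y |-> A|u(y), read in a local frame of u, an immersion at its zeros, so a zero
   is isolated and persists when A moves in a small order interval
   (1 - e) A <= A' <= (1 + e) A; the latter notion is SL(V)-invariant, so by
   cocompactness e can be chosen uniformly. Hence zeros follow A along segments of
   positive definite forms, and the endpoint of the zero followed to a fixed C is a
   locally constant function on the connected surface: every A has at most one zero.

   Let T = (1 + e)^N and let o be a base point. By convex duality, either there are
   q in u(o) and q' in u(a o) with q' - T q > 0 and q' - T^-1 q > 0, and comparing
   them on the definite subspaces of q and q' gives sigma_n / sigma_(n+1) >= k T for
   rho(a); or there are A, B >= 0, not both zero, such that A + B vanishes at a o and
   T A + T^-1 B vanishes at o. In the second case the N steps of the path
   (1 + e)^k A + (1 + e)^-k B are relatively e-close, so following the zero shows
   that a has word length O(N). *)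

Require Import Defs.
From HB Require Import structures.
From mathcomp Require Import all_boot all_order all_algebra.
From mathcomp Require Import all_classical all_reals all_analysis.
From mathcomp Require Import ring lra zify.

Set Implicit Arguments.
Unset Strict Implicit.
Unset Printing Implicit Defensive.

Import Order.TTheory GRing.Theory Num.Theory numFieldNormedType.Exports.
Local Open Scope classical_set_scope.
Local Open Scope ring_scope.

(** * Quadratic forms and the spectral theorem *)

(** Why fitting gives an immersion: at a zero of [A] the whole pencil u(x) pairs to 0 with [A]. If
    the derivative in a direction w vanished too, [A] would pair to 0 with a positive definite r
    representing the image of du(w), which is impossible for A >= 0, A <> 0. Source and target both
    have dimension two, so quantitative inversion applies.

    The obstacle is that X is not compact and rho(a) is unbounded, so norm estimates are not uniform
    along orbits. Zeros are first followed along positive definite forms, where norm closeness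
    implies order closeness; semi-definite forms are reached by adding a small multiple of the
    identity.

    Global uniqueness closes the argument: the zero followed from a o ends at some zero of the last
    form, and uniqueness identifies it with o.

    For the gap, q' > T q where q is positive bounds rho(a) from above on an n-dimensional subspace,
    and q' > T^-1 q where q' is negative bounds it from below on another. The unknown relative scale
    of q and q' enters both bounds and cancels in the quotient. *)

Section LinearAlgebra.
Variable R : realType.

Lemma cvg_sumr (T I : Type) (F : set_system T) {FF : Filter F} (r : seq I)
    (f : I -> T -> R) (a : I -> R) :
  (forall i, f i @ F --> a i) -> (fun x => \sum_(i <- r) f i x) @ F --> \sum_(i <- r) a i.
Proof.
move=> h; elim: r => [|i r IH].
  by under eq_fun do rewrite big_nil; rewrite big_nil; exact: cvg_cst.
by under eq_fun do rewrite big_cons; rewrite big_cons; exact: cvgD.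
Qed.

Definition qf m (A : 'M[R]_m) (v : 'cV[R]_m) : R := (v^T *m A *m v) 0 0.

Lemma qf_sum m (A : 'M[R]_m) v : qf A v = \sum_i \sum_j v i 0 * A i j * v j 0.
Proof.
rewrite /qf mxE exchange_big /=; apply: eq_bigr => j _; rewrite mxE big_distrl /=.
by apply: eq_bigr => i _; rewrite mxE.
Qed.

Lemma qfD m (A B : 'M[R]_m) v : qf (A + B) v = qf A v + qf B v.
Proof. by rewrite /qf mulmxDr mulmxDl mxE. Qed.

Lemma qfZ m a (A : 'M[R]_m) v : qf (a *: A) v = a * qf A v.
Proof. by rewrite /qf -scalemxAr -scalemxAl mxE. Qed.

Lemma qfN m (A : 'M[R]_m) v : qf (- A) v = - qf A v.
Proof. by rewrite -scaleN1r qfZ mulN1r. Qed.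

Lemma qfB m (A B : 'M[R]_m) v : qf (A - B) v = qf A v - qf B v.
Proof. by rewrite qfD qfN. Qed.

Lemma qfZv m a (A : 'M[R]_m) v : qf A (a *: v) = a ^+ 2 * qf A v.
Proof.
rewrite /qf [_^T]linearZ /= -!scalemxAl -scalemxAr !mxE.
by rewrite mulrA expr2.
Qed.

Lemma qf_congr m k (A : 'M[R]_m) (B : 'M[R]_(m, k)) (v : 'cV_k) :
  qf (B^T *m A *m B) v = qf A (B *m v).
Proof. by rewrite /qf trmx_mul !mulmxA. Qed.

Lemma bilin_sym m (A : 'M[R]_m) (v w : 'cV[R]_m) : A^T = A ->
  (w^T *m A *m v) 0 0 = (v^T *m A *m w) 0 0.
Proof.
by move=> As; rewrite -[in LHS](trmxK (w^T *m A *m v)) mxE !trmx_mul trmxK As mulmxA.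
Qed.

Lemma addmxE m k (A B : 'M[R]_(m, k)) i j : (A + B) i j = A i j + B i j.
Proof. by rewrite mxE. Qed.

Lemma scalemxE m k a (A : 'M[R]_(m, k)) i j : (a *: A) i j = a * A i j.
Proof. by rewrite mxE. Qed.

Lemma qfDv m (A : 'M[R]_m) v w : A^T = A ->
  qf A (v + w) = qf A v + 2 * (v^T *m A *m w) 0 0 + qf A w.
Proof.
move=> As; rewrite /qf [_^T]linearD /= !mulmxDl !mulmxDr !addmxE.
by rewrite (bilin_sym v w As); ring.
Qed.

(** The Euclidean norm squared, kept beside the matrix norm, which is the maximum of the absolute
    values of the entries. *)
Definition nsq m (v : 'cV[R]_m) : R := \sum_i v i 0 ^+ 2.

Lemma nsqE m (v : 'cV[R]_m) : nsq v = qf 1%:M v.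
Proof.
by rewrite /qf mulmx1 mxE; apply: eq_bigr => i _; rewrite mxE expr2.
Qed.

Lemma nsq_ge0 m (v : 'cV[R]_m) : 0 <= nsq v.
Proof. by apply: sumr_ge0 => i _; exact: sqr_ge0. Qed.

Lemma nsq_eq0 m (v : 'cV[R]_m) : (nsq v == 0) = (v == 0).
Proof.
apply/eqP/eqP => [h|->]; last first.
  by rewrite /nsq big1 // => i _; rewrite mxE expr0n.
apply/matrixP => i j; rewrite ord1 mxE; apply/eqP; rewrite -sqrf_eq0.
by rewrite (psumr_eq0P _ h) // => k _; exact: sqr_ge0.
Qed.

Lemma nsq_gt0 m (v : 'cV[R]_m) : (0 < nsq v) = (v != 0).
Proof. by rewrite lt_def nsq_eq0 nsq_ge0 andbT. Qed.

Lemma nsqZ m a (v : 'cV[R]_m) : nsq (a *: v) = a ^+ 2 * nsq v.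
Proof. by rewrite !nsqE qfZv. Qed.

Lemma posdef_psd m (q : 'M[R]_m) : posdef q -> possemidef q.
Proof.
case=> qs qp; split=> // v; have [->|v0] := eqVneq v 0; last exact/ltW/qp.
by rewrite mulmx0 mxE.
Qed.

(** Moving [v] by [- t A v] changes the value by [- 2 t |A v|^2 + O(t^2)], which is negative for
    small [t] unless [A v = 0]. *)
Lemma psd_qf0 m (A : 'M[R]_m) v : possemidef A -> qf A v = 0 -> A *m v = 0.
Proof.
case=> As Ap Av; set w := A *m v.
have e1 : (v^T *m A *m w) 0 0 = nsq w.
  by rewrite nsqE /qf mulmx1 /w trmx_mul As.
apply/eqP; rewrite -nsq_eq0; apply/negPn/negP => w0.
have wp : 0 < nsq w by rewrite lt_def w0 nsq_ge0.
(* [K] is any positive bound for [qf A w]; with the step [nsq w / K] the linear term is twice the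
   bound on the quadratic one. *)
have [K K0 hK] : exists2 K, 0 < K & qf A w <= K.
  by exists (Num.max 1 (qf A w)); rewrite ?lt_max ?ltr01 ?le_max ?lexx ?orbT.
have := Ap (v + (- (nsq w / K)) *: w).
rewrite -/(qf _ _) qfDv // Av add0r qfZv -scalemxAr scalemxE e1 => h.
have : (nsq w / K) ^+ 2 * qf A w <= (nsq w / K) ^+ 2 * K.
  by rewrite ler_wpM2l // sqr_ge0.
have -> : (nsq w / K) ^+ 2 * K = nsq w ^+ 2 / K by field; rewrite gt_eqF.
move=> h2; have h3 : 0 <= - (nsq w ^+ 2 / K).
  apply: le_trans h _; rewrite sqrrN.
  rewrite (_ : 2 * (- (nsq w / K) * nsq w) = - 2 * (nsq w ^+ 2 / K)); last by ring.
  by lra.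
by move: h3; rewrite oppr_ge0 leNgt divr_gt0 // exprn_gt0.
Qed.

Lemma qf_continuous m (A : 'M[R]_m) : continuous (fun w : 'rV[R]_m => qf A w^T).
Proof.
have -> : (fun w : 'rV[R]_m => qf A w^T) =
    (fun w : 'rV[R]_m => \sum_i \sum_j w 0 i * A i j * w 0 j).
  apply/funext => w; rewrite qf_sum; apply: eq_bigr => i _.
  by apply: eq_bigr => j _; rewrite !mxE.
move=> w; apply: (cvg_sumr (F := nbhs w)) => i; apply: (cvg_sumr (F := nbhs w)) => j.
apply: cvgM; last exact: coord_continuous.
by apply: cvgM; [exact: coord_continuous | exact: cvg_cst].
Qed.

Lemma coord_le_nsq m (v : 'cV[R]_m) i : v i 0 ^+ 2 <= nsq v.
Proof.
rewrite /nsq (bigD1 i) //= lerDl; apply: sumr_ge0 => k _; exact: sqr_ge0.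
Qed.

Lemma mx_norm_leP m k (A : 'M[R]_(m, k)) (x : R) : 0 <= x ->
  (forall i j, `|A i j| <= x) -> `|A| <= x.
Proof.
by move=> x0 h; rewrite /Num.Def.normr /= mx_normrE; apply: bigmax_le.
Qed.

Lemma entry_le_norm m k (A : 'M[R]_(m, k)) i j : `|A i j| <= `|A|.
Proof.
by rewrite [leRHS]/Num.Def.normr /= mx_normrE; apply: (le_bigmax _ _ (i, j)).
Qed.

Lemma unit_sphere_compact m : compact [set w : 'rV[R]_m | nsq w^T = 1].
Proof.
apply: bounded_closed_compact.
  exists 1; split; first exact: num_real.
  move=> y y1 w /= hw; apply: mx_norm_leP => [|i j]; first exact: le_trans (ltW y1).
  rewrite ord1; apply: le_trans (ltW y1).
  rewrite -[1]sqrtr1 -sqrtr_sqr ler_wsqrtr // -hw.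
  by have := coord_le_nsq w^T j; rewrite mxE.
have -> : [set w : 'rV[R]_m | nsq w^T = 1] =
    (fun w : 'rV[R]_m => qf 1%:M w^T) @^-1` [set 1].
  by apply/seteqP; split=> w /=; rewrite nsqE.
apply: closed_comp => [w _|]; first exact: qf_continuous.
exact: closed_eq.
Qed.

(** The Rayleigh quotient attains its minimum on the compact unit sphere; other vectors follow by
    homogeneity. *)
Lemma qf_min m (A : 'M[R]_m.+1) :
  exists v : 'cV[R]_m.+1, nsq v = 1 /\ forall w, qf A v * nsq w <= qf A w.
Proof.
have S0 : [set w : 'rV[R]_m.+1 | nsq w^T = 1] !=set0.
  exists (delta_mx 0 0); rewrite /= /nsq (bigD1 ord0) //= big1 ?addr0.
    by rewrite !mxE !eqxx expr1n.
  by move=> i /negbTE i0; rewrite !mxE i0 expr0n.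
have [|c cS hc] := EVT_min_rV (f := fun w : 'rV[R]_m.+1 => qf A w^T)
  S0 (@unit_sphere_compact _).
  by apply: continuous_subspaceT; exact: qf_continuous.
exists c^T; split; first by move: cS; rewrite inE.
move=> w; have [->|w0] := eqVneq w 0.
  by rewrite nsqE {2 3}/qf !mulmx0 mxE mulr0.
have np : 0 < nsq w by rewrite nsq_gt0.
have := hc ((Num.sqrt (nsq w))^-1 *: w^T).
rewrite inE /= [_^T]linearZ /= trmxK nsqZ qfZv exprVn sqr_sqrtr ?nsq_ge0 //.
by rewrite mulVf ?gt_eqF // => /(_ erefl); rewrite mulrC ler_pdivlMr.
Qed.

(** A minimiser of the Rayleigh quotient is a null vector of the semi-definite form [A - (min) I],
    hence an eigenvector by [psd_qf0]. *)
Lemma sym_eigenvector m (A : 'M[R]_m.+1) : A^T = A ->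
  exists (v : 'cV[R]_m.+1) a, nsq v = 1 /\ A *m v = a *: v.
Proof.
move=> As; have [v [v1 hv]] := qf_min A; exists v, (qf A v); split=> //.
have /psd_qf0 : possemidef (A - (qf A v)%:M).
  split; first by rewrite [_^T]linearB /= As tr_scalar_mx.
  move=> w; rewrite -/(qf _ _) qfB -scalemx1 qfZ -nsqE subr_ge0; exact: hv.
move=> h; apply/eqP; rewrite -subr_eq0 -mul_scalar_mx -mulmxBl; apply/eqP/h.
by rewrite qfB -scalemx1 qfZ -nsqE v1 mulr1 subrr.
Qed.

(** The reflection in the hyperplane orthogonal to [e - v] exchanges the unit vectors [e] and [v];
    the case [e = v] is separate. *)
Lemma householder m (v : 'cV[R]_m.+1) : nsq v = 1 ->
  exists H : 'M[R]_m.+1,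
    [/\ H^T = H, H *m H = 1%:M & H *m delta_mx 0 0 = v].
Proof.
move=> v1; set e := delta_mx 0 0 : 'cV[R]_m.+1; set w := e - v.
have [w0|w0] := eqVneq w 0.
  exists 1%:M; rewrite tr_scalar_mx !mul1mx; split=> //.
  by apply/eqP; rewrite -subr_eq0; apply/eqP.
have np : nsq w != 0 by rewrite nsq_eq0.
have wtw : w^T *m w = (nsq w)%:M.
  by rewrite [LHS]mx11_scalar -/(qf _ _) nsqE /qf mulmx1.
have e1 : nsq e = 1.
  rewrite /nsq (bigD1 ord0) //= big1 ?addr0 ?mxE ?eqxx ?expr1n //.
  by move=> i /negbTE i0; rewrite !mxE i0 expr0n.
have nw : nsq w = 2 - 2 * v 0 0.
  rewrite nsqE /w qfDv ?tr_scalar_mx // -nsqE e1 -scaleN1r qfZv -nsqE v1 mulmx1.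
  rewrite -scalemxAr scalemxE (_ : (e^T *m v) 0 0 = v 0 0); first by ring.
  rewrite mxE (bigD1 ord0) //= big1 ?addr0 ?mxE ?eqxx ?mul1r //.
  by move=> i /negbTE i0; rewrite !mxE i0 mul0r.
have wte : w^T *m e = (1 - v 0 0)%:M.
  rewrite [LHS]mx11_scalar; congr _%:M.
  rewrite mxE (bigD1 ord0) //= big1 ?addr0 ?mxE ?eqxx ?mulr1 //.
  by move=> i /negbTE i0; rewrite !mxE i0 mulr0.
exists (1%:M - (2 / nsq w) *: (w *m w^T)); split.
- by rewrite [LHS]linearB /= tr_scalar_mx [X in _ - X]linearZ /= trmx_mul trmxK.
- rewrite mulmxBl mul1mx mulmxBr mulmx1 -scalemxAl -!scalemxAr !scalerA.
  rewrite mulmxA -(mulmxA w) wtw -mulmxA mul_scalar_mx -scalemxAr scalerA opprB addrA.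
  rewrite (_ : 2 / nsq w * (2 / nsq w) * nsq w = 2 / nsq w + 2 / nsq w); last by field.
  by rewrite scalerDl addrA subrK addrK.
- rewrite mulmxBl mul1mx -scalemxAl -mulmxA wte mul_mx_scalar scalerA.
  rewrite (_ : 2 / nsq w * (1 - v 0 0) = 1); last by rewrite nw in np *; field.
  by rewrite scale1r /w opprB addrC subrK.
Qed.

Lemma spectral_step m (A H : 'M[R]_(1 + m)) a (D P : 'M[R]_m) d :
  H^T = H -> H *m H = 1%:M -> A = H *m block_mx a%:M 0 0 D *m H ->
  P^T *m P = 1%:M -> D = P^T *m diag_mx d *m P ->
  exists (Q : 'M[R]_(1 + m)) (e : 'rV[R]_(1 + m)),
    Q^T *m Q = 1%:M /\ A = Q^T *m diag_mx e *m Q.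
Proof.
move=> Hs HH -> PP eB; exists (block_mx 1%:M 0 0 P *m H), (row_mx a%:M d); split.
  rewrite trmx_mul mulmxA -(mulmxA H^T) tr_block_mx mulmx_block !trmx0.
  rewrite !mulmx0 !mul0mx !addr0 !add0r tr_scalar_mx mulmx1 PP.
  by rewrite -scalar_mx_block mulmx1 Hs HH.
rewrite trmx_mul Hs !mulmxA; congr (_ *m H); rewrite -!mulmxA; congr (_ *m _).
rewrite tr_block_mx !trmx0 tr_scalar_mx diag_mx_row !mulmx_block.
rewrite !mulmx0 !mul0mx !addr0 !add0r mul1mx mulmx1 eB mulmxA; congr block_mx; rewrite ?mulmx0 //.
by apply/matrixP => i j; rewrite !mxE !ord1.
Qed.

Lemma spectral_theorem m (A : 'M[R]_m) : A^T = A ->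
  exists (P : 'M[R]_m) (d : 'rV[R]_m),
    P^T *m P = 1%:M /\ A = P^T *m diag_mx d *m P.
Proof.
elim: m A => [|m IH] A As.
  by exists 1%:M, 0; split; apply/matrixP => -[].
have [v [a [v1 Av]]] := sym_eigenvector As.
have [H [Hs HH He]] := householder v1.
have [B BE0] : exists B : 'M[R]_(1 + m), B = H *m A *m H by exists (H *m A *m H).
have Bs : B^T = B by rewrite BE0 !trmx_mul Hs As mulmxA.
have Be : B *m delta_mx 0 0 = a *: (delta_mx 0 0 : 'cV[R]_m.+1).
  by rewrite BE0 -(mulmxA _ H) He -mulmxA Av -scalemxAr -He mulmxA HH mul1mx.
have Bl i : B i 0 = a *+ (i == 0).
  have /matrixP/(_ i 0) := Be; rewrite -colE !mxE eqxx andbT => ->.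
  by case: eqP => _; rewrite ?mulr1 ?mulr0.
have drs : (drsubmx B)^T = drsubmx B by rewrite trmx_drsub Bs.
have [P [d [PP eB]]] := IH _ drs.
(* The first column of [B] is a multiple of the first basis vector, and by symmetry so is the first
   row: the induction hypothesis applies to the remaining block. *)
have BE : B = block_mx a%:M 0 0 (drsubmx B).
  rewrite -[LHS]submxK; congr block_mx; apply/matrixP => i j; rewrite !mxE.
  - by rewrite !ord1 !lshift0 Bl eqxx.
  - by rewrite -[B]Bs mxE ord1 lshift0 Bl.
  - by rewrite ord1 lshift0 Bl.
apply: (spectral_step Hs HH _ PP eB (a := a)); rewrite -BE BE0.
by rewrite !mulmxA HH mul1mx -mulmxA HH mulmx1.
Qed.

End LinearAlgebra.

(** * The trace pairing and the order of positive semi-definite matrices *)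

Section Psd.
Variable R : realType.

Definition ip m (A B : 'M[R]_m) : R := \tr (A *m B).

Lemma ipDl m (A B C : 'M[R]_m) : ip (A + B) C = ip A C + ip B C.
Proof. by rewrite /ip mulmxDl mxtraceD. Qed.

Lemma ipDr m (A B C : 'M[R]_m) : ip C (A + B) = ip C A + ip C B.
Proof. by rewrite /ip mulmxDr mxtraceD. Qed.

Lemma ipZl m a (A B : 'M[R]_m) : ip (a *: A) B = a * ip A B.
Proof. by rewrite /ip -scalemxAl mxtraceZ. Qed.

Lemma ipZr m a (A B : 'M[R]_m) : ip A (a *: B) = a * ip A B.
Proof. by rewrite /ip -scalemxAr mxtraceZ. Qed.

Lemma ipNr m (A B : 'M[R]_m) : ip A (- B) = - ip A B.
Proof. by rewrite -scaleN1r ipZr mulN1r. Qed.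

Lemma ipNl m (A B : 'M[R]_m) : ip (- A) B = - ip A B.
Proof. by rewrite -scaleN1r ipZl mulN1r. Qed.

Lemma ipBl m (A B C : 'M[R]_m) : ip (A - B) C = ip A C - ip B C.
Proof. by rewrite ipDl ipNl. Qed.

Lemma ipBr m (A B C : 'M[R]_m) : ip C (A - B) = ip C A - ip C B.
Proof. by rewrite ipDr ipNr. Qed.

Lemma ip0r m (A : 'M[R]_m) : ip A 0 = 0.
Proof. by rewrite /ip mulmx0 mxtrace0. Qed.

Lemma ipC m (A B : 'M[R]_m) : ip A B = ip B A.
Proof. exact: mxtrace_mulC. Qed.

Lemma ipE m (A B : 'M[R]_m) : ip A B = \sum_i \sum_j A i j * B j i.
Proof. by apply: eq_bigr => i _; rewrite mxE. Qed.

Lemma ip1r m (A : 'M[R]_m) : ip A 1%:M = \tr A.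
Proof. by rewrite /ip mulmx1. Qed.

Lemma ip_vv m (A : 'M[R]_m) (v : 'cV_m) : ip (v *m v^T) A = qf A v.
Proof. by rewrite /ip -mulmxA mxtrace_mulC trace_mx11. Qed.

Lemma psdD m (A B : 'M[R]_m) : possemidef A -> possemidef B -> possemidef (A + B).
Proof.
case=> As Ap [Bs Bp]; split; first by rewrite [_^T]linearD /= As Bs.
by move=> v; rewrite -/(qf _ _) qfD addr_ge0 //; [exact: Ap | exact: Bp].
Qed.

Lemma psdZ m a (A : 'M[R]_m) : 0 <= a -> possemidef A -> possemidef (a *: A).
Proof.
move=> a0 [As Ap]; split; first by rewrite [_^T]linearZ /= As.
by move=> v; rewrite -/(qf _ _) qfZ mulr_ge0 //; exact: Ap.
Qed.

Lemma psd_vv m (v : 'cV[R]_m) : possemidef (v *m v^T).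
Proof.
split; first by rewrite trmx_mul trmxK.
move=> w; rewrite mulmxA -mulmxA mxE big_ord1.
rewrite (_ : (v^T *m w) 0 0 = (w^T *m v) 0 0) -?expr2 ?sqr_ge0 //.
by rewrite -(trmxK (v^T *m w)) mxE trmx_mul trmxK.
Qed.

Lemma posdefZ m a (A : 'M[R]_m) : 0 < a -> posdef A -> posdef (a *: A).
Proof.
move=> a0 [As Ap]; split; first by rewrite [_^T]linearZ /= As.
by move=> v v0; rewrite -/(qf _ _) qfZ mulr_gt0 //; exact: Ap.
Qed.

Lemma posdefDpsd m (A B : 'M[R]_m) : posdef A -> possemidef B -> posdef (A + B).
Proof.
case=> As Ap [Bs Bp]; split; first by rewrite [_^T]linearD /= As Bs.
by move=> v v0; rewrite -/(qf _ _) qfD ltr_wpDr //; [exact: Bp | exact: Ap].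
Qed.

Lemma posdef1 m : posdef (1%:M : 'M[R]_m).
Proof.
by split=> [|v]; rewrite ?tr_scalar_mx // -/(qf _ _) -nsqE nsq_gt0.
Qed.

Lemma spectral_qf m (P : 'M[R]_m) (d : 'rV[R]_m) v :
  qf (P^T *m diag_mx d *m P) v = \sum_i d 0 i * (P *m v) i 0 ^+ 2.
Proof.
rewrite qf_congr qf_sum; apply: eq_bigr => i _; rewrite (bigD1 i) //= big1.
  by rewrite addr0 !mxE eqxx mulr1n; ring.
by move=> j /negbTE ji; rewrite [diag_mx _ _ _]mxE eq_sym ji mulr0n mulr0 mul0r.
Qed.

Lemma orthogonal_nsq m (P : 'M[R]_m) v : P^T *m P = 1%:M -> nsq (P *m v) = nsq v.
Proof. by move=> PP; rewrite !nsqE -qf_congr mulmx1 PP. Qed.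

Lemma spectral_eigen m (P : 'M[R]_m) (d : 'rV[R]_m) i : P^T *m P = 1%:M ->
  qf (P^T *m diag_mx d *m P) (P^T *m delta_mx i 0) = d 0 i.
Proof.
move=> /mulmx1C PP; rewrite spectral_qf mulmxA PP mul1mx (bigD1 i) //= big1.
  by rewrite mxE !eqxx expr1n mulr1 addr0.
by move=> j /negbTE ji; rewrite mxE ji expr0n mulr0.
Qed.

Lemma psd_gram m (A : 'M[R]_m) : possemidef A -> exists B : 'M[R]_m, A = B^T *m B.
Proof.
case=> As Ap; have [P [d [PP eA]]] := spectral_theorem As.
have d0 i : 0 <= d 0 i by rewrite -(spectral_eigen d i PP) -eA; exact: Ap.
exists (diag_mx (\row_i Num.sqrt (d 0 i)) *m P).
rewrite trmx_mul tr_diag_mx mulmxA -(mulmxA P^T) mulmx_diag {1}eA.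
by do 2 congr (_ *m _); congr diag_mx; apply/rowP => i; rewrite !mxE -expr2 sqr_sqrtr.
Qed.

(** With [A = C^T C], the pairing is the sum of the values of [B] at the columns of [C^T]. *)
Lemma ip_psd_ge0 m (A B : 'M[R]_m) : possemidef A -> possemidef B -> 0 <= ip A B.
Proof.
move=> /psd_gram[C ->] [Bs Bp]; rewrite /ip -mulmxA mxtrace_mulC.
apply: sumr_ge0 => i _; have := Bp (C^T *m delta_mx i 0).
rewrite trmx_mul trmxK trmx_delta !mulmxA -colE -!mulmxA -rowE.
by rewrite [X in 0 <= X]mxE mxE.
Qed.

Lemma posdef_lb m (A : 'M[R]_m) : posdef A ->
  exists2 c, 0 < c & possemidef (A - c%:M).
Proof.
case: m A => [|m] A [As Ap].
  exists 1; rewrite ?ltr01 //; split; first by apply/matrixP => -[].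
  by move=> v; rewrite (flatmx0 v) mulmx0 mxE.
have [v [v1 hv]] := qf_min A.
have v0 : v != 0 by rewrite -nsq_gt0 v1 ltr01.
exists (qf A v); first exact: Ap.
split; first by rewrite [_^T]linearB /= As tr_scalar_mx.
by move=> w; rewrite -/(qf _ _) qfB -scalemx1 qfZ -nsqE subr_ge0; exact: hv.
Qed.

(** Quantitative positivity: pairing with a positive definite form controls the trace, which by
    [psd_norm] dominates the norm on the cone. This is the source of all transversality estimates
    below. *)
Lemma ip_posdef_ge m (r : 'M[R]_m) : posdef r ->
  exists2 c, 0 < c & forall A, possemidef A -> c * \tr A <= ip A r.
Proof.
move=> /posdef_lb[c c0 rc]; exists c => // A Ap; rewrite -subr_ge0.
have := ip_psd_ge0 Ap rc; rewrite ipBr -scalemx1 ipZr ip1r //.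
Qed.

Lemma qf_delta m (A : 'M[R]_m) i : qf A (delta_mx i 0) = A i i.
Proof. by rewrite /qf trmx_delta -rowE -colE !mxE. Qed.

Lemma psd_diag_ge0 m (A : 'M[R]_m) i : possemidef A -> 0 <= A i i.
Proof. by move=> [_ Ap]; rewrite -qf_delta; exact: Ap. Qed.

Lemma psd_tr_ge0 m (A : 'M[R]_m) : possemidef A -> 0 <= \tr A.
Proof. by move=> Ap; apply: sumr_ge0 => i _; exact: psd_diag_ge0. Qed.

(** Positivity on [e_i + e_j] and [e_i - e_j] gives [2 |A i j| <= A i i + A j j]. *)
Lemma psd_entry m (A : 'M[R]_m) i j : possemidef A -> `|A i j| <= \tr A.
Proof.
move=> Ap; have d k : A k k <= \tr A.
  by rewrite /mxtrace (bigD1 k) //= lerDl; apply: sumr_ge0 => l _; exact: psd_diag_ge0.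
have As := Ap.1.
have e : ((delta_mx i 0 : 'cV[R]_m)^T *m A *m (delta_mx j 0 : 'cV[R]_m)) 0 0 = A i j.
  by rewrite trmx_delta -rowE -colE !mxE.
have h1 := Ap.2 (delta_mx i 0 + delta_mx j 0).
have h2 := Ap.2 (delta_mx i 0 + (-1) *: delta_mx j 0).
rewrite -/(qf _ _) qfDv // !qf_delta e in h1.
rewrite -/(qf _ _) qfDv // qfZv !qf_delta -scalemxAr scalemxE e in h2.
by have di := d i; have dj := d j; rewrite ler_norml; apply/andP; split; nra.
Qed.

Lemma psd_norm m (A : 'M[R]_m) : possemidef A -> `|A| <= \tr A.
Proof.
by move=> Ap; apply: mx_norm_leP => [|i j]; [exact: psd_tr_ge0 | exact: psd_entry].
Qed.

Lemma psd_tr_eq0 m (A : 'M[R]_m) : possemidef A -> \tr A = 0 -> A = 0.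
Proof.
by move=> /psd_norm h t0; apply/eqP; rewrite -normr_le0 -t0.
Qed.

Lemma psd_tr_gt0 m (A : 'M[R]_m) : possemidef A -> A != 0 -> 0 < \tr A.
Proof.
move=> Ap A0; rewrite lt_def psd_tr_ge0 // andbT.
by apply: contra_neq A0; exact: psd_tr_eq0.
Qed.

Lemma ip_norm m (A B : 'M[R]_m) : `|ip A B| <= m%:R ^+ 2 * `|A| * `|B|.
Proof.
rewrite ipE; apply: le_trans (ler_norm_sum _ _ _) _.
have -> : m%:R ^+ 2 * `|A| * `|B| = \sum_(i < m) \sum_(j < m) (`|A| * `|B|).
  rewrite !sumr_const !card_ord; set x := `|A| * _.
  by rewrite -[_ *+ m *+ m]mulr_natr -[x *+ m]mulr_natr /x; ring.
apply: ler_sum => i _; apply: le_trans (ler_norm_sum _ _ _) _.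
by apply: ler_sum => j _; rewrite normrM ler_pM // entry_le_norm.
Qed.

Lemma qf_norm m (A : 'M[R]_m) v : `|qf A v| <= m%:R ^+ 2 * `|A| * nsq v.
Proof.
have vp := psd_vv v.
have e : \tr (v *m v^T) = nsq v by rewrite -ip1r ip_vv nsqE.
rewrite -ip_vv; apply: le_trans (ip_norm _ _) _.
by rewrite -e mulrAC ler_wpM2l ?psd_norm // mulr_ge0 // exprn_ge0.
Qed.

Lemma tr_norm m (A : 'M[R]_m) : `|\tr A| <= m%:R * `|A|.
Proof.
apply: le_trans (ler_norm_sum _ _ _) _.
rewrite mulr_natl -[X in _ *+ X]card_ord -sumr_const.
  by apply: ler_sum => i _; exact: entry_le_norm.
Qed.

Lemma posdef_open m (A : 'M[R]_m) : posdef A ->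
  exists2 e, 0 < e & forall B, B^T = B -> `|B - A| <= e -> posdef B.
Proof.
move=> Ap; have [c c0 hc] := posdef_lb Ap.
have n0 : 0 < m%:R ^+ 2 + 1 :> R by rewrite ltr_wpDl // exprn_ge0.
exists (c / (2 * (m%:R ^+ 2 + 1))); first by rewrite divr_gt0 // mulr_gt0.
move=> B Bs h; split=> // v v0; have vp : 0 < nsq v by rewrite nsq_gt0.
have := qf_norm (B - A) v; rewrite qfB ler_norml => /andP[h1 _].
have h2 := hc.2 v; rewrite -/(qf _ _) qfB -scalemx1 qfZ -nsqE in h2.
have h3 : m%:R ^+ 2 * `|B - A| * nsq v <= c / 2 * nsq v.
  rewrite ler_wpM2r //; first exact: ltW.
  apply: (@le_trans _ _ ((m%:R ^+ 2 + 1) * (c / (2 * (m%:R ^+ 2 + 1))))).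
    by rewrite ler_pM // ?exprn_ge0 // lerDl.
  by rewrite le_eqVlt; apply/orP; left; apply/eqP; field; rewrite gt_eqF.
have h4 : 0 < c * nsq v by rewrite mulr_gt0.
rewrite -/(qf _ _); lra.
Qed.

Definition psd_le m (A B : 'M[R]_m) := possemidef (B - A).

(* Unlike closeness in norm, this is invariant under [A |-> g A g^T], which makes the
   constants of the local analysis uniform along orbits. *)
Definition psd_close m e (A B : 'M[R]_m) :=
  psd_le ((1 - e) *: A) B /\ psd_le B ((1 + e) *: A).

(** [B - A] is the difference of [B - (1 - e) A], which is semi-definite of trace at most
    [2 e tr A], and of [e A]. *)
Lemma psd_close_norm m e (A B : 'M[R]_m) : 0 <= e -> possemidef A -> psd_close e A B ->
  `|B - A| <= 3 * e * \tr A.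
Proof.
move=> e0 Ap [h1 h2].
have t1 := psd_tr_ge0 Ap.
have -> : B - A = (B - (1 - e) *: A) - e *: A.
  by apply/matrixP => i j; rewrite !mxE; ring.
apply: le_trans (ler_normB _ _) _.
have h3 : \tr (B - (1 - e) *: A) <= 2 * e * \tr A.
  have := psd_tr_ge0 h2; rewrite !raddfB /= !mxtraceZ => h; lra.
have := psd_norm h1; rewrite normrZ (ger0_norm e0).
have := ler_wpM2l e0 (psd_norm Ap); nra.
Qed.

End Psd.

(** * Min-max estimates for singular values *)

Section SingularValues.
Variable R : realType.

Lemma char_poly_spectral m (P : 'M[R]_m) (d : 'rV[R]_m) : P^T *m P = 1%:M ->
  char_poly (P^T *m diag_mx d *m P) = \prod_i ('X - (d 0 i)%:P).
Proof.
move=> PP; have mPP : map_mx polyC P^T *m map_mx polyC P = 1%:M.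
  by rewrite -map_mxM PP map_scalar_mx.
have -> : \prod_i ('X - (d 0 i)%:P) = char_poly (diag_mx d).
  rewrite char_poly_trig; last exact: diag_mx_is_trig.
  by apply: eq_bigr => i _; rewrite mxE eqxx mulr1n.
rewrite /char_poly /char_poly_mx.
have -> : 'X%:M - map_mx polyC (P^T *m diag_mx d *m P) =
    map_mx polyC P^T *m ('X%:M - map_mx polyC (diag_mx d)) *m map_mx polyC P.
  by rewrite mulmxBr mulmxBl mul_mx_scalar -scalemxAl mPP scalemx1 !map_mxM.
by rewrite !det_mulmx mulrAC -det_mulmx mPP det1 mul1r.
Qed.

(** Dimension count: a [k]-dimensional subspace meets the common kernel of fewer than [k] linear
    forms, here the spectral coordinates in [S]. *)
Lemma eigen_count m k (P : 'M[R]_m) (S : {pred 'I_m}) (B : 'M[R]_(m, k)) :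
  (#|S| < k)%N -> (forall y : 'cV_k, B *m y = 0 -> y = 0) ->
  exists y : 'cV[R]_k, B *m y != 0 /\ forall i, i \in S -> (P *m (B *m y)) i 0 = 0.
Proof.
move=> Sk Binj; pose N := rowsub (@enum_val _ S) (P *m B).
have rN : (\rank N^T < k)%N.
  by rewrite mxrank_tr; apply: leq_ltn_trans (rank_leq_row _) Sk.
have /rowV0Pn[y /sub_kermxP yN y0] : kermx N^T != 0.
  by rewrite -mxrank_eq0 mxrank_ker subn_eq0 -ltnNge.
exists y^T; split.
  by apply: contra_neq y0 => /Binj /(congr1 trmx); rewrite trmxK trmx0.
move=> i iS; have /(congr1 trmx) := yN; rewrite trmx_mul trmxK trmx0 => h.
have /matrixP/(_ (enum_rank_in iS i) 0) := h.
by rewrite /N mul_rowsub_mx -mulmxA mxE enum_rankK_in // [X in _ = X]mxE.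
Qed.

Lemma sorted_nth_ge (s : seq R) i j : sorted (fun x y : R => y <= x) s ->
  (i <= j)%N -> (j < size s)%N -> s`_j <= s`_i.
Proof.
move=> ss ij js.
have tr : transitive (fun x y : R => y <= x) by move=> y x z yx zy; exact: le_trans zy yx.
have rf : reflexive (fun x y : R => y <= x) by move=> x.
have is_ := leq_ltn_trans ij js.
exact: (sorted_leq_nth tr rf 0 ss i j is_ js ij).
Qed.

Lemma size_index_ord m : size (index_enum 'I_m) = m.
Proof. by rewrite -sum1_size sum1_card card_ord. Qed.

(** If the entry of index [j] failed the downward closed [P], so would the [j + 1] largest entries,
    but at most [j] may fail. *)
Lemma count_sorted (P : pred R) (s : seq R) j :
  sorted (fun x y : R => y <= x) s -> (j < size s)%N ->
  {in s &, forall x y, x <= y -> P y -> P x} -> (size s <= j + count P s)%N -> P s`_j.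
Proof.
move=> ss js Pd h; apply/negPn/negP => nP.
have c0 : count P (take j.+1 s) = 0%N.
  apply/eqP; rewrite -leqn0 leqNgt -has_count; apply/hasPn => x xt.
  have xs := mem_take xt.
  case/(nthP 0) : xt => i; rewrite size_take => hi.
  have [ij is_] : (i <= j)%N /\ (i < size s)%N.
    move: hi; case: ifP => h1 hi; last by rewrite -ltnS (leq_trans hi) // leqNgt h1.
    by rewrite -ltnS hi (leq_trans hi).
  rewrite nth_take // => xe; apply: contra nP => Px; apply: (Pd _ x) => //; first exact: mem_nth.
  by rewrite -xe; apply: sorted_nth_ge.
have := h; rewrite -{2}(cat_take_drop j.+1 s) count_cat c0 add0n.
have := count_size P (drop j.+1 s); rewrite size_drop; lia.
Qed.

Lemma count_sorted_ge (P : pred R) (s : seq R) j :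
  sorted (fun x y : R => y <= x) s -> (j < size s)%N ->
  {in s &, forall x y, x <= y -> P x -> P y} -> (j < count P s)%N -> P s`_j.
Proof.
move=> ss js Pd h; apply/negPn/negP => nP.
have c0 : count P (drop j s) = 0%N.
  apply/eqP; rewrite -leqn0 leqNgt -has_count; apply/hasPn => x xt.
  have xs := mem_drop xt.
  case/(nthP 0) : xt => i; rewrite size_drop => hi; rewrite nth_drop => xe.
  apply: contra nP => Px; apply: (Pd x) => //; first exact: mem_nth.
  by rewrite -xe; apply: sorted_nth_ge; rewrite ?leq_addr // -ltn_subRL.
have := h; rewrite -(cat_take_drop j s) count_cat c0 addn0.
have := count_size P (take j s); rewrite size_take; case: ltnP; lia.
Qed.

Lemma singular_values_exist m (M : 'M[R]_m) : exists s, is_singular_values M s.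
Proof.
have Ms : (M^T *m M)^T = M^T *m M by rewrite trmx_mul trmxK.
have [P [d [PP eA]]] := spectral_theorem Ms.
have d0 i : 0 <= d 0 i.
  rewrite -(spectral_eigen d i PP) -eA.
  by rewrite -{1}[M^T]mulmx1 qf_congr -nsqE nsq_ge0.
set t := [seq Num.sqrt (d 0 i) | i <- index_enum 'I_m].
exists (sort (fun x y => y <= x) t); split.
- by apply: sort_sorted => x y; exact: le_total.
- by apply/allP => x; rewrite mem_sort => /mapP[i _ ->]; exact: sqrtr_ge0.
rewrite eA char_poly_spectral //.
rewrite (perm_big t) /=; last by rewrite perm_sort.
rewrite /t big_map; apply: eq_bigr => i _.
by rewrite sqr_sqrtr.
Qed.

Lemma sigma_singular m (M : 'M[R]_m) :
  exists2 s, is_singular_values M s & forall k, sigma k M = s`_k.-1.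
Proof.
by case: (xgetPex [::] (singular_values_exist M)) => *; eexists; first (split; eassumption).
Qed.

(** Unique factorisation of the characteristic polynomial gives equality of multisets, which is what
    the counting arguments below use. *)
Lemma singular_values_spectral m (M P : 'M[R]_m) (d : 'rV[R]_m) s :
  P^T *m P = 1%:M -> M^T *m M = P^T *m diag_mx d *m P -> is_singular_values M s ->
  perm_eq [seq x ^+ 2 | x <- s] [seq d 0 i | i <- index_enum 'I_m].
Proof.
move=> PP eA [_ _ es]; apply: prod_XsubC_eq.
by rewrite !big_map -es eA char_poly_spectral.
Qed.

Lemma nsq_gram m (M P : 'M[R]_m) (d : 'rV[R]_m) v :
  M^T *m M = P^T *m diag_mx d *m P ->
  nsq (M *m v) = \sum_i d 0 i * (P *m v) i 0 ^+ 2.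
Proof. by move=> eA; rewrite nsqE -qf_congr mulmx1 eA spectral_qf. Qed.

Lemma sigma_ge0 m (M : 'M[R]_m) k : 0 <= sigma k M.
Proof.
have [s [_ s0 _] ->] := sigma_singular M.
by have [h|h] := ltnP k.-1 (size s); [apply: (allP s0); exact: mem_nth | rewrite nth_default].
Qed.

(** One half of Courant-Fischer. If fewer than [k] eigenvalues of [M^T M] were at most [a], the
    image of [B] would contain a nonzero vector without components along their eigenvectors, and [M]
    stretches it too much. The [k] smallest singular values start at the index [m - k + 1]. *)
Lemma sigma_upper m k (M : 'M[R]_m) (B : 'M[R]_(m, k)) a :
  (0 < k <= m)%N -> (forall y : 'cV_k, B *m y = 0 -> y = 0) ->
  (forall y, nsq (M *m (B *m y)) <= a * nsq (B *m y)) ->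
  sigma (m - k).+1 M ^+ 2 <= a.
Proof.
move=> /andP[k0 km] Binj hB.
have Ms : (M^T *m M)^T = M^T *m M by rewrite trmx_mul trmxK.
have [P [d [PP eA]]] := spectral_theorem Ms.
have [s sv ->] := sigma_singular M; have pe := singular_values_spectral PP eA sv.
have ss : size s = m by have := perm_size pe; rewrite !size_map size_index_ord.
have [srt s0 _] := sv.
apply: (count_sorted (P := fun x => x ^+ 2 <= a)) => //; first by rewrite ss /=; lia.
  move=> x y xs ys xy; apply: le_trans.
  by rewrite lerXn2r ?nnegrE //; apply: (allP s0).
have -> : count (fun x => x ^+ 2 <= a) s = #|[pred i | d 0 i <= a]|.
  rewrite -(count_map (fun x => x ^+ 2) (fun x => x <= a)) (permP pe) count_map.
  by rewrite -sum1_count -sum1_card; apply: eq_bigl => i.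
rewrite ss /=; suff : (k <= #|[pred i | (d (0%R : 'I_1) i <= a)%R]|)%N by lia.
rewrite leqNgt; apply/negP => h.
have [y [By0 hy]] := eigen_count P h Binj.
have := hB y; rewrite (nsq_gram _ eA) -(orthogonal_nsq _ PP) /nsq mulr_sumr leNgt.
move=> /negP; apply; rewrite -subr_gt0 -sumrB.
have {}By0 : P *m (B *m y) != 0 by rewrite -nsq_eq0 (orthogonal_nsq _ PP) nsq_eq0.
have [i0 hi0] : exists i, (P *m (B *m y)) i 0 != 0.
  apply/existsP; rewrite -negb_forall; apply: contra_neqN By0 => /forallP h0.
  by apply/matrixP => i j; rewrite ord1 [RHS]mxE; apply/eqP.
have t i : 0 <= d 0 i * (P *m (B *m y)) i 0 ^+ 2 - a * (P *m (B *m y)) i 0 ^+ 2.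
  rewrite -mulrBl; have [da|da] := leP (d 0 i) a.
    by rewrite hy ?inE // expr0n mulr0.
  by rewrite mulr_ge0 ?sqr_ge0 // subr_ge0 ltW.
rewrite (bigD1 i0) //= ltr_wpDr ?sumr_ge0 // -mulrBl mulr_gt0 //.
  rewrite subr_gt0 ltNge; apply: contra hi0 => da; apply/eqP; exact: hy.
by rewrite lt_def sqr_ge0 sqrf_eq0 hi0.
Qed.

(** The other half of Courant-Fischer, with the eigenvalues that are at least [a]. *)
Lemma sigma_lower m k (M : 'M[R]_m) (B : 'M[R]_(m, k)) a :
  (0 < k <= m)%N -> (forall y : 'cV_k, B *m y = 0 -> y = 0) ->
  (forall y, a * nsq (B *m y) <= nsq (M *m (B *m y))) ->
  a <= sigma k M ^+ 2.
Proof.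
move=> /andP[k0 km] Binj hB.
have Ms : (M^T *m M)^T = M^T *m M by rewrite trmx_mul trmxK.
have [P [d [PP eA]]] := spectral_theorem Ms.
have [s sv ->] := sigma_singular M; have pe := singular_values_spectral PP eA sv.
have ss : size s = m by have := perm_size pe; rewrite !size_map size_index_ord.
have [srt s0 _] := sv.
apply: (count_sorted_ge (P := fun x => a <= x ^+ 2)) => //; first by rewrite ss /=; lia.
  move=> x y xs ys xy /le_trans; apply.
  by rewrite lerXn2r ?nnegrE //; apply: (allP s0).
have -> : count (fun x => a <= x ^+ 2) s = #|[pred i | a <= d 0 i]|.
  rewrite -(count_map (fun x => x ^+ 2) (fun x => a <= x)) (permP pe) count_map.
  by rewrite -sum1_count -sum1_card; apply: eq_bigl => i.
suff : (k <= #|[pred i | (a <= d (0%R : 'I_1) i)%R]|)%N by lia.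
rewrite leqNgt; apply/negP => h.
have [y [By0 hy]] := eigen_count P h Binj.
have := hB y; rewrite (nsq_gram _ eA) -(orthogonal_nsq _ PP) /nsq mulr_sumr leNgt.
move=> /negP; apply; rewrite -subr_gt0 -sumrB.
have {}By0 : P *m (B *m y) != 0 by rewrite -nsq_eq0 (orthogonal_nsq _ PP) nsq_eq0.
have [i0 hi0] : exists i, (P *m (B *m y)) i 0 != 0.
  apply/existsP; rewrite -negb_forall; apply: contra_neqN By0 => /forallP h0.
  by apply/matrixP => i j; rewrite ord1 [RHS]mxE; apply/eqP.
have t i : 0 <= a * (P *m (B *m y)) i 0 ^+ 2 - d 0 i * (P *m (B *m y)) i 0 ^+ 2.
  rewrite -mulrBl; have [da|da] := leP a (d 0 i).
    by rewrite hy ?inE // expr0n mulr0.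
  by rewrite mulr_ge0 ?sqr_ge0 // subr_ge0 ltW.
rewrite (bigD1 i0) //= ltr_wpDr ?sumr_ge0 // -mulrBl mulr_gt0 //.
  rewrite subr_gt0 ltNge; apply: contra hi0 => da; apply/eqP; exact: hy.
by rewrite lt_def sqr_ge0 sqrf_eq0 hi0.
Qed.

Lemma sigma_decr m (M : 'M[R]_m) k : (0 < k < m)%N -> sigma k.+1 M <= sigma k M.
Proof.
have Ms : (M^T *m M)^T = M^T *m M by rewrite trmx_mul trmxK.
have [P [d [PP eA]]] := spectral_theorem Ms.
have [s sv e] := sigma_singular M; have pe := singular_values_spectral PP eA sv.
have ss : size s = m by have := perm_size pe; rewrite !size_map size_index_ord.
have [srt _ _] := sv; move=> /andP[k0 km]; rewrite !e /=.
by apply: sorted_nth_ge => //; rewrite ?ss //; lia.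
Qed.

Lemma sigma_gt0 m (M : 'M[R]_m) k : \det M != 0 -> (0 < k <= m)%N -> 0 < sigma k M.
Proof.
move=> Mu /andP[k0 km].
have Ms : (M^T *m M)^T = M^T *m M by rewrite trmx_mul trmxK.
have [P [d [PP eA]]] := spectral_theorem Ms.
have [s sv e] := sigma_singular M; have pe := singular_values_spectral PP eA sv.
have ss : size s = m by have := perm_size pe; rewrite !size_map size_index_ord.
rewrite lt_def sigma_ge0 andbT e; apply/negP => /eqP h.
have : s`_k.-1 ^+ 2 \in [seq d 0 i | i <- index_enum 'I_m].
  by rewrite -(perm_mem pe); apply: map_f; rewrite mem_nth // ss; lia.
rewrite h expr0n /= => /mapP[i _ di].
have : \det (M^T *m M) = 0.
  by rewrite eA !det_mulmx det_diag (bigD1 i) //= -di mul0r mulr0 mul0r.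
by move/eqP; rewrite det_mulmx det_tr mulf_eq0 orbb (negbTE Mu).
Qed.

End SingularValues.

(** * Convex duality for the cone of positive definite forms *)

Section Farkas.
Variable R : realType.

(** By this identity [B |-> B^T B] maps the unit sphere onto the semi-definite matrices of trace 1,
    so minimisation over the latter takes place on a sphere. *)
Lemma nsq_mxvec m (B : 'M[R]_m) : nsq (mxvec B)^T = \tr (B^T *m B).
Proof.
rewrite /nsq /mxtrace (reindex _ (curry_mxvec_bij _ _)) /=.
rewrite (eq_bigr (fun ij => (mxvec B)^T (mxvec_index ij.1 ij.2) 0 ^+ 2)); last by case.
rewrite -(pair_bigA _ (fun i j => (mxvec B)^T (mxvec_index i j) 0 ^+ 2)) /= exchange_big /=.
apply: eq_bigr => i _; rewrite mxE; apply: eq_bigr => j _.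
by rewrite mxE mxvecE mxE expr2.
Qed.

Lemma ip_gram_continuous m (L : 'M[R]_m) :
  continuous (fun w : 'rV[R]_(m * m) => ip ((vec_mx w)^T *m vec_mx w) L).
Proof.
have -> : (fun w : 'rV[R]_(m * m) => ip ((vec_mx w)^T *m vec_mx w) L) =
    (fun w : 'rV[R]_(m * m) => \sum_i \sum_j
       (\sum_k w 0 (mxvec_index k i) * w 0 (mxvec_index k j)) * L j i).
  apply/funext => w; rewrite ipE; apply: eq_bigr => i _; apply: eq_bigr => j _.
  by rewrite mxE; congr (_ * _); apply: eq_bigr => k _; rewrite !mxE.
move=> w; apply: (cvg_sumr (F := nbhs w)) => i; apply: (cvg_sumr (F := nbhs w)) => j.
apply: cvgM; last exact: cvg_cst.
by apply: (cvg_sumr (F := nbhs w)) => k; apply: cvgM; exact: coord_continuous.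
Qed.

(* The minimum of [\sum_i (tr A (l i))^2] over the compact convex set of PSD
   matrices of trace 1: if it is attained at A0 with a nonzero value, then
   [\sum_i (tr A0 (l i)) l i] is positive definite by the first order condition. *)
Lemma psd_alternative m (I : finType) (l : I -> 'M[R]_m) :
  (forall i, (l i)^T = l i) ->
  (forall c : I -> R, ~ posdef (\sum_i c i *: l i)) ->
  exists A, [/\ possemidef A, \tr A = 1 & forall i, ip A (l i) = 0].
Proof.
case: m l => [|m] l ls nl.
  case: (nl (fun=> 0)); split; first by apply/matrixP => -[].
  by move=> v; rewrite (flatmx0 v) eqxx.
set F := fun w : 'rV[R]_(m.+1 * m.+1) =>
  \sum_i ip ((vec_mx w)^T *m vec_mx w) (l i) ^+ 2.
have Fc : continuous F.
  move=> w; apply: (cvg_sumr (F := nbhs w)) => i; rewrite expr2.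
  by under eq_fun do rewrite expr2; apply: cvgM; exact: ip_gram_continuous.
have S0 : [set w : 'rV[R]_(m.+1 * m.+1) | nsq w^T = 1] !=set0.
  exists (delta_mx 0 (mxvec_index ord0 ord0)).
  rewrite /= /nsq (bigD1 (mxvec_index ord0 ord0)) //= big1 ?addr0.
    by rewrite !mxE !eqxx expr1n.
  by move=> i /negbTE i0; rewrite !mxE i0 andbF expr0n.
have [|w0 w0S hw] := EVT_min_rV (f := F) S0 (@unit_sphere_compact R _).
  exact: continuous_subspaceT.
move: w0S; rewrite inE /= => w0S.
set A0 := (vec_mx w0)^T *m vec_mx w0.
have A0p : possemidef A0.
  split; first by rewrite /A0 trmx_mul trmxK.
  move=> v; rewrite -/(qf _ _) /A0 -{1}[(vec_mx w0)^T]mulmx1 qf_congr -nsqE.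
  exact: nsq_ge0.
have A0t : \tr A0 = 1 by rewrite /A0 -nsq_mxvec vec_mxK.
have {}hw A : possemidef A -> \tr A = 1 ->
    \sum_i ip A0 (l i) ^+ 2 <= \sum_i ip A (l i) ^+ 2.
  move=> /psd_gram[B ->] At; have := hw (mxvec B).
  by rewrite inE /= nsq_mxvec /F mxvecK => /(_ At).
exists A0; split=> //.
set c := fun i => ip A0 (l i).
have first_order v : nsq v = 1 -> \sum_i c i ^+ 2 <= \sum_i c i * qf (l i) v.
  move=> v1; rewrite -subr_ge0 -sumrB leNgt; apply/negP => D0.
  set D := (X in X < 0) in D0.
  pose E := \sum_i (qf (l i) v - c i) ^+ 2.
  have E0 : 0 <= E by apply: sumr_ge0 => i _; exact: sqr_ge0.
  (* Moving [A0] towards [v v^T] by [t] changes the objective by [t (2 D + t E)], negative as soon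
     as [t E <= - D]. *)
  pose t := Num.min 1 (- D / (E + 1)).
  have t0 : 0 < t by rewrite lt_min ltr01 divr_gt0 ?oppr_gt0 // ltr_wpDl.
  have t1 : t <= 1 by rewrite ge_min lexx.
  have tE : t * E <= - D.
    have : t <= - D / (E + 1) by rewrite ge_min lexx orbT.
    rewrite ler_pdivlMr ?ltr_wpDl // mulrDr mulr1; apply: le_trans.
    by rewrite lerDl ltW.
  have Ap : possemidef ((1 - t) *: A0 + t *: (v *m v^T)).
    by apply: psdD; apply: psdZ; rewrite ?subr_ge0 ?(ltW t0) //; exact: psd_vv.
  have At : \tr ((1 - t) *: A0 + t *: (v *m v^T)) = 1.
    rewrite mxtraceD !mxtraceZ A0t -(ip1r (v *m _)) ip_vv -nsqE v1; ring.
  have := hw _ Ap At; rewrite -subr_ge0 -sumrB.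
  have -> : \sum_i (ip ((1 - t) *: A0 + t *: (v *m v^T)) (l i) ^+ 2 - ip A0 (l i) ^+ 2)
     = t * (2 * D + t * E).
    rewrite /D /E !mulr_sumr -big_split /= mulr_sumr; apply: eq_bigr => i _.
    by rewrite ipDl !ipZl ip_vv /c; ring.
  by rewrite pmulr_rge0 // => h; lra.
have S0' : \sum_i c i ^+ 2 = 0.
  apply/eqP; apply/negPn/negP => Sn.
  have Sp : 0 < \sum_i c i ^+ 2.
    by rewrite lt_def Sn; apply: sumr_ge0 => i _; exact: sqr_ge0.
  apply: (nl c); split.
    by rewrite raddf_sum /=; apply: eq_bigr => i _; rewrite linearZ /= ls.
  move=> v v0; have vp : 0 < nsq v by rewrite nsq_gt0.
  pose u := (Num.sqrt (nsq v))^-1 *: v.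
  have uv : v = Num.sqrt (nsq v) *: u.
    by rewrite scalerA divff ?scale1r // gt_eqF // sqrtr_gt0.
  have u1 : nsq u = 1.
    by rewrite nsqZ exprVn sqr_sqrtr ?nsq_ge0 // mulVf // gt_eqF.
  have := first_order u u1 => h.
  rewrite -/(qf _ _) uv qfZv mulr_gt0 //; first by rewrite exprn_gt0 // sqrtr_gt0.
  apply: lt_le_trans Sp (le_trans h _); rewrite le_eqVlt; apply/orP; left; apply/eqP.
  rewrite /qf mulmx_sumr mulmx_suml summxE; apply: eq_bigr => i _.
  by rewrite -[RHS]/(qf (c i *: l i) u) qfZ.
move=> i; apply/eqP; rewrite -sqrf_eq0.
by rewrite (psumr_eq0P _ S0') // => k _; exact: sqr_ge0.
Qed.

Lemma qf0 m (A : 'M[R]_m) : qf A 0 = 0.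
Proof. by rewrite /qf mulmx0 mxE. Qed.

Lemma qf_block m (a b : 'M[R]_m) (v w : 'cV[R]_m) :
  qf (block_mx a 0 0 b) (col_mx v w) = qf a v + qf b w.
Proof.
rewrite /qf tr_col_mx mul_row_block !mulmx0 addr0 add0r mul_row_col.
by rewrite addmxE.
Qed.

Lemma posdef_block m (a b : 'M[R]_m) :
  posdef (block_mx a 0 0 b) -> posdef a /\ posdef b.
Proof.
case; rewrite tr_block_mx !trmx0 => /eq_block_mx[as_ _ _ bs] h; split; split=> // v v0.
  have := h (col_mx v 0); rewrite -/(qf _ _) qf_block qf0 addr0.
  by apply; apply: contra_neq v0 => /(congr1 usubmx); rewrite col_mxKu linear0.
have := h (col_mx 0 v); rewrite -/(qf _ _) qf_block qf0 add0r.
by apply; apply: contra_neq v0 => /(congr1 dsubmx); rewrite col_mxKd linear0.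
Qed.

Lemma psd_ulsub m (A : 'M[R]_(m + m)) : possemidef A -> possemidef (ulsubmx A).
Proof.
case=> As Ap; split; first by rewrite trmx_ulsub As.
move=> v; have := Ap (col_mx v 0); rewrite -{1}[A]submxK tr_col_mx trmx0.
by rewrite mul_row_block mul_row_col !mul0mx mulmx0 !addr0.
Qed.

Lemma psd_drsub m (A : 'M[R]_(m + m)) : possemidef A -> possemidef (drsubmx A).
Proof.
case=> As Ap; split; first by rewrite trmx_drsub As.
move=> v; have := Ap (col_mx 0 v); rewrite -{1}[A]submxK tr_col_mx trmx0.
by rewrite mul_row_block mul_row_col !mul0mx mulmx0 !add0r.
Qed.

Lemma ip_block m (A : 'M[R]_(m + m)) (a b : 'M[R]_m) :
  ip A (block_mx a 0 0 b) = ip (ulsubmx A) a + ip (drsubmx A) b.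
Proof.
rewrite /ip -{1}[A]submxK mulmx_block !mulmx0 !addr0 !add0r.
by rewrite mxtrace_block.
Qed.

(** [psd_alternative] for block diagonal matrices: two simultaneous definiteness conditions become
    one, and the certificate acts only through its two diagonal blocks. *)
Lemma psd_pair_alternative m (I : finType) (a b : I -> 'M[R]_m) :
  (forall i, (a i)^T = a i) -> (forall i, (b i)^T = b i) ->
  (forall c : I -> R, ~ (posdef (\sum_i c i *: a i) /\ posdef (\sum_i c i *: b i))) ->
  exists A B, [/\ possemidef A, possemidef B, A + B != 0
    & forall i, ip A (a i) + ip B (b i) = 0].
Proof.
move=> as_ bs h.
have [i|c|A [Ap At hA]] := @psd_alternative _ I (fun i => block_mx (a i) 0 0 (b i)).
- by rewrite tr_block_mx !trmx0 as_ bs.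
- have -> : \sum_i c i *: block_mx (a i) 0 0 (b i) =
     block_mx (\sum_i c i *: a i) 0 0 (\sum_i c i *: b i).
    elim/big_rec3: _ => [|i x y z _ ->]; first by rewrite block_mx0.
    by rewrite scale_block_mx add_block_mx !scaler0 !addr0.
  by move=> /posdef_block; exact: h.
- exists (ulsubmx A), (drsubmx A); split; [exact: psd_ulsub|exact: psd_drsub| |].
    apply: contra_eq_neq At => h0; rewrite -[A]submxK mxtrace_block -mxtraceD h0.
    by rewrite mxtrace0 eq_sym oner_eq0.
  by move=> i; rewrite -ip_block.
Qed.

End Farkas.

(** * Lifting paths and squares *)

Section IntervalInduction.
Variable R : realType.

(** Compactness of the interval, for a property of subintervals that is additive and local: the
    supremum of the [x] with [P 0 x] can be passed unless it is 1. The continuation arguments below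
    rest on this form. *)
Lemma interval_induction (P : R -> R -> Prop) :
  (forall a b c, a <= b -> b <= c -> P a b -> P b c -> P a c) ->
  (forall x, 0 <= x <= 1 -> exists2 d, 0 < d & forall a b, 0 <= a -> a <= x ->
     x <= b -> b <= 1 -> x - d < a -> b < x + d -> P a b) ->
  P 0 1.
Proof.
move=> Padd Ploc.
pose A := [set x | 0 <= x <= 1 /\ P 0 x].
have A0 : A 0.
  split; first by rewrite lexx ler01.
  have [|d d0 h] := Ploc 0; first by rewrite lexx ler01.
  by apply: h; rewrite ?lexx ?ler01 // ?ltrBlDr ?add0r.
have ubA : ubound A 1 by move=> x [/andP[]].
have supA : has_sup A by split; [exists 0 | exists 1].
have s0 : 0 <= sup A by exact: sup_upper_bound.
have s1 : sup A <= 1 by apply: ge_sup => //; exists 0.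
have [|d d0 h] := Ploc (sup A); first by rewrite s0 s1.
have [x [/andP[x0 x1] Px] xs] := sup_adherent d0 supA.
have xle : x <= sup A by apply: sup_upper_bound => //; split=> //; rewrite x0 x1.
pose b := Num.min 1 (sup A + d / 2).
have sb : sup A <= b by rewrite le_min s1 lerDl divr_ge0 // ltW.
have b1 : b <= 1 by rewrite ge_min lexx.
have Pb : P 0 b.
  apply: (Padd _ _ _ x0 (le_trans xle sb) Px); apply: h => //.
  by rewrite /b gt_min; apply/orP; right; lra.
have : b <= sup A by apply: sup_upper_bound => //; split=> //; rewrite b1 (le_trans s0).
rewrite ge_min => /orP[s1'|]; last by lra.
by have -> : 1 = b by apply/eqP; rewrite eq_le b1 (le_trans s1').
Qed.

End IntervalInduction.

Section Nbhs.

Lemma nbhsS (T : topologicalType) (x : T) (A B : set T) :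
  (forall y, A y -> B y) -> nbhs x A -> nbhs x B.
Proof. exact: filterS. Qed.

Lemma nbhsI2 (T : topologicalType) (x : T) (A B : set T) :
  nbhs x A -> nbhs x B -> nbhs x (fun y => A y /\ B y).
Proof. by move=> h1 h2; exact: filterI h1 h2. Qed.

Lemma hausdorff_sep (T : topologicalType) (x y : T) : hausdorff_space T -> x <> y ->
  exists A B, [/\ nbhs x A, nbhs y B & forall z, A z -> B z -> False].
Proof.
rewrite open_hausdorff => h /eqP /h[[A B] /= [Ax By] [oA oB /eqP AB]].
rewrite !inE in Ax By; exists A, B; split; try exact: open_nbhs_nbhs.
by move=> z Az Bz; have : (A `&` B) z by []; rewrite AB.
Qed.

End Nbhs.

Section Lifting.
Variables (R : realType) (Z : topologicalType).
Hypothesis hZ : hausdorff_space Z.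

Lemma within_contP (T U : topologicalType) (K : set T) (f : T -> U) :
  {within K, continuous f} <->
  forall x, K x -> forall O, nbhs (f x) O -> \forall y \near x, K y -> O (f y).
Proof. by rewrite subspace_continuousP. Qed.

Lemma within_cont_sub (T U : topologicalType) (K K' : set T) (f : T -> U) :
  K' `<=` K -> {within K, continuous f} -> {within K', continuous f}.
Proof.
move=> KK /within_contP h; apply/within_contP => x Kx O fO.
by apply: nbhsS (h x (KK _ Kx) O fO) => y + /KK.
Qed.

Lemma within_cont_eq (T U : topologicalType) (K : set T) (f g : T -> U) :
  (forall x, K x -> f x = g x) -> {within K, continuous f} -> {within K, continuous g}.
Proof.
move=> fg /within_contP h; apply/within_contP => x Kx N; rewrite -(fg x Kx) => hN.
by apply: nbhsS (h x Kx N hN) => y hy Ky; rewrite -fg //; exact: hy.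
Qed.

(** Interval induction on the property that one point of agreement in [[a, b]] forces agreement on
    [[a, b]]. Near a point where [f] and [g] agree this is the local uniqueness; near any other
    point they have no agreement at all, as [Z] is Hausdorff. *)
Lemma agree_on_path (f g : R -> Z) t0 :
  {within `[0, 1], continuous f} -> {within `[0, 1], continuous g} ->
  (forall t, 0 <= t <= 1 -> exists2 W, nbhs (f t) W & \forall t' \near t,
     0 <= t' <= 1 -> W (f t') -> W (g t') -> f t' = g t') ->
  0 <= t0 <= 1 -> f t0 = g t0 -> forall t, 0 <= t <= 1 -> f t = g t.
Proof.
move=> /within_contP cf /within_contP cg hu ht0 e0.
pose P a b := (exists2 t, a <= t <= b & f t = g t) ->
  forall t, a <= t <= b -> f t = g t.
suff : P 0 1 by apply; exists t0.
apply: interval_induction.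
  move=> a b c ab bc Pab Pbc [t /andP[ta tc] et].
  have eb : f b = g b.
    have [tb|bt] := leP t b.
      by apply: Pab; [exists t; rewrite ?ta | rewrite ab lexx].
    by apply: Pbc; [exists t; rewrite ?tc ?ltW | rewrite bc lexx].
  move=> u /andP[ua uc]; have [ub|bu] := leP u b.
    by apply: Pab; [exists b; rewrite ?ab ?lexx | rewrite ua ub].
  by apply: Pbc; [exists b; rewrite ?bc ?lexx | rewrite uc ltW].
move=> x x01.
have xi : `[0, 1]%classic x by rewrite /= in_itv.
suff [d d0 hd] : exists2 d, 0 < d & forall a b, 0 <= a -> a <= x ->
     x <= b -> b <= 1 -> x - d < a -> b < x + d -> P a b by exists d.
have [ex|nx] := pselect (f x = g x).
  have [W Wx hW] := hu x x01.
  have Wg : nbhs (g x) W by rewrite -ex.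
  have /nbhs_ballP[d /= d0 hd] : \forall y \near x, 0 <= y <= 1 -> f y = g y.
    apply: nbhsS (nbhsI2 hW (nbhsI2 (cf x xi W Wx) (cg x xi W Wg))).
    move=> y [h1 [h2 h3]] y01.
    by apply: h1 => //; [apply: h2 | apply: h3]; rewrite /= in_itv.
  exists d => // a b a0 ax xb b1 ad bd _ t /andP[ta tb]; apply: hd.
    by rewrite /ball /= ltr_distl; apply/andP; split; lra.
  by apply/andP; split; lra.
have [A [B [fA gB AB]]] := hausdorff_sep hZ nx.
have /nbhs_ballP[d /= d0 hd] := nbhsI2 (cf x xi A fA) (cg x xi B gB).
exists d => // a b a0 ax xb b1 ad bd [t /andP[ta tb] et].
have [|/= hA hB] := hd t.
  by rewrite /ball /= ltr_distl; apply/andP; split; lra.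
have ti : `[0, 1]%classic t by rewrite /= in_itv /=; apply/andP; split; lra.
by case: (AB (f t)); [exact: hA | rewrite et; exact: hB].
Qed.

Definition rect (a b c d : R) : set (R * R) :=
  [set z | (a <= z.1 <= b) /\ (c <= z.2 <= d)].

Definition segpt (p q : R * R) (t : R) : R * R :=
  (p.1 + t * (q.1 - p.1), p.2 + t * (q.2 - p.2)).

Lemma segpt0 p q : segpt p q 0 = p.
Proof. by case: p => a b; rewrite /segpt !mul0r !addr0. Qed.

Lemma segpt1 p q : segpt p q 1 = q.
Proof. by case: p q => a b [c d]; rewrite /segpt /=; congr pair; ring. Qed.

Definition convex2 (K : set (R * R)) :=
  forall p q t, K p -> K q -> 0 <= t <= 1 -> K (segpt p q t).

Lemma rect_convex a b c d : convex2 (rect a b c d).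
Proof.
move=> p q t [/andP[p1 p2] /andP[p3 p4]] [/andP[q1 q2] /andP[q3 q4]] /andP[t0 t1].
by split; apply/andP; split; rewrite /segpt /=; nra.
Qed.

Lemma convex2I K K' : convex2 K -> convex2 K' -> convex2 (K `&` K').
Proof. by move=> h h' p q t [? ?] [? ?] t01; split; [exact: h | exact: h']. Qed.

Lemma rect_closed a b c d : closed (rect a b c d).
Proof.
have -> : rect a b c d = (fst @^-1` `[a, b]%classic) `&` (snd @^-1` `[c, d]%classic).
  by apply/seteqP; split=> -[x y] /=; rewrite /rect /= !in_itv.
apply: closedI; apply: closed_comp => [z _|]; try exact: itv_closed.
  exact: cvg_fst.
exact: cvg_snd.
Qed.

Lemma segpt_continuous p q : continuous (segpt p q).
Proof.
have lin (a b : R) : continuous (fun t : R => a + t * b).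
  by move=> t; apply: cvgD; [exact: cvg_cst | apply: cvgMr_tmp; exact: cvg_id].
move=> t O [[A B] /= [hA hB] hO].
by apply: nbhsS (nbhsI2 (lin _ _ t A hA) (lin _ _ t B hB)) => y [hy1 hy2]; exact: hO.
Qed.

Lemma segpt_within (K : set (R * R)) (h : R * R -> Z) p q : convex2 K -> K p -> K q ->
  {within K, continuous h} -> {within `[0, 1], continuous (h \o segpt p q)}.
Proof.
move=> Kc Kp Kq /within_contP ch; apply/within_contP => t; rewrite /= in_itv /= => t01 O hO.
have := segpt_continuous (ch _ (Kc _ _ _ Kp Kq t01) O hO).
by apply: nbhsS => y /=; rewrite in_itv /= => h1 y01; apply/h1/Kc.
Qed.

Variable L : R * R -> Z -> Prop.
Let Q := rect 0 1 0 1.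

(** The relation [L] is abstract because squares are lifted in two situations: through the covering,
    where [L a z] is [p z = F a], and to zeros of a family of forms, where it says that [z] is a
    zero of the form at [a]. *)
Definition is_lift (K : set (R * R)) (f : R * R -> Z) :=
  {within K, continuous f} /\ forall a, K a -> L a (f a).

Definition liftable (K : set (R * R)) :=
  forall a z, K a -> L a z -> exists2 f, is_lift K f & f a = z.

Hypothesis L_uniq : forall a z, Q a -> L a z -> exists O W,
  [/\ nbhs a O, nbhs z W & forall b z1 z2, O b -> Q b -> W z1 -> W z2 ->
       L b z1 -> L b z2 -> z1 = z2].

Lemma lift_unique K f g p : K `<=` Q -> convex2 K -> is_lift K f -> is_lift K g ->
  K p -> f p = g p -> forall q, K q -> f q = g q.
Proof.
move=> KQ Kc [cf Lf] [cg Lg] Kp e q Kq.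
have sK t : 0 <= t <= 1 -> K (segpt p q t) by exact: Kc.
rewrite -(segpt1 p q); apply: (@agree_on_path (f \o segpt p q) (g \o segpt p q) 0).
- exact: (segpt_within Kc).
- exact: (segpt_within Kc).
- move=> t t01; have [N [W [Oa Wz hW]]] := L_uniq (KQ _ (sK t t01)) (Lf _ (sK t t01)).
  exists W => //; have := segpt_continuous Oa.
  apply: nbhsS => t' Ot' t'01 /= W1 W2.
  by apply: (hW (segpt p q t')) => //; [apply: KQ; apply: sK | apply: Lf; apply: sK
    | apply: Lg; apply: sK].
- by rewrite lexx ler01.
- by rewrite /= segpt0.
- by rewrite ler01 lexx.
Qed.

Lemma liftable_sub K K' : K' `<=` K -> liftable K -> liftable K'.
Proof.
move=> KK h a z Ka Lz; have [f [cf Lf] fa] := h a z (KK _ Ka) Lz.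
exists f => //; split; first exact: within_cont_sub cf.
by move=> b /KK; exact: Lf.
Qed.

(** Lifts chosen to agree at [p] agree on the convex intersection, and continuous maps paste along
    closed sets. *)
Lemma liftableU K1 K2 p : K1 `<=` Q -> K2 `<=` Q -> closed K1 -> closed K2 ->
  convex2 K1 -> convex2 K2 -> K1 p -> K2 p ->
  liftable K1 -> liftable K2 -> liftable (K1 `|` K2).
Proof.
move=> Q1 Q2 c1 c2 v1 v2 p1 p2 l1 l2 a z Ka Lz.
have [f1 [f2 [l1' l2' ep ea]]] : exists f1 f2, [/\ is_lift K1 f1, is_lift K2 f2,
    f1 p = f2 p & (K1 a /\ f1 a = z) \/ (K2 a /\ f2 a = z)].
  case: Ka => Ka.
    have [f1 l1' e1] := l1 a z Ka Lz.
    have [f2 l2' e2] := l2 p (f1 p) p2 (l1'.2 _ p1).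
    by exists f1, f2; split=> //; left.
  have [f2 l2' e2] := l2 a z Ka Lz.
  have [f1 l1' e1] := l1 p (f2 p) p1 (l2'.2 _ p2).
  by exists f1, f2; split=> //; right.
have e12 : forall q, K1 q -> K2 q -> f1 q = f2 q.
  move=> q k1 k2; apply: (@lift_unique (K1 `&` K2) f1 f2 p) => //.
  - by move=> ? [? _]; exact: Q1.
  - exact: convex2I.
  - by split; [apply: within_cont_sub l1'.1 => ? [] | move=> b [? _]; exact: l1'.2].
  - by split; [apply: within_cont_sub l2'.1 => ? [] | move=> b [_ ?]; exact: l2'.2].
pose f b := if pselect (K1 b) then f1 b else f2 b.
have fe1 b : K1 b -> f b = f1 b by rewrite /f; case: pselect.
have fe2 b : K2 b -> f b = f2 b by rewrite /f; case: pselect => // ? ?; exact: e12.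
exists f; last by case: ea => -[ka <-]; [exact: fe1 | exact: fe2].
split; last by move=> b [kb|kb]; [rewrite fe1 //; exact: l1'.2 | rewrite fe2 //; exact: l2'.2].
apply: withinU_continuous => //.
  by apply: within_cont_eq l1'.1 => b kb; rewrite fe1.
by apply: within_cont_eq l2'.1 => b kb; rewrite fe2.
Qed.

Hypothesis L_loc : forall a, Q a -> exists2 O, nbhs a O & liftable (O `&` Q).

Lemma L_loc_rect a : Q a -> exists2 d, 0 < d & forall x y z w,
  0 <= x -> y <= 1 -> 0 <= z -> w <= 1 -> a.1 - d < x -> y < a.1 + d ->
  a.2 - d < z -> w < a.2 + d -> liftable (rect x y z w).
Proof.
move=> Qa; have [N Oa lO] := L_loc Qa.
have [d /= d0 hd] := (iffLR (nbhs_ballP _ _)) Oa.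
exists d => // x y z w x0 y1 z0 w1 xd yd zd wd; apply: liftable_sub lO => b.
move=> [/andP[b1 b2] /andP[b3 b4]]; split; last first.
  by split; apply/andP; split; lra.
by apply: hd; split; rewrite /ball /= ltr_distl; apply/andP; split; lra.
Qed.

(** Two nested interval inductions: the outer one glues vertical strips, the inner one builds a
    strip around each [s] by stacking small rectangles. *)
Lemma square_liftable : liftable Q.
Proof.
have rQ a b c d : 0 <= a -> b <= 1 -> 0 <= c -> d <= 1 -> rect a b c d `<=` Q.
  by move=> ? ? ? ? z [/andP[? ?] /andP[? ?]]; split; apply/andP; split; lra.
pose P a b := 0 <= a -> b <= 1 -> liftable (rect a b 0 1).
suff : P 0 1 by apply.
apply: interval_induction => [a b c ab bc Pab Pbc a0 c1|s /andP[s0 s1]].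
  have b0 : 0 <= b by lra.
  have b1 : b <= 1 by lra.
  apply: liftable_sub (@liftableU (rect a b 0 1) (rect b c 0 1) (b, 0) _ _ _ _ _ _ _ _
    (Pab a0 b1) (Pbc b0 c1)).
  - move=> z [/andP[z1 z2] z3]; have [zb|bz] := leP z.1 b.
      by left; split=> //; rewrite z1 zb.
    by right; split=> //; rewrite z2 ltW.
  - by apply: rQ.
  - by apply: rQ.
  - exact: rect_closed.
  - exact: rect_closed.
  - exact: rect_convex.
  - exact: rect_convex.
  - by split => /=; rewrite ?ab ?lexx ?ler01.
  - by split => /=; rewrite ?bc ?lexx ?ler01.
(* The width [d] may depend on the height interval; two pieces stacked on each other keep the
   smaller width. *)
pose T a b := exists2 d, 0 < d & forall x y, 0 <= x -> y <= 1 -> x <= s -> s <= y ->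
  s - d < x -> y < s + d -> 0 <= a -> b <= 1 -> liftable (rect x y a b).
have [d d0 hd] : T 0 1.
  apply: interval_induction => [a b c ab bc [d d0 hd] [e e0 he]|t /andP[t0 t1]].
    exists (Num.min d e); first by rewrite lt_min d0.
    move=> x y x0 y1 xs sy xd yd a0 c1.
    have md : Num.min d e <= d by rewrite ge_min lexx.
    have me : Num.min d e <= e by rewrite ge_min lexx orbT.
    have b0 : 0 <= b by lra.
    have b1 : b <= 1 by lra.
    have lab : liftable (rect x y a b) by apply: hd => //; lra.
    have lbc : liftable (rect x y b c) by apply: he => //; lra.
    apply: liftable_sub (@liftableU _ _ (s, b) _ _ _ _ _ _ _ _ lab lbc).
    - move=> z [z3 /andP[z1 z2]]; have [zb|bz] := leP z.2 b.
        by left; split=> //; rewrite z1 zb.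
      by right; split=> //; rewrite z2 ltW.
    - by apply: rQ.
    - by apply: rQ.
    - exact: rect_closed.
    - exact: rect_closed.
    - exact: rect_convex.
    - exact: rect_convex.
    - by split => /=; rewrite ?xs ?sy ?ab ?lexx.
    - by split => /=; rewrite ?xs ?sy ?bc ?lexx.
  have [|d d0 hd] := @L_loc_rect (s, t); first by split; apply/andP; split.
  exists d => // a b a0 at_ tb b1 ad bd; exists d => // x y x0 y1 xs sy xd yd _ _.
  exact: hd.
exists d => // a b a0 as_ sb b1 ad bd _ _; apply: hd => //.
Qed.

End Lifting.

(** * Coverings and deck transformations *)

Section Covering.
Variables (R : realType) (X S : topologicalType) (p : X -> S).

Definition sheet (W : set X) := [/\ open W, open (p @` W), set_inj W p
  & forall W', open W' -> W' `<=` W -> open (p @` W')].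

Lemma sheet_inj W x y : sheet W -> W x -> W y -> p x = p y -> x = y.
Proof. by case=> _ _ h _ Wx Wy; apply: h; rewrite inE. Qed.

Lemma sheet_section W x0 : sheet W -> W x0 -> exists g : S -> X,
  [/\ forall s, (p @` W) s -> W (g s) /\ p (g s) = s,
      forall w, W w -> g (p w) = w
    & forall s, (p @` W) s -> forall N, nbhs (g s) N -> nbhs s (g @^-1` N)].
Proof.
move=> sW Wx0; have [oW oU pinj pop] := sW.
pose g s := xget x0 [set w | W w /\ p w = s].
have gP s : (p @` W) s -> W (g s) /\ p (g s) = s.
  by move=> [w Ww ws]; apply: (@xgetPex _ x0 [set w | W w /\ p w = s]); exists w.
have gK w : W w -> g (p w) = w.
  move=> Ww; have pw : (p @` W) (p w) by exists w.
  by apply: (sheet_inj sW) => //; [exact: (gP _ pw).1 | exact: (gP _ pw).2].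
exists g; split=> // s Us N; rewrite nbhsE => -[B [oB Bg] BN].
have oBW : open (p @` (B `&` W)) by apply: pop => [|? []//]; exact: openI.
have : nbhs s (p @` (B `&` W)).
  apply: open_nbhs_nbhs; split=> //; have [Wg pg] := gP _ Us.
  by exists (g s).
by apply: nbhsS => _ [w [Bw Ww] <-]; rewrite /preimage /= gK //; exact: BN.
Qed.

Hypothesis hp : covering_map p.

Lemma covering_continuous : continuous p.
Proof. by case: hp. Qed.

Lemma evenly_covered (s : S) : exists2 U, nbhs s U & forall x, U (p x) ->
  exists W, [/\ sheet W, W x & p @` W = U].
Proof.
case: hp => cp sp /(_ s)[U [F [oU Us eU tF hF]]].
exists U; first exact: open_nbhs_nbhs.
move=> x Ux; have : (p @^-1` U) x by [].
rewrite eU => -[W FW Wx]; have [oW pW iW opW] := hF W FW.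
by exists W; split=> //; split=> //; rewrite pW.
Qed.

Lemma exists_sheet x : exists2 W, sheet W & W x.
Proof.
have [U Ux hU] := evenly_covered (p x).
by have [W [sW Wx _]] := hU x (nbhs_singleton Ux); exists W.
Qed.

Lemma sheet_nbhs W x : sheet W -> W x -> nbhs x W.
Proof. by case=> oW _ _ _ Wx; exact: open_nbhs_nbhs. Qed.

(** Points with distinct images are separated in [S]; distinct points of one fibre lie in distinct,
    hence disjoint, sheets. *)
Lemma covering_hausdorff : hausdorff_space S -> hausdorff_space X.
Proof.
move=> hS; move=> x y clxy; apply: contrapT => xy.
have [pxy|pxy] := pselect (p x = p y); last first.
  have [A [B [/covering_continuous hA /covering_continuous hB AB]]] := hausdorff_sep hS pxy.
  by have [z [Az Bz]] := clxy _ _ hA hB; exact: (AB (p z)).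
case: hp => cp sp /(_ (p x))[U [F [oU Us eU tF hF]]].
have : (p @^-1` U) x by []; rewrite eU => -[W FW Wx].
have : (p @^-1` U) y by rewrite /preimage /= -pxy.
rewrite eU => -[W' FW' Wy].
have [oW pW iW opW] := hF W FW; have [oW' _ _ _] := hF W' FW'.
have [z [Wz Wz']] := clxy W W' (open_nbhs_nbhs (conj oW Wx)) (open_nbhs_nbhs (conj oW' Wy)).
have e : W = W' by apply: tF => //; exists z.
by apply: xy; apply: iW; rewrite ?inE // e.
Qed.

Hypothesis hX : hausdorff_space X.

Definition path_in (O : set X) (c : R -> X) (x y : X) :=
  [/\ {within `[0, 1], continuous c}, c 0 = x, c 1 = y & forall t, 0 <= t <= 1 -> O (c t)].

Lemma cov_uniq (F : R * R -> S) a z : rect 0 1 0 1 a -> p z = F a -> exists O W,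
  [/\ nbhs a O, nbhs z W & forall b z1 z2, O b -> rect 0 1 0 1 b -> W z1 -> W z2 ->
       p z1 = F b -> p z2 = F b -> z1 = z2].
Proof.
move=> _ _; have [W sW Wz] := exists_sheet z.
exists setT, W; split=> //; [exact: filterT | exact: sheet_nbhs|].
by move=> b z1 z2 _ _ W1 W2 e1 e2; apply: (sheet_inj sW) => //; rewrite e1 e2.
Qed.

Lemma cov_square_liftable (F : R * R -> S) : {within rect 0 1 0 1, continuous F} ->
  liftable (fun a z => p z = F a) (rect 0 1 0 1).
Proof.
move=> /within_contP cF; apply: (square_liftable hX); first exact: cov_uniq.
move=> a Qa; have [U Ua hU] := evenly_covered (F a).
exists (fun b => rect 0 1 0 1 b -> U (F b)); first exact: cF.
move=> b z [Ub Qb] pz.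
have [|W [sW Wz pW]] := hU z; first by rewrite pz; exact: Ub.
have [g [gP gK gc]] := sheet_section sW Wz.
exists (g \o F); last by rewrite /= -pz gK.
split; last by move=> b' [Ub' Qb'] /=; apply: (gP _ _).2; rewrite pW; exact: Ub'.
apply/within_contP => b' [Ub' Qb'] N /= gN.
have : nbhs (F b') (g @^-1` N) by apply: gc => //; rewrite pW; exact: Ub'.
by move=> /(cF _ Qb'); apply: nbhsS => b'' h [_ Qb'']; exact: h.
Qed.

(** The path is read as a square that is constant in its first coordinate. *)
Lemma path_lifting (c : R -> S) z : {within `[0, 1], continuous c} -> p z = c 0 ->
  exists c' : R -> X, [/\ {within `[0, 1], continuous c'}, c' 0 = z
    & forall t, 0 <= t <= 1 -> p (c' t) = c t].
Proof.
move=> /within_contP cc z0.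
have cF : {within @rect R 0 1 0 1, continuous (c \o snd)}.
  apply/within_contP => -[s t] [_ /= t01] N cN.
  have ti : `[0, 1]%classic t by rewrite /= in_itv.
  have h := cc t ti N cN.
  exists (setT, [set t | `[0, 1]%classic t -> N (c t)]) => /=.
    by split; [exact: filterT|].
  by move=> -[s' t'] /= [_ h'] [_ /= t'01]; apply: h'; rewrite /= in_itv.
have [|//|f [cf Lf] f0] := cov_square_liftable cF (a := (0, 0)) (z := z).
  by split; rewrite /= lexx ler01.
have Q0 t : 0 <= t <= 1 -> @rect R 0 1 0 1 (0, t) by move=> t01; split; rewrite //= lexx ler01.
exists (fun t => f (0, t)); split=> //; last by move=> t t01; exact: (Lf _ (Q0 t t01)).
move/within_contP: cf => cf; apply/within_contP => t; rewrite /= in_itv /= => t01 N fN.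
have [[A B] /= [hA hB] hAB] := cf _ (Q0 t t01) N fN.
apply: nbhsS hB => t' Bt'; rewrite in_itv /= => t'01.
apply: (hAB (0, t')) => //; last exact: Q0.
by split=> //=; exact: nbhs_singleton hA.
Qed.

Lemma lift_path_unique (c c' : R -> X) t0 :
  {within `[0, 1], continuous c} -> {within `[0, 1], continuous c'} ->
  (forall t, 0 <= t <= 1 -> p (c t) = p (c' t)) ->
  0 <= t0 <= 1 -> c t0 = c' t0 -> forall t, 0 <= t <= 1 -> c t = c' t.
Proof.
move=> cc cc' e t01; apply: (agree_on_path hX cc cc') => // t tt.
have [W sW Wt] := exists_sheet (c t).
exists W; first exact: sheet_nbhs.
by apply: filterE => t' t'01 W1 W2; apply: (sheet_inj sW) => //; exact: e.
Qed.

(** The section over [U] lifts the projected path inside [W], and the two lifts agree at 0. *)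
Lemma path_in_sheet W U (c : R -> X) x y : sheet W -> p @` W = U ->
  path_in (p @^-1` U) c x y -> W x -> W y.
Proof.
move=> sW pW [cc c0 c1 cU] Wx; have [g [gP gK gc]] := sheet_section sW Wx.
have U01 t : 0 <= t <= 1 -> (p @` W) (p (c t)) by rewrite pW; exact: cU.
have h0 : 0 <= (0 : R) <= 1 by apply/andP; split; lra.
have h1 : 0 <= (1 : R) <= 1 by apply/andP; split; lra.
have := @lift_path_unique c (g \o p \o c) 0 cc _ _ h0 _ 1 h1; rewrite /= c1 => ->.
- by have := (gP _ (U01 1 h1)).1; rewrite c1.
- move/within_contP: cc => cc; apply/within_contP => t; rewrite /= in_itv /= => tt N hN.
  have := covering_continuous (gc _ (U01 t tt) N hN).
  by move=> h; apply: (cc t _ _ h); rewrite /= in_itv.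
- by move=> t tt; rewrite (gP _ (U01 t tt)).2.
- by rewrite c0 gK.
Qed.

Definition concat (c d : R -> X) (t : R) := if t <= 2^-1 then c (2 * t) else d (2 * t - 1).

Lemma concat_within (c d : R -> X) : c 1 = d 0 ->
  {within `[0, 1], continuous c} -> {within `[0, 1], continuous d} ->
  {within `[0, 1], continuous (concat c d)}.
Proof.
move=> cd /within_contP cc /within_contP dc.
have h2 : (2 : R) * 2^-1 = 1 by rewrite divff.
have lc : continuous (fun t : R => 2 * t) by move=> t; apply: cvgMl_tmp; exact: cvg_id.
have ld : continuous (fun t : R => 2 * t - 1).
  by move=> t; apply: cvgD; [exact: lc | exact: cvg_cst].
suff h : {within `[0, 2^-1]%classic `|` `[2^-1, 1]%classic, continuous (concat c d)}.
  apply: within_cont_sub h => t; rewrite /= !in_itv /= => /andP[t0 t1].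
  by have [h|h] := leP t 2^-1; [left; rewrite t0 | right; rewrite ltW].
apply: withinU_continuous; try exact: itv_closed.
  have h : {within `[0, 2^-1], continuous (fun t => c (2 * t))}.
    apply/within_contP => t; rewrite /= in_itv /= => /andP[t0 t1] N hN.
    have : `[0, 1]%classic (2 * t) by rewrite /= in_itv /=; apply/andP; split; lra.
    move=> /cc /(_ _ hN) /lc; apply: nbhsS => t' h; rewrite in_itv /= => /andP[t0' t1'].
    by apply: h; rewrite /= in_itv /=; apply/andP; split; lra.
  apply: within_cont_eq h => t; rewrite /= in_itv /= /concat => /andP[_ t1].
  by rewrite t1.
have h : {within `[2^-1, 1], continuous (fun t => d (2 * t - 1))}.
  apply/within_contP => t; rewrite /= in_itv /= => /andP[t0 t1] N hN.
  have : `[0, 1]%classic (2 * t - 1) by rewrite /= in_itv /=; apply/andP; split; lra.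
  move=> /dc /(_ _ hN) /ld; apply: nbhsS => t' h; rewrite in_itv /= => /andP[t0' t1'].
  by apply: h; rewrite /= in_itv /=; apply/andP; split; lra.
apply: within_cont_eq h => t; rewrite /= in_itv /= /concat => /andP[t0 t1].
case: ifP => // t2; have -> : t = 2^-1 by apply/eqP; rewrite eq_le t0 t2.
by rewrite h2 subrr cd.
Qed.

Lemma rev_within (c : R -> X) : {within `[0, 1], continuous c} ->
  {within `[0, 1], continuous (fun t => c (1 - t))}.
Proof.
move=> /within_contP cc; apply/within_contP => t; rewrite /= in_itv /= => /andP[t0 t1] N hN.
have lc : continuous (fun t : R => 1 - t).
  by move=> s; apply: cvgB; [exact: cvg_cst | exact: cvg_id].
have : `[0, 1]%classic (1 - t) by rewrite /= in_itv /=; apply/andP; split; lra.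
move=> /cc /(_ _ hN) /lc; apply: nbhsS => t' h; rewrite in_itv /= => /andP[t0' t1'].
by apply: h; rewrite /= in_itv /=; apply/andP; split; lra.
Qed.

End Covering.

(** * Deck transformations of a simply connected covering *)

Section Deck.
Variables (R : realType) (X S : topologicalType) (p : X -> S).
Hypothesis hp : covering_map p.
Hypothesis hS : hausdorff_space S.
Let hX : hausdorff_space X := covering_hausdorff hp hS.
Hypothesis lpc : forall (x : X) (N : set X), nbhs x N -> exists2 M, nbhs x M &
  forall y, M y -> exists c, path_in (R := R) N c x y.
Hypothesis sc : simply_connected R X.

(** The graph of the deck transformation that takes [x] to [x']: the image of [y] is found by
    lifting the projection of a path from [x] to [y]. *)
Definition pair_path (x x' y z : X) := exists c c' : R -> X,
  [/\ {within `[0, 1], continuous c}, {within `[0, 1], continuous c'},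
      c 0 = x /\ c' 0 = x', c 1 = y /\ c' 1 = z
    & forall t, 0 <= t <= 1 -> p (c t) = p (c' t)].

Let h00 : 0 <= (0 : R) <= 1. Proof. by apply/andP; split; lra. Qed.
Let h11 : 0 <= (1 : R) <= 1. Proof. by apply/andP; split; lra. Qed.

Lemma pair_path_sym x x' y z : pair_path x x' y z -> pair_path x' x z y.
Proof.
move=> [c [c' [cc cc' [e1 e2] [e3 e4] e]]]; exists c', c; split=> // t t01.
by rewrite e.
Qed.

Lemma pair_path_fiber x x' y z : pair_path x x' y z -> p y = p z.
Proof. by move=> [c [c' [_ _ _ [<- <-] e]]]; exact: e. Qed.

Lemma continuous_within (c : R -> X) : {within `[0, 1], continuous c} ->
  {within `[0, 1], continuous (p \o c)}.
Proof.
move=> /within_contP cc; apply/within_contP => t t01 N hN.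
exact: cc (covering_continuous hp hN).
Qed.

Lemma pair_path_total x x' y : p x = p x' -> exists z, pair_path x x' y z.
Proof.
move=> xx; have [c [cc c0 c1]] := sc.1 x y.
have [|c' [cc' c'0 e]] := path_lifting hp hX (z := x') (continuous_within cc).
  by rewrite /= c0.
by exists (c' 1), c, c'; split=> // t t01; rewrite e.
Qed.

Lemma cst_within (z : X) : {within `[(0 : R), 1], continuous (fun=> z)}.
Proof. by apply: continuous_subspaceT => t; exact: cvg_cst. Qed.

(** Independence of the path. The loop [c1] followed by the reverse of [c2] is contracted by [H],
    and [p \o H] is lifted from [x']. The lift is constant on three sides of the square; on the
    fourth it runs along [c1'] from one corner and along [c2'] from the other, and both reach the
    midpoint. *)
Lemma pair_path_fun x x' y z1 z2 :
  pair_path x x' y z1 -> pair_path x x' y z2 -> z1 = z2.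
Proof.
move=> [c1 [c1' [cc1 cc1' [a1 a2] [a3 a4] e1]]] [c2 [c2' [cc2 cc2' [b1 b2] [b3 b4] e2]]].
pose loop := concat c1 (fun t => c2 (1 - t)).
have cl : {within `[0, 1], continuous loop}.
  by apply: concat_within (rev_within cc2) => //; rewrite subr0 a3 b3.
have l0 : loop 0 = x by rewrite /loop /concat mulr0 invr_ge0 ler0n.
have l1 : loop 1 = x.
  rewrite /loop /concat ifF; last by apply/negbTE; rewrite -ltNge; lra.
  by rewrite -b1; congr c2; ring.
have [|H [cH H0 H1 Hs]] := sc.2 loop cl; first by rewrite l0 l1.
have QE : [set` `[(0 : R), 1]] `*` [set` `[(0 : R), 1]] = rect 0 1 0 1.
  by apply/seteqP; split=> -[s t] /=; rewrite !in_itv.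
rewrite QE in cH.
have cF : {within rect 0 1 0 1, continuous (p \o H)}.
  move/within_contP: cH => cH; apply/within_contP => q Qq N hN.
  exact: cH (covering_continuous hp hN).
have Q s t : 0 <= s <= 1 -> 0 <= t <= 1 -> rect (0 : R) 1 0 1 (s, t) by [].
have hh : 0 <= (2^-1 : R) <= 1 by apply/andP; split; lra.
have [||f [cf Lf] f0] := cov_square_liftable hp hX cF (a := (0, 0)) (z := x').
- exact: Q.
- by rewrite /= H0 // l0 -a1 -a2; symmetry; exact: e1.
(* Identifies the lift along the segment from [a] to [b] with a known path [d] over the same
   projection. *)
have cmp (a b : R * R) (d : R -> X) : rect 0 1 0 1 a -> rect 0 1 0 1 b ->
    {within `[0, 1], continuous d} -> f a = d 0 ->
    (forall t, 0 <= t <= 1 -> p (H (segpt a b t)) = p (d t)) -> f b = d 1.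
  move=> Qa Qb cd fd ed.
  have cs := segpt_within (@rect_convex R 0 1 0 1) Qa Qb cf.
  have := lift_path_unique hp hX cs cd _ h00 _ h11.
  rewrite /= segpt0 segpt1; apply=> // t t01.
  by rewrite -ed //; apply: Lf; apply: rect_convex.
have pxx : p x = p x' by rewrite -a1 -a2; exact: e1.
have f10 : f (1, 0) = x'.
  apply: (cmp (0, 0) (1, 0) (fun=> x')) ; try exact: Q; try exact: cst_within; rewrite ?f0 ?f10 ?f11 //.
  move=> t t01; rewrite /segpt /= subr0 mulr1 add0r subrr mulr0 addr0.
  by rewrite (Hs t t01).1 l0.
have f11 : f (1, 1) = x'.
  apply: (cmp (1, 0) (1, 1) (fun=> x')) ; try exact: Q; try exact: cst_within; rewrite ?f0 ?f10 ?f11 //.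
  move=> t t01; rewrite /segpt /= subr0 mulr1 add0r subrr mulr0 addr0.
  by rewrite H1 // l0.
have f01 : f (0, 1) = x'.
  apply: (cmp (1, 1) (0, 1) (fun=> x')) ; try exact: Q; try exact: cst_within; rewrite ?f0 ?f10 ?f11 //.
  move=> t /andP[t0 t1]; rewrite /segpt /= subrr mulr0 addr0 sub0r.
  by rewrite (Hs _ _).2 ?l0 //; apply/andP; split; lra.
have <- : f (0, 2^-1) = z1.
  rewrite -a4; apply: (cmp (0, 0)) ; try exact: Q; rewrite ?f0 ?a2 //.
  move=> t /andP[t0 t1]; rewrite /segpt /= !subr0 !add0r mulr0.
  rewrite H0; last by apply/andP; split; lra.
  rewrite /loop /concat ifT; last by lra.
  by rewrite -e1 ?t0 //; congr (p (c1 _)); field.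
rewrite -b4; apply: (cmp (0, 1)) ; try exact: Q; rewrite ?f01 ?b2 //.
move=> t /andP[t0 t1]; rewrite /segpt /= subrr mulr0 addr0.
rewrite H0; last by apply/andP; split; lra.
rewrite /loop /concat; case: ifP => t12.
  (* At the midpoint [concat] takes the value of its first half, so the parameter [t = 1] is treated
     apart. *)
  have -> : t = 1 by apply/eqP; rewrite eq_le t1 /=; lra.
  by rewrite -e2 // b3 -a3; congr (p (c1 _)); field.
by rewrite -e2 ?t0 //; congr (p (c2 _)); field.
Qed.

Lemma pair_path_ext x x' y z W (g : S -> X) c y' : pair_path x x' y z ->
  sheet p W -> W z ->
  (forall s, (p @` W) s -> W (g s) /\ p (g s) = s) -> (forall w, W w -> g (p w) = w) ->
  (forall s, (p @` W) s -> forall N, nbhs (g s) N -> nbhs s (g @^-1` N)) ->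
  path_in (R := R) (p @^-1` (p @` W)) c y y' -> pair_path x x' y' (g (p y')).
Proof.
move=> pp sW Wz gP gK gc [cc c0 c1 cW].
have pyz := pair_path_fiber pp.
case: pp => d [d' [cd cd' [a1 a2] [a3 a4] e]].
have cg : {within `[0, 1], continuous (g \o (p \o c))}.
  move/within_contP: (continuous_within cc) => h; apply/within_contP => t t01 N hN.
  by apply: (h t t01 (g @^-1` N)); apply: gc hN; apply: cW; move: t01; rewrite /= in_itv.
exists (concat d c), (concat d' (g \o (p \o c))).
have c10 : ((1 : R) <= 2^-1) = false by apply/negbTE; rewrite -ltNge; lra.
have c21 : 2 * 1 - 1 = 1 :> R by ring.
split.
- by apply: concat_within => //; rewrite c0.
- by apply: concat_within => //; rewrite /= c0 pyz gK.
- by rewrite /concat mulr0 invr_ge0 ler0n.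
- by rewrite /concat c10 c21 /= c1.
move=> t /andP[t0 t1]; rewrite /concat; case: ifP => t2.
  by apply: e; apply/andP; split; lra.
have tt : 0 <= 2 * t - 1 <= 1 by move/negbT: t2; rewrite -ltNge => t2; apply/andP; split; lra.
by rewrite /= (gP _ (cW _ tt)).2.
Qed.

(** Near [y] the map is the composite of [p] with a local section, by [pair_path_ext] and
    uniqueness. *)
Lemma pair_path_map x x' (f : X -> X) : (forall y, pair_path x x' y (f y)) -> continuous f.
Proof.
move=> hf y N hN; have [U Uy hU] := evenly_covered hp (p y).
have pyz := pair_path_fiber (hf y).
have [|W [sW Wz pW]] := hU (f y); first by rewrite -pyz; exact: nbhs_singleton.
have [g [gP gK gc]] := sheet_section sW Wz.
have [M My hM] := lpc (covering_continuous hp Uy).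
have Wpy : (p @` W) (p y) by exists (f y).
have : nbhs y (p @^-1` (g @^-1` N)).
  by apply: (covering_continuous hp); apply: gc => //; rewrite pyz gK.
move=> /(nbhsI2 My); apply: nbhsS => y' [My' Ny'].
have [c hc] := hM y' My'; rewrite -pW in hc.
by rewrite /preimage /= (pair_path_fun (hf y') (pair_path_ext (hf y) sW Wz gP gK gc hc)).
Qed.

Lemma deck_transitive x x' : p x = p x' ->
  exists2 f, deck_transformation p f & f x = x'.
Proof.
move=> xx; have [f hf] := choice (fun y => pair_path_total y xx).
have [f' hf'] := choice (fun y => pair_path_total y (esym xx)).
exists f; last first.
  apply: pair_path_fun (hf x) _; exists (fun=> x), (fun=> x').
  by split=> //; exact: cst_within.
split.
- exact: pair_path_map hf.
- by apply/funext => y /=; rewrite -(pair_path_fiber (hf y)).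
exists f'; split.
- exact: pair_path_map hf'.
- by move=> y; apply: pair_path_fun (hf' (f y)) (pair_path_sym (hf y)).
- by move=> y; apply: pair_path_fun (hf (f' y)) (pair_path_sym (hf' y)).
Qed.

Lemma deck_free f x : deck_transformation p f -> f x = x -> f = id.
Proof.
move=> [cf pf _] fx; apply/funext => y; have [c [cc c0 c1]] := sc.1 x y.
have cfc : {within `[0, 1], continuous (f \o c)}.
  move/within_contP: cc => cc; apply/within_contP => t t01 N hN.
  exact: cc (cf _ _ hN).
have := lift_path_unique hp hX cfc cc _ h00 _ h11.
rewrite /= c0 c1; apply=> // t t01.
by rewrite -[in RHS]pf.
Qed.

Variables (G : groupType) (act : G -> X -> X).
Hypothesis hact : deck_group p act.

Lemma act_deck a : deck_transformation p (act a).
Proof. by case: hact => _ _ _ /(_ (act a))[_]; apply; exists a. Qed.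

Lemma act_proj a x : p (act a x) = p x.
Proof. by case: (act_deck a) => _ /(congr1 (fun h => h x)). Qed.

Lemma act1 x : act 1%g x = x.
Proof. by case: hact => ->. Qed.

Lemma actM a b x : act (a * b)%g x = act a (act b x).
Proof. by case: hact => _ ->. Qed.

Lemma actK a x : act a^-1%g (act a x) = x.
Proof. by rewrite -actM mulVg act1. Qed.

Lemma actVK a x : act a (act a^-1%g x) = x.
Proof. by rewrite -actM mulgV act1. Qed.

Lemma act_continuous a : continuous (act a).
Proof. by case: (act_deck a). Qed.

Lemma act_transitive x x' : p x = p x' -> exists a, act a x = x'.
Proof.
move=> /deck_transitive[f df fx]; case: hact => _ _ _ /(_ f)[/(_ df)[a af] _].
by exists a; rewrite af.
Qed.

Lemma act_free a b x : act a x = act b x -> a = b.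
Proof.
move=> ab; have e : act (b^-1 * a)%g x = x by rewrite actM ab actK.
have := deck_free (act_deck _) e; case: hact => <- _ inj _ /inj h.
by rewrite -[a]mul1g -(mulgV b) -mulgA h mulg1.
Qed.

(** In the case of a common fibre take a sheet [W] around [z] and points [M] joined to [y] by paths
    over the image of [W]. If [act a v] lies in [W], the translated path stays in [W], so
    [act a y = z]; freeness then determines [a]. *)
Lemma act_separated (y z : X) : exists Y Z, [/\ nbhs y Y, nbhs z Z & forall a b v w,
  Y v -> Z (act a v) -> Y w -> Z (act b w) -> a = b].
Proof.
have [pyz|pyz] := pselect (p y = p z); last first.
  have [A [B [/(covering_continuous hp) hA /(covering_continuous hp) hB AB]]] := hausdorff_sep hS pyz.
  exists (p @^-1` A), (p @^-1` B); split=> // a b v w Av; rewrite /preimage /= act_proj.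
  by move=> Bv; case: (AB (p v)).
have [U Uy hU] := evenly_covered hp (p y).
have [|W [sW Wz pW]] := hU z; first by rewrite -pyz; exact: nbhs_singleton.
have [M My hM] := lpc (covering_continuous hp Uy).
exists M, W; split=> //; first exact: (sheet_nbhs sW).
suff h a v : M v -> W (act a v) -> act a y = z.
  by move=> a b v w Mv Wv Mw Ww; apply: (@act_free a b y); rewrite (h a v) // (h b w).
move=> Mv Wv; have [c [cc c0 c1 cU]] := hM v Mv.
have Way : W (act a y).
  apply: (path_in_sheet hp hX (c := fun t => act a (c (1 - t))) sW pW _ Wv).
  split.
  - move/within_contP: (rev_within cc) => cr; apply/within_contP => t t01 N hN.
    exact: cr (act_continuous hN).
  - by rewrite subr0 c1.
  - by rewrite subrr c0.
  - move=> t /andP[t0 t1]; rewrite /preimage /= act_proj; apply: cU.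
    by apply/andP; split; lra.
by apply: (sheet_inj sW) => //; rewrite act_proj.
Qed.

Lemma act_proper (K1 K2 : set X) : compact K1 -> compact K2 ->
  exists s : seq G, forall a v, K1 v -> K2 (act a v) -> a \in s.
Proof.
move=> c1 c2; have /compact_near_coveringP := compact_setX c1 c2.
(* Lists ordered by inclusion form a filter; near-covering compactness along it collects the local
   finite lists into one. *)
pose F := filter_from (@setT (seq G)) (fun s => [set s' : seq G | {subset s <= s'}]).
have FF : Filter F.
  apply: filter_from_filter; first by exists [::].
  move=> s t _ _; exists (s ++ t) => // u hu; split=> a ha; apply: hu.
    by rewrite mem_cat ha.
  by rewrite mem_cat ha orbT.
move=> /(_ _ F (fun s vw => forall a, act a vw.1 = vw.2 -> a \in s) FF) [].
  move=> [y z] _; have [Y [Z [hY hZ hYZ]]] := act_separated y z.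
  have [[a [v [Yv Zv]]]|none] := pselect (exists a v, Y v /\ Z (act a v)).
    exists (Y `*` Z, [set s : seq G | a \in s]) => /=.
      split; first by exists (Y, Z).
      by exists [:: a] => // s hs; apply: hs; rewrite mem_head.
    move=> [[v' w'] s] /= [[Yv' Zw'] as_] b bv.
    by rewrite (_ : b = a) //; apply: (hYZ b a v' v) => //; rewrite bv.
  exists (Y `*` Z, setT) => /=; first by split; [exists (Y, Z) | exact: filterT].
  move=> [[v' w'] s] /= [[Yv' Zw'] _] b bv; case: none; exists b, v'.
  by rewrite bv.
move=> s _ hs; exists s => a v K1v K2v.
by apply: (hs s (fun _ h => h) (v, act a v)).
Qed.

End Deck.

(** * Charts and local inversion *)

Section Charts.
Variable R : realType.

Lemma dist_continuous (V : normedModType R) (y0 : V) : continuous (fun y => `|y - y0|).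
Proof.
move=> y N /nbhs_ballP[d /= d0 hd]; apply/nbhs_ballP; exists d => //= y'.
rewrite -ball_normE /= => h; apply: hd; rewrite -ball_normE /=.
apply: le_lt_trans (ler_dist_dist _ _) _.
by rewrite opprB addrA subrK.
Qed.

Lemma le_ball_compact k (y0 : 'rV[R]_k) e : compact [set y | `|y - y0| <= e].
Proof.
apply: bounded_closed_compact.
  exists (`|y0| + e); split; first exact: num_real.
  move=> r hr y /= hy; apply: le_trans (ltW hr).
  by rewrite -[y](subrK y0) addrC; apply: le_trans (ler_normD _ _) _; rewrite lerD2l.
have -> : [set y | `|y - y0| <= e] = (fun y => `|y - y0|) @^-1` [set x | x <= e] by [].
apply: closed_comp => [y _|]; last exact: closed_le.
exact: dist_continuous.
Qed.

Variables (M : topologicalType) (c : chart R M).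

Lemma chart_bwd y : (fwd c @` dom c) y -> dom c (bwd c y) /\ fwd c (bwd c y) = y.
Proof. by move=> [x dx <-]; rewrite fwdK. Qed.

Lemma chart_near x (N : set M) : dom c x -> nbhs x N ->
  nbhs (fwd c x) (fun y => (fwd c @` dom c) y /\ N (bwd c y)).
Proof.
move=> dx hN; have iy : (fwd c @` dom c) (fwd c x) by exists x.
apply: nbhsI2; first by apply: open_nbhs_nbhs; split; [exact: img_open | exact: iy].
have hN' : nbhs (bwd c (fwd c x)) N by rewrite fwdK.
exact: (bwd_cont iy hN').
Qed.

Lemma chart_dom_nbhs x (N : set 'rV[R]_2) : dom c x -> nbhs (fwd c x) N ->
  nbhs x (fun x' => dom c x' /\ N (fwd c x')).
Proof.
move=> dx hN; apply: nbhsI2; last exact: (fwd_cont dx hN).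
by apply: open_nbhs_nbhs; split; [exact: dom_open |].
Qed.

Lemma chart_path x (N : set M) : dom c x -> nbhs x N -> exists2 M', nbhs x M' &
  forall y, M' y -> exists d, path_in (R := R) N d x y.
Proof.
move=> dx hN; have /nbhs_ballP[e /= e0 he] := chart_near dx hN.
exists (fun x' => dom c x' /\ ball (fwd c x) e (fwd c x')).
  by apply: chart_dom_nbhs => //; exact: nbhsx_ballx.
move=> y [dy]; rewrite -ball_normE /= => hy.
pose l (t : R) := fwd c x + t *: (fwd c y - fwd c x).
have lc : continuous l.
  by move=> t; apply: cvgD; [exact: cvg_cst | apply: cvgZr_tmp; exact: cvg_id].
have lb t : 0 <= t <= 1 -> ball (fwd c x) e (l t).
  move=> /andP[t0 t1]; rewrite -ball_normE /= /l opprD addrA subrr add0r normrN.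
  rewrite normrZ ger0_norm // distrC; apply: le_lt_trans hy.
  by rewrite ler_piMl.
exists (bwd c \o l); split.
- apply/within_contP => t; rewrite /= in_itv /= => t01 O hO.
  have [it _] := he _ (lb t t01).
  by apply: nbhsS (lc t _ (bwd_cont it hO)) => t' h _.
- by rewrite /= /l scale0r addr0 fwdK.
- by rewrite /= /l scale1r addrC subrK fwdK.
- by move=> t t01; exact: (he _ (lb t t01)).2.
Qed.

Lemma chart_compact_nbhs x (N : set M) : dom c x -> nbhs x N ->
  exists K, [/\ compact K, nbhs x K & K `<=` N].
Proof.
move=> dx hN; have /nbhs_ballP[e /= e0 he] := chart_near dx hN.
have e2 : 0 < e / 2 by rewrite divr_gt0.
have sub y : `|y - fwd c x| <= e / 2 -> ball (fwd c x) e y.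
  by rewrite -ball_normE /= distrC => h; apply: le_lt_trans h _; lra.
exists (bwd c @` [set y | `|y - fwd c x| <= e / 2]); split.
- apply: continuous_compact; last exact: le_ball_compact.
  apply/within_contP => y /= hy O hO; have [it _] := he _ (sub y hy).
  by apply: nbhsS (bwd_cont it hO) => y' h _.
- have := chart_dom_nbhs dx (nbhsx_ballx (fwd c x) (e / 2) e2).
  apply: nbhsS => x' [dx' hx']; exists (fwd c x'); rewrite ?fwdK //=.
  by move: hx'; rewrite -ball_normE /= distrC => /ltW.
- by move=> _ [y /= hy <-]; exact: (he _ (sub y hy)).2.
Qed.

End Charts.

Section LiftCharts.
Variables (R : realType) (X S : topologicalType) (p : X -> S).
Hypothesis hp : covering_map p.
Variable A : set (chart R S).

Lemma lift_chart d x : A d -> dom d (p x) -> exists2 c, lift_atlas p A c & dom c x.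
Proof.
move=> Ad dpx; have [W sW Wx] := exists_sheet hp x.
have [g [gP gK gc]] := sheet_section sW Wx.
have [oW oU _ _] := sW.
pose D := W `&` p @^-1` (dom d).
have oD : open D.
  apply: openI => //; apply: open_comp; last exact: dom_open.
  by move=> y _; exact: (covering_continuous hp).
pose f := fwd d \o p; pose h := g \o bwd d.
have fD y : (f @` D) y -> (fwd d @` dom d) y /\ (p @` W) (bwd d y).
  move=> [w [Ww dw] <-]; split; first by exists (p w).
  by rewrite /f /= fwdK //; exists w.
have oI : open (f @` D).
  rewrite openE => y /= fy; have [w [Ww dw] yw] := fy.
  have : nbhs (p w) (p @` W).
    by apply: open_nbhs_nbhs; split=> //; exists w.
  move=> /(chart_near dw); rewrite -[fwd d (p w)]/(f w) yw.
  apply: nbhsS => y' [[s ds <-]]; rewrite fwdK // => -[w' Ww' ws].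
  by exists w'; rewrite /f /= ?ws //; split=> //; rewrite /preimage /= ws.
have cf z : D z -> {for z, continuous f}.
  move=> [Wz dz] N hN; have := fwd_cont dz hN.
  exact: (covering_continuous hp).
have ch y : (f @` D) y -> {for y, continuous h}.
  move=> /fD[iy Uy] N hN; exact: (bwd_cont iy (gc _ Uy N hN)).
have fK z : D z -> h (f z) = z.
  by move=> [Wz dz]; rewrite /h /f /= fwdK // gK.
exists (Chart oD oI cf ch fK); last by split.
by exists d => // z [_ dz].
Qed.

End LiftCharts.

(** * Strict differentiability and quantitative local inversion *)

Section PlaneAnalysis.
Variable R : realType.

Lemma nbhs_forall (T : topologicalType) (x : T) (I : finType) (P : I -> set T) :
  (forall i, nbhs x (P i)) -> nbhs x (fun y => forall i, P i y).
Proof. by move=> h; exact: filter_forall h. Qed.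

Lemma derive_line k (f : 'rV[R]_k -> R) (a v : 'rV[R]_k) (t : R) :
  derivable f (a + t *: v) v ->
  is_derive t 1 (fun s => f (a + s *: v)) ('D_v f (a + t *: v)).
Proof.
move=> df.
have e : (fun h : R => h^-1 *: (((fun s => f (a + s *: v)) \o shift t) (h *: (1 : R)) - f (a + t *: v)))
   = (fun h : R => h^-1 *: ((f \o shift (a + t *: v)) (h *: v) - f (a + t *: v))).
  apply/funext => h /=; congr (_ *: (f _ - _)).
  by rewrite [h *: _]mulr1 scalerDl addrCA addrA addrAC.
split; first by rewrite /derivable e.
by rewrite /derive e.
Qed.

Lemma derive_coords k (f : 'rV[R]_k -> R) (a v : 'rV[R]_k) : differentiable f a ->
  'D_v f a = \sum_j v 0 j * 'D_(delta_mx 0 j) f a.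
Proof.
move=> df; rewrite deriveE // {1}(row_sum_delta v) linear_sum /=.
by apply: eq_bigr => j _; rewrite linearZ /= -deriveE.
Qed.

(** Mean value theorem on the segment from [y'] to [y], where the partial derivatives stay close to
    those at [y0]. *)
Lemma strict_diff k (V : set 'rV[R]_k) (f : 'rV[R]_k -> R) (y0 : 'rV[R]_k) (eta : R) :
  nbhs y0 V -> (forall y, V y -> differentiable f y) ->
  (forall v, {for y0, continuous (fun y => 'D_v f y)}) -> 0 < eta ->
  exists2 r, 0 < r & forall y y', ball y0 r y -> ball y0 r y' ->
    `|f y - f y' - 'D_(y - y') f y0| <= eta * `|y - y'|.
Proof.
move=> hV df dc eta0.
have k0 : 0 < k%:R + 1 :> R by rewrite ltr_wpDl.
(* The errors of the [k] partial derivatives add up. *)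
pose eps := eta / (k%:R + 1).
have eps0 : 0 < eps by rewrite divr_gt0.
have hn : nbhs y0 (fun y => forall j, `|'D_(delta_mx 0 j) f y0 - 'D_(delta_mx 0 j) f y| < eps).
  apply: nbhs_forall => j.
  have := dc (delta_mx 0 j) (ball ('D_(delta_mx 0 j) f y0) eps) (nbhsx_ballx _ _ eps0).
  by apply: nbhsS => y; rewrite -ball_normE.
have /nbhs_ballP[r /= r0 hr] := nbhsI2 hV hn.
exists r => // y y' hy hy'; pose v : 'rV[R]_k := y - y'.
have hb (t : R) : 0 <= t <= 1 -> ball y0 r (y' + t *: v).
  move=> /andP[t0 t1]; move: hy hy'; rewrite -!ball_normE /= => hy hy'.
  have -> : y0 - (y' + t *: v) = t *: (y0 - y) + (1 - t) *: (y0 - y').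
    by apply/matrixP => i j; rewrite !mxE; ring.
  apply: le_lt_trans (ler_normD _ _) _; rewrite !normrZ !ger0_norm ?subr_ge0 //.
  have := ler_wpM2l t0 (ltW hy); have [->|tn] := eqVneq t 0; first by rewrite mul0r add0r subr0 mul1r.
  have tp : 0 < t by rewrite lt_def tn.
  have h1 : t * `|y0 - y| < t * r by rewrite ltr_pM2l.
  have h2 : (1 - t) * `|y0 - y'| <= (1 - t) * r by rewrite ler_wpM2l ?subr_ge0 // ltW.
  lra.
have Vd (t : R) : 0 <= t <= 1 -> differentiable f (y' + t *: v).
  by move=> t01; apply: df; exact: (hr _ (hb t t01)).1.
have dl (t : R) : 0 <= t <= 1 -> is_derive t 1 (fun s => f (y' + s *: v)) ('D_v f (y' + t *: v)).
  by move=> t01; apply: derive_line; apply: diff_derivable; exact: Vd.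
have [||c cin] := MVT (f := fun s => f (y' + s *: v)) (df := fun s => 'D_v f (y' + s *: v)) (@ltr01 R).
- by move=> t; rewrite in_itv /= => /andP[t0 t1]; apply: dl; rewrite !ltW.
- apply/within_contP => t; rewrite /= in_itv /= => t01 N hN.
  have := dl t t01; case => dt _.
  have := (iffLR (derivable1_diffP _ _) dt) => /differentiable_continuous /(_ N hN).
  exact: nbhsS.
rewrite scale0r addr0 scale1r subr0 mulr1 (addrC y') subrK => ->.
have c01 : 0 <= c <= 1 by move: cin; rewrite in_itv /= => /andP[c0 c1]; rewrite !ltW.
rewrite -/v (derive_coords _ (Vd c c01)) (derive_coords _ (df _ (nbhs_singleton hV))) -sumrB.
apply: le_trans (ler_norm_sum _ _ _) _.
apply: (@le_trans _ _ (\sum_(j < k) `|v| * eps)).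
  apply: ler_sum => j _; rewrite -mulrBr normrM ler_pM ?entry_le_norm //.
  by rewrite distrC ltW // (hr _ (hb c c01)).2.
rewrite sumr_const card_ord -[_ *+ k]mulr_natl mulrCA [leRHS]mulrC ler_wpM2l //.
by rewrite /eps mulrA ler_pdivrMr // mulrC ler_wpM2l ?(ltW eta0) // lerDl.
Qed.

Lemma mulmx_norm k l (w : 'rV[R]_k) (J : 'M[R]_(k, l)) : `|w *m J| <= k%:R * `|w| * `|J|.
Proof.
apply: mx_norm_leP => [|i j]; first by rewrite !mulr_ge0.
rewrite mxE; apply: le_trans (ler_norm_sum _ _ _) _.
rewrite -mulrA mulr_natl -[X in _ *+ X]card_ord -sumr_const; apply: ler_sum => s _.
by rewrite normrM ler_pM ?entry_le_norm.
Qed.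

Lemma bounded_below_unit k (J : 'M[R]_k) (kappa : R) : 0 < kappa ->
  (forall w : 'rV_k, kappa * `|w| <= `|w *m J|) -> J \in unitmx.
Proof.
move=> k0 hJ; rewrite -row_free_unit -kermx_eq0; apply/negPn/negP => /rowV0Pn[w].
move=> /sub_kermxP wJ /negP; apply; have := hJ w; rewrite wJ normr0.
by rewrite pmulr_rle0 // normr_le0.
Qed.

(* Existence part of the inverse function theorem: [|F|] attains its minimum on the
   ball at an interior point, where a Newton step would decrease a nonzero value. *)
Lemma local_zero k (F : 'rV[R]_k -> 'rV[R]_k) (J : 'M[R]_k) (y1 : 'rV[R]_k) (rho kappa : R) :
  0 < rho -> 0 < kappa ->
  (forall y y', `|y - y1| <= rho -> `|y' - y1| <= rho ->
    `|F y - F y' - (y - y') *m J| <= kappa / 2 * `|y - y'|) ->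
  (forall w : 'rV_k, kappa * `|w| <= `|w *m J|) -> `|F y1| < kappa * rho / 4 ->
  exists2 y, `|y - y1| <= rho & F y = 0.
Proof.
move=> rho0 k0 hF hJ h1; pose B := [set y | `|y - y1| <= rho].
have Ju := bounded_below_unit k0 hJ.
have By1 : B y1 by rewrite /B /= subrr normr0 ltW.
have cF : {within B, continuous (fun y => `|F y|)}.
  apply/within_contP => y hy N /nbhs_ballP[d /= d0 hd].
  pose C := k%:R * `|J| + kappa / 2.
  have C0 : 0 < C by rewrite ltr_wpDl ?mulr_ge0 // divr_gt0.
  apply/nbhs_ballP; exists (d / C); first exact: divr_gt0.
  move=> y'; rewrite -ball_normE /= => yy' hy'; apply: hd; rewrite -ball_normE /=.
  apply: le_lt_trans (ler_dist_dist _ _) _.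
  have : `|F y - F y'| <= C * `|y - y'|.
    rewrite -[F y - F y'](subrK ((y - y') *m J)); apply: le_trans (ler_normD _ _) _.
    rewrite /C mulrDl addrC lerD //; last exact: hF.
    by apply: le_trans (mulmx_norm _ _) _; rewrite mulrAC.
  by move=> /le_lt_trans; apply; rewrite mulrC -ltr_pdivlMr.
have [y yB hy] := EVT_min_rV (ex_intro _ y1 By1) (@le_ball_compact R k y1 rho) cF.
move: yB; rewrite inE /= => yB.
have ya : `|F y| <= `|F y1| by apply: hy; rewrite inE.
(* Origin of the factor 4: the lower bound on [J] and the strict estimate give [kappa / 2 * |y - y1|
   <= |F y| + |F y1| <= 2 |F y1|], which is less than [kappa * rho / 2]. *)
have yint : `|y - y1| < rho.
  have hy1 : `|y1 - y1| <= rho by rewrite subrr normr0 ltW.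
  have h2 := hF y y1 yB hy1; have h3 := hJ (y - y1).
  have h4 : `|(y - y1) *m J| <= `|F y - F y1 - (y - y1) *m J| + (`|F y| + `|F y1|).
    rewrite -{1}[(y - y1) *m J](subKr (F y - F y1)).
    by apply: le_trans (ler_normB _ _) _; rewrite addrC lerD2l ler_normB.
  have h5 : kappa * `|y - y1| < kappa * rho by nra.
  by rewrite ltr_pM2l in h5.
exists y => //; apply/eqP; rewrite -normr_le0 leNgt; apply/negP => a0.
(* The Newton direction, scaled by [t] to remain in the ball; the step brings [|F|] down to at most
   [(1 - t / 2) |F y|]. *)
pose w := - F y *m invmx J.
have wJ : w *m J = - F y by rewrite /w mulmxKV.
have hw : kappa * `|w| <= `|F y| by have := hJ w; rewrite wJ normrN.
have w1 : 0 < `|w| + 1 by rewrite ltr_wpDl.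
pose t := Num.min 1 ((rho - `|y - y1|) / (`|w| + 1)).
have t0 : 0 < t by rewrite lt_min ltr01 divr_gt0 // subr_gt0.
have t1 : t <= 1 by rewrite ge_min lexx.
have tw : t * `|w| <= rho - `|y - y1|.
  have : t <= (rho - `|y - y1|) / (`|w| + 1) by rewrite ge_min lexx orbT.
  rewrite ler_pdivlMr // mulrDr mulr1; apply: le_trans.
  by rewrite lerDl ltW.
have yB' : `|y + t *: w - y1| <= rho.
  rewrite addrAC; apply: le_trans (ler_normD _ _) _.
  by rewrite normrZ gtr0_norm // -lerBrDl.
have := hy (y + t *: w); rewrite inE /= => /(_ yB'); apply/negP; rewrite -ltNge.
have := hF (y + t *: w) y yB' yB.
rewrite (addrC y) addrK -scalemxAl wJ normrZ gtr0_norm // => h6.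
have : `|F (t *: w + y)| <= `|F (t *: w + y) - F y - t *: - F y| + `|(1 - t) *: F y|.
  have e : F (t *: w + y) = (F (t *: w + y) - F y - t *: - F y) + (1 - t) *: F y.
    by apply/matrixP => i j; rewrite !mxE; ring.
  by rewrite {1}e; exact: ler_normD.
rewrite normrZ (ger0_norm (_ : 0 <= 1 - t)) ?subr_ge0 // => /le_lt_trans; apply.
have : t * (kappa * `|w|) <= t * `|F y| by rewrite ler_wpM2l // ltW.
have : 0 < t * `|F y| by rewrite mulr_gt0.
nra.
Qed.

Lemma local_zero_unique k (F : 'rV[R]_k -> 'rV[R]_k) (J : 'M[R]_k) (kappa : R) (y y' : 'rV[R]_k) :
  0 < kappa -> `|F y - F y' - (y - y') *m J| <= kappa / 2 * `|y - y'| ->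
  (forall w : 'rV_k, kappa * `|w| <= `|w *m J|) -> F y = 0 -> F y' = 0 -> y = y'.
Proof.
move=> k0 h1 /(_ (y - y')) h2 e1 e2; rewrite e1 e2 subrr sub0r normrN in h1.
have h : kappa * `|y - y'| <= 0 by have := le_trans h2 h1; lra.
by apply/eqP; rewrite -subr_eq0 -normr_le0 -(pmulr_rle0 _ k0).
Qed.

End PlaneAnalysis.

(** * Zeros of semi-definite forms on a frame in a plane chart *)

Section PlaneLoc.
Variables (R : realType) (m : nat) (Q : 'I_2 -> 'rV[R]_2 -> 'M[R]_m).
Variables (y0 : 'rV[R]_2) (V : set 'rV[R]_2).
Hypothesis hV : nbhs y0 V.
Hypothesis dQ : forall k i j y, V y -> differentiable (fun y => Q k y i j) y.
Hypothesis cQ : forall k i j v, {for y0, continuous (fun y => 'D_v (fun y => Q k y i j) y)}.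

Let J k (w : 'rV[R]_2) : 'M[R]_m := \matrix_(i, j) 'D_w (fun y => Q k y i j) y0.

Hypothesis hfit : forall w : 'rV[R]_2, w != 0 -> exists l a : 'I_2 -> R,
  posdef (\sum_k l k *: J k w + \sum_k a k *: Q k y0).

Let Phi (A : 'M[R]_m) y : 'rV[R]_2 := \row_k ip A (Q k y).
Let Jm (A : 'M[R]_m) : 'M[R]_2 := \matrix_(j, k) ip A (J k (delta_mx 0 j)).
Let M2 : R := m%:R ^+ 2 + 1.

Let M2gt0 : 0 < M2. Proof. by rewrite ltr_wpDl // exprn_ge0. Qed.

Let Jlin k w : J k w = \sum_j w 0 j *: J k (delta_mx 0 j).
Proof.
apply/matrixP => a b; rewrite mxE derive_coords; last exact: dQ (nbhs_singleton hV).
by rewrite summxE; apply: eq_bigr => j _; rewrite !mxE.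
Qed.

Let ip_sumr (I : finType) A (c : I -> R) (B : I -> 'M[R]_m) :
  ip A (\sum_i c i *: B i) = \sum_i c i * ip A (B i).
Proof.
elim/big_rec2: _ => [|i x y _ <-]; first by rewrite ip0r.
by rewrite ipDr ipZr.
Qed.

Let JmE A w k : (w *m Jm A) 0 k = ip A (J k w).
Proof. by rewrite mxE Jlin ip_sumr; apply: eq_bigr => j _; rewrite mxE. Qed.

Let ip_psd (A B : 'M[R]_m) : possemidef A -> `|ip A B| <= M2 * \tr A * `|B|.
Proof.
move=> Ap; apply: le_trans (ip_norm _ _) _; rewrite ler_wpM2r //.
by rewrite ler_pM ?exprn_ge0 ?psd_norm // lerDl.
Qed.

Let ip_le (A B : 'M[R]_m) : `|ip A B| <= M2 * `|A| * `|B|.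
Proof.
by apply: le_trans (ip_norm _ _) _; rewrite !ler_wpM2r // lerDl.
Qed.

Let CJ : R := \sum_k \sum_j `|J k (delta_mx 0 j)|.

Let CJ_ge0 : 0 <= CJ.
Proof. by apply: sumr_ge0 => k _; apply: sumr_ge0. Qed.

Let rowJ_bound (A : 'M[R]_m) (w : 'rV[R]_2) : possemidef A -> `|w *m Jm A| <= 2 * M2 * CJ * `|w| * \tr A.
Proof.
move=> Ap; apply: le_trans (mulmx_norm _ _) _.
have tA := psd_tr_ge0 Ap.
have h : `|Jm A| <= M2 * \tr A * CJ.
  apply: mx_norm_leP => [|j k]; first by rewrite !mulr_ge0 // ltW.
  rewrite mxE; apply: le_trans (ip_psd _ Ap) _.
  apply: ler_wpM2l; first by rewrite mulr_ge0 // ltW.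
  rewrite /CJ (bigD1 k) //= (bigD1 j) //= -addrA lerDl addr_ge0 ?sumr_ge0 // => i _.
  exact: sumr_ge0.
have -> : 2 * M2 * CJ * `|w| * \tr A = 2 * `|w| * (M2 * \tr A * CJ) by ring.
by rewrite ler_wpM2l // mulr_ge0.
Qed.

(** Transversality: [A] is paired with the positive definite combination supplied by [hfit], and [L]
    dominates the coefficients of that combination. *)
Let psd_pencil_bound_at (w : 'rV[R]_2) : w != 0 -> exists2 c, 0 < c &
  forall A : 'M[R]_m, possemidef A -> c * \tr A <= `|w *m Jm A| + `|Phi A y0|.
Proof.
move=> /hfit[l [a hr]]; have [c c0 hc] := ip_posdef_ge hr.
pose L := \sum_k `|l k| + \sum_k `|a k| + 1.
have L0 : 0 < L by rewrite ltr_wpDl // addr_ge0 // sumr_ge0.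
exists (c / L); first exact: divr_gt0.
move=> A Ap; rewrite mulrAC ler_pdivrMr //; apply: le_trans (hc A Ap) _.
rewrite ipDr !ip_sumr; apply: le_trans (ler_norm _) _; apply: le_trans (ler_normD _ _) _.
set x := `|w *m Jm A|; set y := `|Phi A y0|.
have x0 : 0 <= x by exact: normr_ge0.
have y0' : 0 <= y by exact: normr_ge0.
have h1 : `|\sum_i l i * ip A (J i w)| <= (\sum_k `|l k|) * x.
  rewrite mulr_suml; apply: le_trans (ler_norm_sum _ _ _) _; apply: ler_sum => k _.
  by rewrite normrM ler_wpM2l // -JmE entry_le_norm.
have h2 : `|\sum_i a i * ip A (Q i y0)| <= (\sum_k `|a k|) * y.
  rewrite mulr_suml; apply: le_trans (ler_norm_sum _ _ _) _; apply: ler_sum => k _.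
  have e : ip A (Q k y0) = Phi A y0 0 k by rewrite mxE.
  by rewrite normrM ler_wpM2l // e; exact: entry_le_norm.
have sl : 0 <= \sum_k `|l k| by exact: sumr_ge0.
have sa : 0 <= \sum_k `|a k| by exact: sumr_ge0.
apply: le_trans (lerD h1 h2) _; rewrite /L; nra.
Qed.

Let sphere_compact : compact [set w : 'rV[R]_2 | `|w| = 1].
Proof.
apply: (subclosed_compact _ (@le_ball_compact R 2 0 1)); last first.
  by move=> w /= hw; rewrite subr0 hw.
have -> : [set w : 'rV[R]_2 | `|w| = 1] = (fun w => `|w - 0|) @^-1` [set 1].
  by apply/seteqP; split=> w /=; rewrite subr0.
apply: closed_comp => [w _|]; last exact: closed_eq.
exact: dist_continuous.
Qed.

(** The constant is made uniform over directions by compactness of the unit sphere. This works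
    simultaneously for all [A] because both sides, and the variation in [w], scale with [\tr A]. *)
Let psd_pencil_bound : exists2 c, 0 < c & forall (A : 'M[R]_m) (w : 'rV[R]_2), possemidef A ->
  c * `|w| * \tr A <= `|w *m Jm A| + `|w| * `|Phi A y0|.
Proof.
pose P (c : R) (w : 'rV[R]_2) := forall A : 'M[R]_m, possemidef A ->
  c * \tr A <= `|w *m Jm A| + `|Phi A y0|.
have [c [c0 hc]] : exists c, 0 < c /\ forall w : 'rV[R]_2, `|w| = 1 -> P c w.
  have : \forall c \near 0^'+, [set w : 'rV[R]_2 | `|w| = 1] `<=` P c.
    move/compact_near_coveringP: sphere_compact; apply=> w /= w1.
    have w0 : w != 0 by rewrite -normr_eq0 w1 oner_eq0.
    have [c c0 hc] := psd_pencil_bound_at w0.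
    pose C := 2 * M2 * CJ + 1.
    have C0 : 0 < C by rewrite ltr_wpDl // !mulr_ge0 // ltW.
    exists (ball w (c / 2 / C), [set e | e <= c / 2]) => /=.
      split; first by apply: nbhsx_ballx; rewrite !divr_gt0.
      by apply: nbhs_right_le; rewrite divr_gt0.
    move=> [w' e] [/= hw' he] A Ap; have tA := psd_tr_ge0 Ap.
    have h1 := hc A Ap; have h2 := rowJ_bound (w - w') Ap.
    have h3 : `|w *m Jm A| <= `|w' *m Jm A| + `|(w - w') *m Jm A|.
      by rewrite mulmxBl -{1}[w *m Jm A](subrKC (w' *m Jm A)); exact: ler_normD.
    have h4 : 2 * M2 * CJ * `|w - w'| * \tr A <= c / 2 * \tr A.
      rewrite ler_wpM2r //; move: hw'; rewrite -ball_normE /= => /ltW.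
      rewrite ler_pdivlMr // /C => h; apply: le_trans h.
      have -> : `|w - w'| * (2 * M2 * CJ + 1) = 2 * M2 * CJ * `|w - w'| + `|w - w'| by ring.
      by rewrite lerDl.
    have h5 : e * \tr A <= c / 2 * \tr A by rewrite ler_wpM2r.
    lra.
  move=> /(filterI (nbhs_right_gt 0)) /filter_ex [c [c0 hc]]; exists c; split=> //.
exists c => // A w Ap; have [->|w0] := eqVneq w 0.
  by rewrite mul0mx !normr0 mulr0 !mul0r addr0.
have wp : 0 < `|w| by rewrite normr_gt0.
have := hc (`|w|^-1 *: w) _ A Ap; rewrite normrZ normfV normr_id mulVf ?gt_eqF //.
move=> /(_ erefl); rewrite -scalemxAl normrZ normfV normr_id => h.
have := ler_wpM2l (ltW wp) h; rewrite mulrDr mulVKf ?gt_eqF // => h'.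
by apply: le_trans h'; rewrite le_eqVlt; apply/orP; left; apply/eqP; ring.
Qed.

Let strict_frame eta : 0 < eta -> exists2 r, 0 < r & forall y y', ball y0 r y -> ball y0 r y' ->
  forall k, `|Q k y - Q k y' - J k (y - y')| <= eta * `|y - y'|.
Proof.
move=> eta0; pose P (kij : 'I_2 * 'I_m * 'I_m) (r : R) := forall y y', ball y0 r y -> ball y0 r y' ->
    `|Q kij.1.1 y kij.1.2 kij.2 - Q kij.1.1 y' kij.1.2 kij.2 -
      'D_(y - y') (fun y => Q kij.1.1 y kij.1.2 kij.2) y0| <= eta * `|y - y'|.
have : \forall r \near 0^'+, forall kij, P kij r.
  apply: filter_forall => -[[k i] j].
  have [r r0 hr] := strict_diff hV (@dQ k i j) (@cQ k i j) eta0.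
  apply: filterS (nbhs_right_le r0) => r' hr' y y' hy hy'.
  by apply: hr; [apply: le_ball hr' _ hy | apply: le_ball hr' _ hy'].
move=> /(filterI (nbhs_right_gt 0)) /filter_ex [r [r0 hr]]; exists r => // y y' hy hy' k.
apply: mx_norm_leP => [|i j]; first by rewrite mulr_ge0 // ltW.
by have := hr (k, i, j) y y' hy hy'; rewrite /= !mxE.
Qed.

Let frame_continuous eta : 0 < eta ->
  nbhs y0 (fun y => forall k, `|Q k y - Q k y0| <= eta).
Proof.
move=> eta0.
have : nbhs y0 (fun y => forall kij : 'I_2 * 'I_m * 'I_m,
    `|Q kij.1.1 y kij.1.2 kij.2 - Q kij.1.1 y0 kij.1.2 kij.2| < eta).
  apply: nbhs_forall => -[[k i] j] /=.
  have := differentiable_continuous (@dQ k i j _ (nbhs_singleton hV)).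
  move=> /(_ _ (nbhsx_ballx _ _ eta0)); apply: nbhsS => y.
  by rewrite /= -ball_normE /= distrC.
apply: nbhsS => y h k; apply: mx_norm_leP => [|i j]; first exact: ltW.
by rewrite !mxE; exact/ltW/(h (k, i, j)).
Qed.

(** Every estimate is proportional to [\tr A], so [r] and [e] serve the whole cone. A zero near [y0]
    makes [Phi A y0] small, hence [Jm A] bounded below; strict differentiability then gives
    uniqueness, and [local_zero] gives persistence. Starting in the half ball leaves room for the
    radius [r / 4] used there. *)
Lemma local_zeros_plane (V' : set 'rV[R]_2) : nbhs y0 V' ->
  exists r e : R, [/\ 0 < r, 0 < e, ball y0 r `<=` V `&` V',
    forall A y y', possemidef A -> A != 0 -> ball y0 r y -> ball y0 r y' ->
      (forall k, ip A (Q k y) = 0) -> (forall k, ip A (Q k y') = 0) -> y = y'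
  & forall A A' y, possemidef A -> A != 0 -> possemidef A' -> ball y0 (r / 2) y ->
      (forall k, ip A (Q k y) = 0) -> `|A' - A| <= e * \tr A ->
      exists2 y', ball y0 r y' & forall k, ip A' (Q k y') = 0].
Proof.
move=> hV'; have [c c0 hc] := psd_pencil_bound.
pose eta := c / 16 / M2.
have eta0 : 0 < eta by rewrite !divr_gt0.
have M2eta : M2 * eta = c / 16 by rewrite /eta mulrC divfK // gt_eqF.
have [r1 r10 hr1] := strict_frame eta0.
have /nbhs_ballP[r2 /= r20 hr2] := nbhsI2 (nbhsI2 hV hV') (frame_continuous eta0).
pose r := Num.min r1 r2.
have r0 : 0 < r by rewrite lt_min r10 r20.
have b1 y : ball y0 r y -> ball y0 r1 y by apply: le_ball; rewrite ge_min lexx.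
have b2 y : ball y0 r y -> ball y0 r2 y by apply: le_ball; rewrite ge_min lexx orbT.
pose K := \sum_k `|Q k y0| + eta + 1.
have K0 : 0 < K by rewrite ltr_wpDl // addr_ge0 ?sumr_ge0 // ltW.
have Qb y k : ball y0 r y -> `|Q k y| <= K.
  move=> /b2/hr2[_ /(_ k) h]; rewrite -[Q k y](subrK (Q k y0)).
  apply: le_trans (ler_normD _ _) _.
  have : `|Q k y0| <= \sum_k `|Q k y0| by rewrite (bigD1 k) //= lerDl sumr_ge0.
  rewrite /K; lra.
pose n1 : R := m%:R + 1.
have n10 : 0 < n1 by rewrite ltr_wpDl.
(* The first bound keeps [\tr A'] at least half of [\tr A]; the second makes the change of [Phi] on
   the ball small enough both for [lower] and for the smallness condition of [local_zero]. *)
pose e := Num.min (1 / (2 * n1)) (c * Num.min 1 r / (200 * M2 * K)).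
have e0 : 0 < e.
  by rewrite lt_min !(divr_gt0, mulr_gt0) // lt_min ltr01.
have be : e <= 1 / (2 * n1) by rewrite ge_min lexx.
have be2 : 200 * M2 * K * e <= c * Num.min 1 r.
  have : e <= c * Num.min 1 r / (200 * M2 * K) by rewrite ge_min lexx orbT.
  by rewrite ler_pdivlMr ?mulr_gt0 // mulrC.
have be3 : 200 * M2 * K * e <= c.
  by apply: le_trans be2 _; rewrite -[leRHS]mulr1 ler_wpM2l ?(ltW c0) // ge_min lexx.
have be4 : 200 * M2 * K * e <= c * r.
  by apply: le_trans be2 _; rewrite ler_wpM2l ?(ltW c0) // ge_min lexx orbT.
have near0 A y : possemidef A -> ball y0 r y -> (forall k, ip A (Q k y) = 0) ->
    `|Phi A y0| <= c / 16 * \tr A.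
  move=> Ap hy hz; have tA := psd_tr_ge0 Ap.
  apply: mx_norm_leP => [|i k]; first by rewrite mulr_ge0 // divr_ge0 // ltW.
  rewrite mxE -[ip A _]subr0 -(hz k) -ipBr; apply: le_trans (ip_psd _ Ap) _.
  rewrite -M2eta distrC mulrAC ler_wpM2r // ler_wpM2l ?(ltW M2gt0) //.
  by have [_ ] := hr2 _ (b2 _ hy).
have lower A : possemidef A -> `|Phi A y0| <= c / 2 * \tr A ->
    forall w : 'rV[R]_2, c / 2 * \tr A * `|w| <= `|w *m Jm A|.
  move=> Ap h w; have h1 := hc A w Ap; have h2 := ler_wpM2l (normr_ge0 w) h; nra.
have strict A y y' : possemidef A -> ball y0 r y -> ball y0 r y' ->
    `|Phi A y - Phi A y' - (y - y') *m Jm A| <= c / 2 * \tr A / 2 * `|y - y'|.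
  move=> Ap hy hy'; have tA := psd_tr_ge0 Ap.
  apply: mx_norm_leP => [|i k]; first by rewrite !mulr_ge0 // ltW.
  have -> : (Phi A y - Phi A y' - (y - y') *m Jm A) i k =
      ip A (Q k y - Q k y' - J k (y - y')).
    by rewrite ord1 !ipBr -JmE 2!mxE [(- _ : 'rV__) _ _]mxE [in LHS]mxE
      [(- _ : 'rV__) _ _]mxE [Phi A y' _ _]mxE.
  apply: le_trans (ip_psd _ Ap) _.
  have h := hr1 y y' (b1 _ hy) (b1 _ hy') k.
  have h' : M2 * \tr A * `|Q k y - Q k y' - J k (y - y')| <= M2 * \tr A * (eta * `|y - y'|).
    by rewrite ler_wpM2l // mulr_ge0 // ltW.
  apply: le_trans h' _.
  have -> : M2 * \tr A * (eta * `|y - y'|) = (M2 * eta) * \tr A * `|y - y'| by ring.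
  rewrite M2eta !ler_wpM2r //.
  have : 0 <= c * \tr A by rewrite mulr_ge0 // ltW.
  lra.
exists r, e; split=> //.
- by move=> y /b2/hr2[[]].
- move=> A y y' Ap A0 hy hy' hz hz'; have tA := psd_tr_gt0 Ap A0.
  have k0 : 0 < c / 2 * \tr A by rewrite mulr_gt0 // divr_gt0.
  apply: (local_zero_unique k0 (strict A y y' Ap hy hy')).
  + apply: lower => //; apply: le_trans (near0 A y Ap hy hz) _.
    by rewrite ler_wpM2r ?(ltW tA) //; lra.
  + by apply/rowP => k; rewrite !mxE hz.
  + by apply/rowP => k; rewrite !mxE hz'.
move=> A A' y1 Ap A0 Ap' hy1 hz hA; have tA := psd_tr_gt0 Ap A0.
have tA' : \tr A <= 2 * \tr A'.
  have h := tr_norm (A' - A); rewrite raddfB /= ler_norml in h; case/andP: h => h _.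
  have h1 : m%:R * `|A' - A| <= n1 * (1 / (2 * n1) * \tr A).
    apply: ler_pM => //; first by rewrite lerDl.
    by apply: le_trans hA _; rewrite ler_wpM2r // ltW.
  have h2 : n1 * (1 / (2 * n1) * \tr A) = \tr A / 2 by field; rewrite gt_eqF.
  lra.
have tA'0 : 0 < \tr A' by lra.
have by1 : ball y0 r y1 by apply: le_ball hy1; lra.
have diffb y k : ball y0 r y -> `|ip (A' - A) (Q k y)| <= M2 * (e * (2 * \tr A')) * K.
  move=> hy; apply: le_trans (ip_le _ _) _; apply: ler_pM; rewrite ?mulr_ge0 ?(ltW M2gt0) //.
    rewrite ler_wpM2l ?(ltW M2gt0) //; apply: le_trans hA _.
    by rewrite ler_wpM2l // ltW.
  exact: Qb.
have hk : `|Phi A' y0| <= c / 2 * \tr A'.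
  have b0 : ball y0 r y0 by exact: ballxx.
  have -> : Phi A' y0 = Phi A y0 + Phi (A' - A) y0.
    by apply/rowP => k; rewrite !mxE ipBl addrC subrK.
  apply: le_trans (ler_normD _ _) _.
  have h1 := near0 A y1 Ap by1 hz.
  have h2 : `|Phi (A' - A) y0| <= M2 * (e * (2 * \tr A')) * K.
    apply: mx_norm_leP => [|i k]; last by rewrite mxE; exact: diffb.
    by rewrite !mulr_ge0 // ltW.
  have h3 : c * \tr A <= c * (2 * \tr A') by rewrite ler_wpM2l // ltW.
  have h4 : 200 * M2 * K * e * \tr A' <= c * \tr A' by rewrite ler_wpM2r // ltW.
  have h5 : 0 < c * \tr A' by rewrite mulr_gt0.
  lra.
have hb y : `|y - y1| <= r / 4 -> ball y0 r y.
  move: hy1; rewrite -!ball_normE /= => h1 h2; rewrite -(subrKA y1).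
  by apply: le_lt_trans (ler_normD _ _) _; rewrite (distrC y1); lra.
have k0 : 0 < c / 2 * \tr A' by rewrite mulr_gt0 // divr_gt0.
have r4 : 0 < r / 4 by rewrite divr_gt0.
have [||y' hy' hz'] := @local_zero R 2 (Phi A') (Jm A') y1 (r / 4) _ r4 k0 _ (lower A' Ap' hk).
- by move=> y y' hy hy'; apply: strict => //; exact: hb.
- apply: (@le_lt_trans _ _ (M2 * (e * (2 * \tr A')) * K)).
    apply: mx_norm_leP => [|i k]; first by rewrite !mulr_ge0 // ltW.
    have -> : Phi A' y1 i k = ip (A' - A) (Q k y1) by rewrite mxE ipBl hz subr0.
    exact: diffb.
  have h4 : 200 * M2 * K * e * \tr A' <= c * r * \tr A' by rewrite ler_wpM2r // ltW.
  have h5 : 0 < c * r * \tr A' by rewrite !mulr_gt0.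
  have -> : M2 * (e * (2 * \tr A')) * K = (200 * M2 * K * e * \tr A') / 100 by field.
  lra.
by exists y'; [exact: hb | move=> k; have /rowP/(_ k) := hz'; rewrite !mxE].
Qed.

End PlaneLoc.

(** * Local zeros of a fitting immersion *)

Section Gram.
Variable R : realType.

Lemma span2P m (a b v : 'M[R]_m) :
  v \in <<[:: a; b]>>%VS <-> exists l1 l2, v = l1 *: a + l2 *: b.
Proof.
rewrite span_cons span_seq1; split.
  by move=> /memv_addP[_ /vlineP[l1 ->] [_ /vlineP[l2 ->] ->]]; exists l1, l2.
by move=> [l1 [l2 ->]]; apply: memv_add; apply/vlineP; [exists l1 | exists l2].
Qed.

Lemma pencil_free m (P : {vspace 'M[R]_m}) a b : \dim P = 2 -> P = <<[:: a; b]>>%VS ->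
  b != 0 /\ forall l1 l2, l1 *: a + l2 *: b = 0 -> l1 = 0.
Proof.
move=> dP eP; have : free [:: a; b] by rewrite /free -eP dP.
rewrite free_cons span_seq1 seq1_free => /andP[aNb b0]; split=> // l1 l2 h.
apply/eqP/negPn/negP => l10; case/negP: aNb; apply/vlineP; exists (- (l2 / l1)).
have -> : a = l1^-1 *: (l1 *: a) by rewrite scalerA mulVf // scale1r.
move/eqP: h; rewrite addr_eq0 => /eqP ->.
by rewrite scalerN scalerA scaleNr mulrC.
Qed.

Lemma ip_sym_eq0 m (A : 'M[R]_m) : A^T = A -> ip A A = 0 -> A = 0.
Proof.
move=> As; rewrite ipE => h; have sq i j : A i j * A j i = A i j ^+ 2 by rewrite -{2}As mxE expr2.
have h' i j : A i j ^+ 2 = 0.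
  have hi : \sum_k A i k * A k i = 0.
    by apply: (psumr_eq0P _ h) => // l _; apply: sumr_ge0 => k _; rewrite sq sqr_ge0.
  by rewrite -sq; apply: (psumr_eq0P _ hi) => // k _; rewrite sq sqr_ge0.
by apply/matrixP => i j; rewrite mxE; apply/eqP; rewrite -sqrf_eq0 h'.
Qed.

Definition gramdet m (a b : 'M[R]_m) := ip a a * ip b b - ip a b ^+ 2.

(** [gramdet a b] times the orthogonal projection of [v] to the span of [a] and [b]; free of
    division, so that membership in the span becomes a polynomial identity that passes to limits. *)
Definition gramproj m (a b v : 'M[R]_m) :=
  (ip b b * ip v a - ip a b * ip v b) *: a + (ip a a * ip v b - ip a b * ip v a) *: b.

Lemma gramproj_span m (a b v : 'M[R]_m) : v \in <<[:: a; b]>>%VS ->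
  gramdet a b *: v = gramproj a b v.
Proof.
move=> /span2P[l1 [l2 ->]]; rewrite /gramproj /gramdet !ipDl !ipZl (ipC b a).
by rewrite scalerDr !scalerA; congr (_ *: _ + _ *: _); ring.
Qed.

(** The component of [a] orthogonal to [b], scaled by [ip b b], has square [ip b b * gramdet a b];
    its vanishing would make [a] and [b] dependent. *)
Lemma gramdet_neq0 m (P : {vspace 'M[R]_m}) a b : \dim P = 2 -> P = <<[:: a; b]>>%VS ->
  a^T = a -> b^T = b -> gramdet a b != 0.
Proof.
move=> dP eP as_ bs; have [b0 ab] := pencil_free dP eP.
apply/negP => /eqP g0; pose e := ip b b *: a + (- ip a b) *: b.
have es : e^T = e by rewrite [LHS]linearD /= ![(_ *: _)^T]linearZ /= as_ bs.
have ee : ip e e = 0.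
  have -> : ip e e = ip b b * gramdet a b.
    by rewrite /e /gramdet !ipDl !ipDr !ipZl !ipZr (ipC b a); ring.
  by rewrite g0 mulr0.
have bb := ab _ _ (ip_sym_eq0 es ee).
by move/negP: b0; apply; apply/eqP/ip_sym_eq0.
Qed.

Lemma gramproj_ip m (a b v : 'M[R]_m) : gramdet a b != 0 ->
  ip (v - (gramdet a b)^-1 *: gramproj a b v) a = 0 /\
  ip (v - (gramdet a b)^-1 *: gramproj a b v) b = 0.
Proof.
move=> g0; rewrite !ipBl !ipZl /gramproj !ipDl !ipZl (ipC b a).
split; apply/eqP; rewrite subr_eq0; apply/eqP; apply: (mulfI g0); rewrite mulrA mulfV // mul1r;
  rewrite /gramdet; ring.
Qed.

Definition mxcvg T (F : set_system T) m (A : T -> 'M[R]_m) (A0 : 'M[R]_m) :=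
  forall i j, (fun h => A h i j) @ F --> A0 i j.

Lemma ip_cvg T (F : set_system T) {FF : Filter F} m (A B : T -> 'M[R]_m) A0 B0 :
  mxcvg F A A0 -> mxcvg F B B0 -> (fun h => ip (A h) (B h)) @ F --> ip A0 B0.
Proof.
move=> hA hB; rewrite ipE; under eq_fun do rewrite ipE.
apply: cvg_sumr => i; apply: cvg_sumr => j; apply: cvgM; [exact: hA | exact: hB].
Qed.

Lemma gramdet_cvg T (F : set_system T) {FF : Filter F} m (a b : T -> 'M[R]_m) a0 b0 :
  mxcvg F a a0 -> mxcvg F b b0 -> (fun h => gramdet (a h) (b h)) @ F --> gramdet a0 b0.
Proof.
move=> ha hb; rewrite /gramdet expr2; under eq_fun do rewrite expr2.
by apply: cvgB; apply: cvgM; apply: ip_cvg.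
Qed.

Lemma gramproj_cvg T (F : set_system T) {FF : Filter F} m (a b v : T -> 'M[R]_m) a0 b0 v0 :
  mxcvg F a a0 -> mxcvg F b b0 -> mxcvg F v v0 ->
  mxcvg F (fun h => gramproj (a h) (b h) (v h)) (gramproj a0 b0 v0).
Proof.
move=> ha hb hv i j; rewrite /gramproj !mxE.
under eq_fun do rewrite !mxE.
apply: cvgD; apply: cvgM; [|exact: ha| |exact: hb];
  by apply: cvgB; apply: cvgM; apply: ip_cvg.
Qed.

Lemma cvg_eq_near T (F : set_system T) {FF : ProperFilter F} (f g : T -> R) (a b : R) :
  f @ F --> a -> g @ F --> b -> (\forall h \near F, f h = g h) -> a = b.
Proof.
move=> fa gb fg; apply: (cvg_unique (@Rhausdorff R) fa).
by apply: cvg_trans gb; apply: near_eq_cvg; apply: filterS fg => h ->.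
Qed.

Lemma quotient_cvg k (f : 'rV[R]_k -> R) y0 w : differentiable f y0 ->
  (fun h : R => h^-1 * (f (h *: w + y0) - f y0)) @ 0^' --> 'D_w f y0.
Proof. by move=> /(@diff_derivable _ _ _ f y0 w) df; exact: df. Qed.

End Gram.

Section Frames.
Variables (R : realType) (X : topologicalType) (B : set (chart R X)) (m : nat).
Variable u : X -> {vspace 'M[R]_m}.
Hypothesis hu : fitting_immersion B u.
Hypothesis hcov : forall x, exists2 c, B c & dom c x.

Definition annih (P : {vspace 'M[R]_m}) (A : 'M[R]_m) := forall q, q \in P -> ip A q = 0.

Lemma annih_span A a b : annih <<[:: a; b]>>%VS A <-> ip A a = 0 /\ ip A b = 0.
Proof.
split=> [h|[ha hb] q /span2P[l1 [l2 ->]]].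
  by split; apply: h; apply/span2P; [exists 1, 0 | exists 0, 1];
     rewrite scale1r scale0r ?addr0 ?add0r.
by rewrite ipDr !ipZr ha hb !mulr0 addr0.
Qed.

Definition frame_at (q1 q2 : 'M[R]_m) (k : 'I_2) := if k == 0 then q1 else q2.

Lemma annih_frame A a b : annih <<[:: a; b]>>%VS A <-> forall k, ip A (frame_at a b k) = 0.
Proof.
split=> [/annih_span[ha hb] k|h]; first by rewrite /frame_at; case: ifP.
by apply/annih_span; split; [exact: (h 0) | exact: (h 1)].
Qed.

Lemma sum_frame (l : 'I_2 -> R) a b :
  \sum_k l k *: frame_at a b k = l 0 *: a + l 1 *: b.
Proof. by rewrite big_ord_recl big_ord1; congr (_ + l _ *: _); apply/val_inj. Qed.

Lemma chart_img_open (c : chart R X) W : open W -> open (fwd c @` (dom c `&` W)).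
Proof.
move=> oW; rewrite openE => _ [x [dx Wx] <-].
have := chart_near dx (open_nbhs_nbhs (conj oW Wx)); apply: nbhsS => y [iy Wy].
by exists (bwd c y); [split=> //; exact: (chart_bwd iy).1 | exact: (chart_bwd iy).2].
Qed.

(** Fitting concerns an arbitrary local section [s]. If [s x0 = l1 q1 + l2 q2], then
    [s - l1 q1 - l2 q2] is a section that vanishes at [x0], so its derivative lies in [u x0]. Hence
    the positive definite [r] is the same combination of the derivatives of the frame, up to an
    element of [u x0]. *)
Lemma pencil_chart x0 : exists c (q1 q2 : X -> 'M[R]_m) (V : set 'rV[R]_2),
  [/\ B c /\ dom c x0, nbhs (fwd c x0) V /\ V `<=` fwd c @` dom c,
      forall y, V y -> u (bwd c y) = <<[:: q1 (bwd c y); q2 (bwd c y)]>>%VS,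
      (forall k i j y, V y ->
        differentiable (fun y => frame_at (q1 (bwd c y)) (q2 (bwd c y)) k i j) y) /\
      (forall k i j v, {for fwd c x0, continuous (fun y =>
        'D_v (fun y => frame_at (q1 (bwd c y)) (q2 (bwd c y)) k i j) y)})
    & forall w : 'rV[R]_2, w != 0 -> exists l a : 'I_2 -> R, posdef (
       \sum_k l k *: (\matrix_(i, j) 'D_w
          (fun y => frame_at (q1 (bwd c y)) (q2 (bwd c y)) k i j) (fwd c x0)) +
       \sum_k a k *: frame_at (q1 (bwd c (fwd c x0))) (q2 (bwd c (fwd c x0))) k)].
Proof.
case: (hu) => hpen _ [hsm _] hfit; have [c Bc dx] := hcov x0.
have [W [q1 [q2 [oW Wx s1 s2 eu]]]] := hsm x0.
pose V := fwd c @` (dom c `&` W); pose y0 := fwd c x0.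
have Vy0 : V y0 by exists x0.
have hV : nbhs y0 V by apply: open_nbhs_nbhs; split=> //; exact: chart_img_open.
have VW y : V y -> W (bwd c y) by move=> [x [dx' Wx'] <-]; rewrite fwdK.
have euV y : V y -> u (bwd c y) = <<[:: q1 (bwd c y); q2 (bwd c y)]>>%VS.
  by move=> /VW; exact: eu.
have C1 k i j : Ck_on 1 V (fun y => frame_at (q1 (bwd c y)) (q2 (bwd c y)) k i j).
  by rewrite /frame_at; case: (k == 0); [exact: (s1 c Bc i j 1%N) | exact: (s2 c Bc i j 1%N)].
have dV k i j y : V y ->
    differentiable (fun y => frame_at (q1 (bwd c y)) (q2 (bwd c y)) k i j) y.
  by move=> Vy; exact: (C1 k i j).1.
exists c, q1, q2, V; split=> //.
- by split=> // y [x [dx' _] <-]; exists x.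
- by split=> // k i j v; exact: ((C1 k i j).2 v _ Vy0).
move=> w w0; have [q [r [[W1 [s [oW1 W1x ss su [sq rd]]]] rp]]] := hfit c x0 w Bc dx w0.
have bx : bwd c y0 = x0 by rewrite /y0 fwdK.
have ux : u x0 = <<[:: q1 x0; q2 x0]>>%VS by rewrite -{1}bx euV // bx.
have /span2P[l1 [l2 eq]] : q \in <<[:: q1 x0; q2 x0]>>%VS by rewrite -ux -sq su.
have ds i j : differentiable (fun y => s (bwd c y) i j) y0.
  by have [h _] := ss c Bc i j 1%N; apply: h; exists x0.
have d1 i j := dV 0 i j y0 Vy0; have d2 i j := dV 1 i j y0 Vy0.
pose J1 := tangent_deriv c w x0 q1; pose J2 := tangent_deriv c w x0 q2.
pose Ds := tangent_deriv c w x0 s.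
pose d := Ds - l1 *: J1 - l2 *: J2.
(* The difference quotient of that section; it lies in the pencil at the moving point. *)
pose v (h : R) := h^-1 *: (s (bwd c (h *: w + y0)) - l1 *: q1 (bwd c (h *: w + y0))
   - l2 *: q2 (bwd c (h *: w + y0))).
have vd : mxcvg 0^' v d.
  move=> i j.
  have e : (fun h => v h i j) = (fun h =>
      h^-1 * (s (bwd c (h *: w + y0)) i j - s (bwd c y0) i j) -
      l1 * (h^-1 * (q1 (bwd c (h *: w + y0)) i j - q1 (bwd c y0) i j)) -
      l2 * (h^-1 * (q2 (bwd c (h *: w + y0)) i j - q2 (bwd c y0) i j))).
    by apply/funext => h; rewrite bx sq eq /v !mxE; ring.
  have -> : d i j = Ds i j - l1 * J1 i j - l2 * J2 i j by rewrite !mxE.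
  rewrite e; apply: cvgB; first apply: cvgB.
  - by rewrite mxE; exact: quotient_cvg.
  - by apply: cvgMl_tmp; rewrite mxE; exact: (quotient_cvg (d1 i j)).
  - by apply: cvgMl_tmp; rewrite mxE; exact: (quotient_cvg (d2 i j)).
have lc : (fun h : R => h *: w + y0) @ 0^' --> y0.
  have h0 : (fun h : R => h *: w + y0) @ 0 --> (0 *: w + y0).
    by apply: cvgD; [apply: cvgZr_tmp; exact: cvg_id | exact: cvg_cst].
  rewrite scale0r add0r in h0; apply: cvg_trans h0.
  by apply: cvg_app; exact: cvg_within.
have fc (f : X -> 'M[R]_m) : (forall i j, differentiable (fun y => f (bwd c y) i j) y0) ->
    mxcvg (0 : R)^' (fun h : R => f (bwd c (h *: w + y0))) (f x0).
  move=> df i j; have := differentiable_continuous (df i j).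
  by move=> h; rewrite -bx; exact: (cvg_comp _ _ lc h).
have c1 : mxcvg (0 : R)^' (fun h : R => q1 (bwd c (h *: w + y0))) (q1 x0) by exact: fc.
have c2 : mxcvg (0 : R)^' (fun h : R => q2 (bwd c (h *: w + y0))) (q2 x0) by exact: fc.
have hn : \forall h \near (0 : R)^', gramdet (q1 (bwd c (h *: w + y0))) (q2 (bwd c (h *: w + y0))) *: v h
    = gramproj (q1 (bwd c (h *: w + y0))) (q2 (bwd c (h *: w + y0))) (v h).
  have h1 : nbhs y0 (fun y => V y /\ W1 (bwd c y)).
    apply: nbhsI2 => //; have := chart_near dx (open_nbhs_nbhs (conj oW1 W1x)).
    by apply: nbhsS => y [].
  have h2 : \forall h \near (0 : R)^', V (h *: w + y0) /\ W1 (bwd c (h *: w + y0)).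
    exact: (lc _ h1).
  apply: filterS h2 => h [Vh W1h]; apply: gramproj_span; rewrite -euV //.
  have := su _ W1h; rewrite /v => sh.
  apply: memvZ; apply: memvB; first apply: memvB => //; apply: memvZ; rewrite euV //;
    apply/span2P; [exists 1, 0 | exists 0, 1]; by rewrite scale1r scale0r ?addr0 ?add0r.
have [dim2 sym] := hpen x0.
have q1u : q1 x0 \in u x0 by rewrite ux; apply/span2P; exists 1, 0; rewrite scale1r scale0r addr0.
have q2u : q2 x0 \in u x0 by rewrite ux; apply/span2P; exists 0, 1; rewrite scale1r scale0r add0r.
have g0 := gramdet_neq0 dim2 ux (sym _ q1u) (sym _ q2u).
(* Passage to the limit in the Gram identity shows that the span condition is closed although the
   pencil varies. *)
have eqd : gramdet (q1 x0) (q2 x0) *: d = gramproj (q1 x0) (q2 x0) d.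
  apply/matrixP => i j; rewrite [LHS]mxE.
  apply: (@cvg_eq_near _ _ 0^' _ _ _ _ _ (cvgM (gramdet_cvg c1 c2) (vd i j))
    (gramproj_cvg c1 c2 vd (i := i) (j := j))).
  by apply: filterS hn => h /matrixP/(_ i j); rewrite mxE.
have du : d \in u x0.
  have -> : d = (gramdet (q1 x0) (q2 x0))^-1 *: gramproj (q1 x0) (q2 x0) d.
    by rewrite -eqd scalerA mulVf // scale1r.
  by apply: memvZ; apply: memvD; apply: memvZ.
have : d + (r - Ds) \in u x0 by exact: memvD.
rewrite ux => /span2P[a1 [a2 ea]].
pose l := fun k : 'I_2 => if k == 0 then l1 else l2.
pose a := fun k : 'I_2 => if k == 0 then a1 else a2.
exists l, a; rewrite -/y0 bx sum_frame.
have -> : \sum_k l k *: (\matrix_(i, j) 'D_w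
   (fun y => frame_at (q1 (bwd c y)) (q2 (bwd c y)) k i j) y0) = l1 *: J1 + l2 *: J2.
  by rewrite big_ord_recl big_ord1.
suff -> : l1 *: J1 + l2 *: J2 + (a 0 *: q1 x0 + a 1 *: q2 x0) = r by [].
by rewrite -[a 0]/a1 -[a 1]/a2 -ea /d; apply/matrixP => i j; rewrite !mxE; ring.
Qed.

(** The two balls of the plane statement: zeros are unique in [W], and zeros in [U] persist into
    [W]. *)
Lemma local_zeros (x0 : X) (N : set X) : nbhs x0 N -> exists (W U : set X) (e : R),
  [/\ open W, W `<=` N, nbhs x0 U /\ U `<=` W, 0 < e
    & (forall A x x', possemidef A -> A != 0 -> W x -> W x' ->
        annih (u x) A -> annih (u x') A -> x = x') /\
      (forall A A' x, possemidef A -> A != 0 -> possemidef A' -> U x ->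
        annih (u x) A -> `|A' - A| <= e * \tr A -> exists2 x', W x' & annih (u x') A')].
Proof.
move=> hN; have [c [q1 [q2 [V [[Bc dx] [hV Vc] eu [dQ cQ] hf]]]]] := pencil_chart x0.
have hV' : nbhs (fwd c x0) (fun y => N (bwd c y)).
  by apply: nbhsS (chart_near dx hN) => y [].
pose Q k y := frame_at (q1 (bwd c y)) (q2 (bwd c y)) k.
have [r [e [r0 e0 br ha hb]]] := local_zeros_plane (Q := Q) hV dQ cQ hf hV'.
pose W := dom c `&` [set x | ball (fwd c x0) r (fwd c x)].
have bW y : ball (fwd c x0) r y -> W (bwd c y).
  move=> hy; have [/Vc iy _] := br _ hy; have [d1 d2] := chart_bwd iy.
  by split=> //=; rewrite d2.
have uz x A : W x -> annih (u x) A <-> forall k, ip A (Q k (fwd c x)) = 0.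
  move=> [dx' bx']; have [Vx _] := br _ bx'.
  by have := eu _ Vx; rewrite /Q fwdK // => ->; exact: annih_frame.
exists W, (dom c `&` [set x | ball (fwd c x0) (r / 2) (fwd c x)]), e; split=> //.
- rewrite openE => x [dx' bx']; apply: (chart_dom_nbhs dx').
  by apply: open_nbhs_nbhs; split=> //; exact: ball_open.
- by move=> x [dx' /br[_]]; rewrite fwdK.
- split; first by apply: chart_dom_nbhs => //; apply: nbhsx_ballx; rewrite divr_gt0.
  by move=> x [dx' bx']; split=> //=; apply: le_ball bx'; lra.
split=> [A x x' Ap A0 Wx Wx' /(uz _ _ Wx) zx /(uz _ _ Wx') zx'|].
  have := ha A _ _ Ap A0 Wx.2 Wx'.2 zx zx'.
  by move=> /(congr1 (bwd c)); rewrite !fwdK //; [exact: Wx'.1 | exact: Wx.1].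
move=> A A' x Ap A0 Ap' [dx' bx'] zx hAA.
have Wx : W x by split=> //=; apply: le_ball bx'; lra.
have [y' by' hy'] := hb A A' _ Ap A0 Ap' bx' ((uz _ _ Wx).1 zx) hAA.
exists (bwd c y'); first exact: bW.
apply/uz; first exact: bW.
by have [/Vc iy _] := br _ by'; rewrite (chart_bwd iy).2.
Qed.

(** [A] minus its orthogonal projection to [u x] depends continuously on [x], and the projection
    vanishes at [x0]. *)
Lemma annih_perturb (x0 : X) A (delta : R) : annih (u x0) A -> A^T = A -> 0 < delta ->
  nbhs x0 (fun x => exists A', [/\ A'^T = A', annih (u x) A' & `|A' - A| <= delta]).
Proof.
move=> zA As d0; have [c [q1 [q2 [V [[Bc dx] [hV Vc] eu [dQ cQ] _]]]]] := pencil_chart x0.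
case: (hu) => hpen _ _ _; have bx : bwd c (fwd c x0) = x0 by rewrite fwdK.
pose a y := q1 (bwd c y); pose b y := q2 (bwd c y).
pose A' y := A - (gramdet (a y) (b y))^-1 *: gramproj (a y) (b y) A.
have Vy0 := nbhs_singleton hV.
have ca : mxcvg (nbhs (fwd c x0)) a (a (fwd c x0)).
  by move=> i j; exact: (differentiable_continuous (dQ 0 i j _ Vy0)).
have cb : mxcvg (nbhs (fwd c x0)) b (b (fwd c x0)).
  by move=> i j; exact: (differentiable_continuous (dQ 1 i j _ Vy0)).
have sp y : V y -> [/\ \dim (u (bwd c y)) = 2, (a y)^T = a y & (b y)^T = b y].
  move=> Vy; have [dim2 sym] := hpen (bwd c y); split=> //; apply: sym; rewrite eu //;
    apply/span2P; [exists 1, 0 | exists 0, 1]; by rewrite scale1r scale0r ?addr0 ?add0r.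
have gd y : V y -> gramdet (a y) (b y) != 0.
  by move=> Vy; have [dim2 s1 s2] := sp y Vy; exact: gramdet_neq0 dim2 (eu y Vy) s1 s2.
have P0 : gramproj (a (fwd c x0)) (b (fwd c x0)) A = 0.
  have : annih (u (bwd c (fwd c x0))) A by rewrite bx.
  rewrite eu // => /annih_span[z1 z2].
  by rewrite /gramproj /a /b z1 z2 !mulr0 subrr !scale0r addr0.
have cA' i j : (fun y => A' y i j) @ nbhs (fwd c x0) --> A i j.
  have e : (fun y => A' y i j) =
      (fun y => A i j + - (gramdet (a y) (b y))^-1 * gramproj (a y) (b y) A i j).
    by apply/funext => y; rewrite /A' -scaleNr addmxE scalemxE.
  have e0 : A i j = A i j + - (gramdet (a (fwd c x0)) (b (fwd c x0)))^-1 *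
      gramproj (a (fwd c x0)) (b (fwd c x0)) A i j.
    by rewrite P0 [X in _ * X]mxE mulr0 addr0.
  rewrite e {2}e0; apply: cvgD; first exact: cvg_cst.
  apply: cvgM; first by apply: cvgN; apply: cvgV; [exact: gd | exact: gramdet_cvg].
  by apply: gramproj_cvg => // i' j'; exact: cvg_cst.
have : nbhs (fwd c x0) (fun y => V y /\ forall ij : 'I_m * 'I_m, `|A' y ij.1 ij.2 - A ij.1 ij.2| < delta).
  apply: nbhsI2 => //; apply: nbhs_forall => -[i j] /=.
  have := cA' i j _ (nbhsx_ballx (A i j) delta d0); apply: nbhsS => y.
  by rewrite /= -ball_normE /= distrC.
move=> /(chart_dom_nbhs dx); apply: nbhsS => x [dx' [Vx hx]].
exists (A' (fwd c x)); have [dim2 s1 s2] := sp _ Vx; split.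
- by rewrite /A' [LHS]linearB /= As [X in _ - X]linearZ /= [X in _ - _ *: X]linearD /=
    ![(_ *: _)^T]linearZ /= s1 s2.
- have := eu _ Vx; rewrite fwdK // => ->; apply/annih_span.
  have := gramproj_ip A (gd _ Vx); rewrite /A' /a /b fwdK //.
- apply: mx_norm_leP => [|i j]; first exact: ltW.
  by rewrite [X in `|X|]mxE [X in _ + X]mxE; apply/ltW/(hx (i, j)).
Qed.

End Frames.

(** * Annihilators of a pencil and the action of the group on forms *)

Section Annihilators.
Variable R : realType.

Lemma compact_finite (T : topologicalType) (K : set T) (I : choiceType) (P : I -> set T) :
  compact K -> (forall x, K x -> exists i, nbhs x (P i)) ->
  exists s : seq I, forall x, K x -> exists2 i, i \in s & P i x.
Proof.
move=> /compact_near_coveringP cK hP.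
pose F := filter_from (@setT (seq I)) (fun s => [set s' : seq I | {subset s <= s'}]).
have FF : Filter F.
  apply: filter_from_filter; first by exists [::].
  move=> s t _ _; exists (s ++ t) => // u hu; split=> a ha; apply: hu.
    by rewrite mem_cat ha.
  by rewrite mem_cat ha orbT.
have [x Kx|s _ hs] := cK _ F (fun s x => exists2 i, i \in s & P i x) FF; last first.
  by exists s => x Kx; exact: (hs s (fun _ h => h)).
have [i hi] := hP x Kx; exists (P i, [set s : seq I | i \in s]) => /=.
  by split=> //; exists [:: i] => // s hs; apply: hs; rewrite mem_head.
by move=> [x' s] /= [Pi si]; exists i.
Qed.

(** Near a positive definite form, a norm error is absorbed by the form itself, so norm closeness
    gives order closeness. *)
Lemma posdef_close m (A0 : 'M[R]_m) (e : R) : posdef A0 -> 0 < e -> exists2 d, 0 < d &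
  forall A A', A^T = A -> A'^T = A' -> `|A - A0| <= d -> `|A' - A0| <= d ->
    posdef A /\ psd_close e A A'.
Proof.
move=> Ap e0; have [c c0 hc] := posdef_lb Ap.
have [d1 d10 hd1] := posdef_open Ap.
pose M : R := m%:R ^+ 2 + 1.
have M0 : 0 < M by rewrite ltr_wpDl // exprn_ge0.
pose f := Num.min e 1; have f0 : 0 < f by rewrite lt_min e0 ltr01.
pose d := Num.min d1 (f * c / (4 * M)).
have d0 : 0 < d by rewrite lt_min d10 !(divr_gt0, mulr_gt0).
have fe : f <= e by rewrite ge_min lexx.
have f1 : f <= 1 by rewrite ge_min lexx orbT.
have dM : 4 * M * d <= f * c.
  have : d <= f * c / (4 * M) by rewrite ge_min lexx orbT.
  by rewrite ler_pdivlMr ?mulr_gt0 // mulrC.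
exists d => // A A' As As' hA hA'.
have qd B v : `|B - A0| <= d -> `|qf B v - qf A0 v| <= M * d * nsq v.
  move=> hB; rewrite -qfB; apply: le_trans (qf_norm _ _) _.
  rewrite ler_wpM2r ?nsq_ge0 // ler_pM ?exprn_ge0 // lerDl //.
have q0 v : c * nsq v <= qf A0 v.
  by have := hc.2 v; rewrite -/(qf _ _) qfB -scalemx1 qfZ -nsqE subr_ge0.
split; first by apply: hd1 => //; apply: le_trans hA _; rewrite ge_min lexx.
have main v : `|qf A' v - qf A v| <= e * qf A v.
  have h1 := qd A v hA; have h2 := qd A' v hA'; have h3 := q0 v; have nv := nsq_ge0 v.
  have h4 : 4 * M * d * nsq v <= f * c * nsq v by rewrite ler_wpM2r.
  have h5 : f * c * nsq v <= c * nsq v by rewrite ler_wpM2r // -[leRHS]mul1r ler_wpM2r // ltW.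
  have h6 : f * (c * nsq v) <= f * (2 * qf A v).
    by rewrite ler_wpM2l ?(ltW f0) //; move: h1; rewrite ler_norml => /andP[h1 h1']; lra.
  have h7 : 0 <= qf A v.
    have : 0 <= c * nsq v by rewrite mulr_ge0 // ltW.
    by move: h1; rewrite ler_norml => /andP[h1 h1']; lra.
  have h8 : f * qf A v <= e * qf A v by rewrite ler_wpM2r.
  have h9 : `|qf A' v - qf A v| <= 2 * (M * d * nsq v).
    rewrite -(subrKA (qf A0 v)); apply: le_trans (ler_normD _ _) _.
    by rewrite (distrC (qf A0 v)); lra.
  lra.
split; split.
- by rewrite [LHS]linearB /= As' [X in _ - X]linearZ /= As.
- move=> v; rewrite -/(qf _ _) qfB qfZ; have := main v; rewrite ler_norml => /andP[h _]; lra.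
- by rewrite [LHS]linearB /= As' [X in X - _]linearZ /= As.
- move=> v; rewrite -/(qf _ _) qfB qfZ; have := main v; rewrite ler_norml => /andP[_ h]; lra.
Qed.

Lemma gramproj_adj m (a b v w : 'M[R]_m) :
  ip v (gramproj a b w) = ip w (gramproj a b v).
Proof. by rewrite /gramproj !ipDr !ipZr; ring. Qed.

Lemma ip_delta m (A : 'M[R]_m) i j : ip A (delta_mx i j) = A j i.
Proof.
rewrite ipE (bigD1 j) //= (bigD1 i) //= !big1 ?addr0 ?mxE ?eqxx ?mulr1 //.
  by move=> k /negbTE kj; apply: big1 => l _; rewrite mxE kj andbF mulr0.
by move=> k /negbTE ki; rewrite mxE ki mulr0.
Qed.

Lemma gramproj_mem m (a b v : 'M[R]_m) : gramproj a b v \in <<[:: a; b]>>%VS.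
Proof. by apply/span2P; eexists; eexists. Qed.

(* Otherwise [psd_alternative], applied to a spanning family of the orthogonal of P,
   would give a nonzero PSD element of the double orthogonal of P, which is P. *)
Lemma posdef_annih m (P : {vspace 'M[R]_m}) : pencil P ->
  (forall q, q \in P -> possemidef q -> q = 0) -> exists A, posdef A /\ annih P A.
Proof.
move=> [dim2 sym] hP.
have : exists a b, P = <<[:: a; b]>>%VS.
  have := vbasisP P; move: (vbasis P); rewrite dim2 => -[s hs] /span_basis /= <-.
  by case: s hs => [|a [|b [|? ?]]] // _; exists a, b.
move=> [a [b eP]].
have aP : a \in P by rewrite eP; apply/span2P; exists 1, 0; rewrite scale1r scale0r addr0.
have bP : b \in P by rewrite eP; apply/span2P; exists 0, 1; rewrite scale1r scale0r add0r.
have g0 := gramdet_neq0 dim2 eP (sym _ aP) (sym _ bP).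
pose E (ij : 'I_m * 'I_m) : 'M[R]_m := delta_mx ij.1 ij.2 + delta_mx ij.2 ij.1.
pose pr v := v - (gramdet a b)^-1 *: gramproj a b v.
have prs v : v^T = v -> (pr v)^T = pr v.
  move=> vs; rewrite /pr [LHS]linearB /= vs [X in _ - X]linearZ /=; congr (_ - _ *: _).
  by apply: sym; rewrite eP; exact: gramproj_mem.
have Es ij : (E ij)^T = E ij by rewrite [LHS]linearD /= !trmx_delta addrC.
have pra v : annih P (pr v) by rewrite eP; apply/annih_span; exact: gramproj_ip.
apply: contrapT => none.
have [ij|c cp|B [Bp Bt hB]] := @psd_alternative R m _ (fun ij => pr (E ij)).
- exact: prs.
- apply: none; exists (\sum_ij c ij *: pr (E ij)); split=> // q qP.
  rewrite ipC; elim/big_rec: _ => [|ij x _ hx]; first by rewrite ip0r.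
  by rewrite ipDr ipZr hx addr0 ipC pra // mulr0.
have B0 : pr B = 0.
  apply/matrixP => i j; rewrite [RHS]mxE.
  have : ip (pr B) (E (i, j)) = 0.
    rewrite -(hB (i, j)) /pr ipBl ipZl ipBr ipZr; congr (_ - _ * _).
    by rewrite gramproj_adj ipC.
  have prBs := prs _ Bp.1.
  have e : pr B j i = pr B i j by rewrite -[in RHS]prBs [RHS]mxE.
  by rewrite ipDr !ip_delta /= e => h; lra.
have BP : B \in P.
  move/eqP: B0; rewrite subr_eq0 => /eqP ->; apply: memvZ; rewrite eP; exact: gramproj_mem.
by move/eqP: Bt; rewrite (hP B BP Bp) mxtrace0 eq_sym oner_eq0.
Qed.

Lemma posdef_neq0 m (A : 'M[R]_m) : (0 < m)%N -> posdef A -> A != 0.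
Proof.
case: m A => // m A _ [_ h]; apply/negP => /eqP A0; have := h (delta_mx 0 0).
rewrite A0 mulmx0 mul0mx mxE ltxx => h'; have : false; last by [].
by apply: h'; apply/negP => /eqP/matrixP/(_ 0 0)/eqP; rewrite !mxE eqxx oner_eq0.
Qed.

(** The action on [S^2 V] dual to [quadric_act]; [ip_gact] is the invariance of the pairing. *)
Definition gact m (g A : 'M[R]_m) := g *m A *m g^T.

Lemma gactM m (g h A : 'M[R]_m) : gact (g *m h) A = gact g (gact h A).
Proof. by rewrite /gact trmx_mul !mulmxA. Qed.

Lemma gact1 m (A : 'M[R]_m) : gact 1%:M A = A.
Proof. by rewrite /gact tr_scalar_mx mulmx1 mul1mx. Qed.

Lemma gactZ m (g A : 'M[R]_m) a : gact g (a *: A) = a *: gact g A.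
Proof. by rewrite /gact -scalemxAr -scalemxAl. Qed.

Lemma gactB m (g A B : 'M[R]_m) : gact g (A - B) = gact g A - gact g B.
Proof. by rewrite /gact mulmxBr mulmxBl. Qed.

Lemma gact_psd m (g A : 'M[R]_m) : possemidef A -> possemidef (gact g A).
Proof.
case=> As Ap; split; first by rewrite /gact !trmx_mul trmxK As mulmxA.
by move=> v; rewrite -/(qf _ _) /gact -{1}[g]trmxK qf_congr; exact: Ap.
Qed.

Lemma gact_close m (g A B : 'M[R]_m) (e : R) : psd_close e A B -> psd_close e (gact g A) (gact g B).
Proof. by move=> [h1 h2]; split; rewrite /psd_le -gactZ -gactB; exact: gact_psd. Qed.

Lemma ip_gact m (g A q : 'M[R]_m) : g \in unitmx -> ip (gact g A) (quadric_act g q) = ip A q.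
Proof.
move=> gu; rewrite /ip /gact /quadric_act -!mulmxA (mulmxA g^T) trmx_inv mulmxV ?unitmx_tr //.
by rewrite mul1mx mxtrace_mulC -!mulmxA mulVmx // mulmx1.
Qed.

End Annihilators.

(** * Global uniqueness of zeros and word length *)

Section Words.
Variable G : groupType.
Implicit Types (s F : seq G) (a b : G).

Lemma is_word1 s : is_word s 0 1%g.
Proof. by exists [::]. Qed.

Lemma is_word_gen s a : a \in s -> is_word s 1 a.
Proof. by move=> sa; exists [:: a]; split=> //=; rewrite ?sa // mulg1. Qed.

Lemma is_wordM s j k a b : is_word s j a -> is_word s k b -> is_word s (j + k) (a * b)%g.
Proof.
move=> [v [<- hv ->]] [w [<- hw ->]]; exists (v ++ w); split.
- by rewrite size_cat.
- by rewrite all_cat hv.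
- by elim: v {hv} => [|x v IH] /=; rewrite ?mul1g // -mulgA IH.
Qed.

Lemma word_length_le s (hs : generates s) k a : is_word s k a -> (word_length hs a <= k)%N.
Proof. by move=> h; rewrite /word_length; case: ex_minnP => i _; apply; apply/asboolP. Qed.

Lemma word_lengthP s (hs : generates s) a : is_word s (word_length hs a) a.
Proof. by rewrite /word_length; case: ex_minnP => i /asboolP. Qed.

Lemma word_lengthM s (hs : generates s) a b :
  (word_length hs (a * b)%g <= word_length hs a + word_length hs b)%N.
Proof. by apply: word_length_le; apply: is_wordM; exact: word_lengthP. Qed.

(** One half of the equivalence of word metrics: a bound obtained with the letters [F] transfers to
    any generating list. *)
Lemma word_length_bounded s (hs : generates s) F : exists2 L, (0 < L)%N &
  forall k a, is_word F k a -> (word_length hs a <= L * k)%N.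
Proof.
have [L [L0 hL]] : exists L, (0 < L)%N /\ forall x, x \in F ->
    (word_length hs x <= L)%N /\ (word_length hs x^-1%g <= L)%N.
  elim: F => [|f F [L [L0 hL]]]; first by exists 1%N.
  exists (L + word_length hs f + word_length hs f^-1%g)%N; split.
    by rewrite -addnA addn_gt0 L0.
  move=> x; rewrite in_cons => /orP[/eqP ->|/hL[h1 h2]]; first by split; lia.
  by split; lia.
exists L => // _ _ [w [<- hw ->]]; elim: w hw => [_|x w IH /= /andP[hx /IH hw]] /=.
  by rewrite muln0; apply: word_length_le; exact: is_word1.
apply: leq_trans (word_lengthM hs _ _) _; rewrite mulnS; apply: leq_add hw.
by case/orP: hx => /hL[h1 h2] //; rewrite -(invgK x).
Qed.

End Words.

(** * Following zeros over the universal cover *)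

Section Global.
Variables (R : realType) (m : nat) (S X : topologicalType) (A : set (chart R S)).
Variables (p : X -> S) (G : groupType) (act : G -> X -> X).
Variables (rho : G -> 'M[R]_m) (u : X -> {vspace 'M[R]_m}).
Hypothesis hS : closed_oriented_surface A.
Hypothesis hp : universal_cover R p.
Hypothesis hact : deck_group p act.
Hypothesis hrho : SL_representation rho.
Hypothesis hu : fitting_immersion (lift_atlas p A) u.
Hypothesis hequi : equivariant act rho u.
Hypothesis m_gt0 : (0 < m)%N.

Let hsS : hausdorff_space S. Proof. by case: hS. Qed.
Let cov : covering_map p. Proof. by case: hp. Qed.
Let sc : simply_connected R X. Proof. by case: hp. Qed.
Let hX : hausdorff_space X := covering_hausdorff cov hsS.

Lemma cover_chart x : exists2 c, lift_atlas p A c & dom c x.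
Proof.
case: hS => _ _ _ [h _]; have [d Ad dx] := h (p x).
exact: (lift_chart cov Ad dx).
Qed.

Lemma cover_path (x : X) (N : set X) : nbhs x N -> exists2 M, nbhs x M &
  forall y, M y -> exists c, path_in (R := R) N c x y.
Proof. by move=> hN; have [c _ dx] := cover_chart x; exact: (chart_path dx hN). Qed.

Lemma rho_unit a : rho a \in unitmx.
Proof. by case: hrho => _ _ /(_ a) h; rewrite unitmxE h unitr1. Qed.

Lemma gact_rhoK a B : gact (rho a^-1%g) (gact (rho a) B) = B.
Proof. by case: hrho => r1 rM _; rewrite -gactM -rM mulVg r1 gact1. Qed.

Lemma gact_rho_neq0 a B : B != 0 -> gact (rho a) B != 0.
Proof.
by apply: contra_neq => h; rewrite -(gact_rhoK a B) h /gact mulmx0 mul0mx.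
Qed.

Lemma annih_act a x B : annih (u x) B -> annih (u (act a x)) (gact (rho a) B).
Proof.
move=> h q qu; have : [set` u (act a x)] q by [].
by rewrite hequi => -[q0 q0u <-]; rewrite ip_gact ?rho_unit //; exact: h.
Qed.

Lemma annih_actV a x B : annih (u (act a x)) (gact (rho a) B) -> annih (u x) B.
Proof.
move=> h; have := @annih_act a^-1%g _ _ h.
by rewrite gact_rhoK (actK hact).
Qed.

Lemma proj_nbhs x U : nbhs x U -> nbhs (p x) (p @` U).
Proof.
rewrite nbhsE => -[N [oO Ox] OU]; have [W [oW _ _ opW] Wx] := exists_sheet cov x.
have h : open (p @` (N `&` W)) by apply: opW => [|? []//]; exact: openI.
have : nbhs (p x) (p @` (N `&` W)) by apply: open_nbhs_nbhs; split=> //; exists x.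
by apply: nbhsS => _ [y [Oy Wy] <-]; exists y => //; exact: OU.
Qed.

(** Finitely many projected sets [U k] cover the compact [S], and the local statements are carried
    elsewhere by deck transformations, acting on forms by [gact]. The threshold survives because
    [psd_close] is invariant. The compact sets [K k] are kept for the finiteness of overlaps. *)
Lemma uniform_local_zeros : exists (l : seq X) (W U K : X -> set X) (e : R),
  [/\ 0 < e,
      forall k, [/\ open (W k), U k `<=` W k, W k `<=` K k & compact (K k)],
      forall x, exists k a, k \in l /\ nbhs (act a x) (U k),
      forall k a B x x', possemidef B -> B != 0 -> W k (act a x) -> W k (act a x') ->
        annih (u x) B -> annih (u x') B -> x = x'
    & forall k a B B' x, k \in l -> possemidef B -> B != 0 -> possemidef B' ->
        U k (act a x) -> annih (u x) B -> psd_close e B B' ->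
        exists2 x', W k (act a x') & annih (u x') B'].
Proof.
have : forall x : X, exists D : set X * set X * set X * R, let: (W, U, K, e) := D in
  [/\ [/\ open W, U `<=` W, W `<=` K & compact K], nbhs x U, 0 < e,
    (forall B x x', possemidef B -> B != 0 -> W x -> W x' ->
        annih (u x) B -> annih (u x') B -> x = x') &
    (forall B B' x, possemidef B -> B != 0 -> possemidef B' -> U x ->
        annih (u x) B -> `|B' - B| <= e * \tr B -> exists2 x', W x' & annih (u x') B')].
  move=> x; have [c _ dx] := cover_chart x.
  have [K [cK xK _]] := chart_compact_nbhs dx filterT.
  have [W [U [e [oW WK [xU UW] e0 [hW hU]]]]] := local_zeros hu cover_chart xK.
  by exists (W, U, K, e).
move=> /choice[D hD].
pose W k := (D k).1.1.1; pose U k := (D k).1.1.2; pose K k := (D k).1.2; pose e k := (D k).2.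
have {}hD k : [/\ [/\ open (W k), U k `<=` W k, W k `<=` K k & compact (K k)], nbhs k (U k), 0 < e k,
    (forall B x x', possemidef B -> B != 0 -> W k x -> W k x' ->
        annih (u x) B -> annih (u x') B -> x = x') &
    (forall B B' x, possemidef B -> B != 0 -> possemidef B' -> U k x ->
        annih (u x) B -> `|B' - B| <= e k * \tr B -> exists2 x', W k x' & annih (u x') B')].
  by have := hD k; rewrite /W /U /K /e; case: (D k) => -[[? ?] ?] ?.
have [l hl] : exists l : seq X, forall s, [set: S] s -> exists2 k, k \in l & (p @` (U k)^°) s.
  case: (hS) => _ cS _ _; apply: compact_finite cS _ => s _.
  have [x xs] : exists x, p x = s by case: cov => _ h _; exact: h.
  exists x; rewrite -xs; apply: proj_nbhs; apply: nbhs_interior.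
  by have [_ ? _ _ _] := hD x.
have [f f0 hf] : exists2 f, 0 < f & forall k, k \in l -> f <= e k.
  elim: (l) => [|k s [f f0 hf]]; first by exists 1.
  have [_ _ ek _ _] := hD k.
  exists (Num.min (e k) f); first by rewrite lt_min ek f0.
  move=> j; rewrite in_cons => /orP[/eqP ->|js]; first by rewrite ge_min lexx.
  by rewrite ge_min hf // orbT.
(* The division by 3 compensates the factor 3 in [psd_close_norm]. *)
exists l, W, U, K, (f / 3); split.
- by rewrite divr_gt0.
- by move=> k; have [] := hD k.
- move=> x; have [k kl [z Uz pz]] := hl (p x) I.
  have [a ax] := act_transitive cov hsS cover_path sc hact (esym pz).
  by exists k, a; rewrite ax.
- move=> k a B x x' Bp B0 Wx Wx' zx zx'; have [_ _ _ h _] := hD k.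
  have := h _ _ _ (gact_psd (rho a) Bp) (gact_rho_neq0 a B0) Wx Wx' (@annih_act a _ _ zx) (@annih_act a _ _ zx').
  by move=> /(congr1 (act a^-1%g)); rewrite !(actK hact).
- move=> k a B B' x kl Bp B0 Bp' Ux zx cBB; have [_ _ _ _ h] := hD k.
  have [|y Wy zy] := h _ _ _ (gact_psd (rho a) Bp) (gact_rho_neq0 a B0) (gact_psd (rho a) Bp')
    Ux (@annih_act a _ _ zx).
    have f3 : 0 <= f / 3 by rewrite divr_ge0 // ltW.
    apply: le_trans (psd_close_norm f3 (gact_psd _ Bp) (gact_close (rho a) cBB)) _.
    rewrite (_ : 3 * (f / 3) = f); last by field.
    by rewrite ler_wpM2r ?hf // psd_tr_ge0 //; exact: gact_psd.
  exists (act a^-1%g y); first by rewrite (actVK hact).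
  by apply: (@annih_actV a); rewrite (actVK hact).
Qed.

Definition mx_continuous_on (T : topologicalType) (K : set T) (M : T -> 'M[R]_m) :=
  forall b, K b -> forall d, 0 < d -> nbhs b (fun b' => K b' -> `|M b' - M b| <= d).

(** The zero in [W] is continuous: it persists into any neighbourhood [N] of its position, and
    uniqueness in [W] identifies the persisting zero with the chosen one. *)
Lemma zero_branch (T : topologicalType) (K : set T) (M : T -> 'M[R]_m) (W : set X) :
  K !=set0 -> open W ->
  (forall B x x', possemidef B -> B != 0 -> W x -> W x' ->
     annih (u x) B -> annih (u x') B -> x = x') ->
  mx_continuous_on K M -> (forall b, K b -> possemidef (M b) /\ M b != 0) ->
  (forall b, K b -> exists2 x, W x & annih (u x) (M b)) ->
  exists f : T -> X, {within K, continuous f} /\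
    forall b, K b -> W (f b) /\ annih (u (f b)) (M b).
Proof.
move=> Kb0' oW uW cM pM eM; have [b0 Kb0] := Kb0'.
have [x0 _ _] := eM b0 Kb0.
pose f b := xget x0 [set x | W x /\ annih (u x) (M b)].
have fP b : K b -> W (f b) /\ annih (u (f b)) (M b).
  move=> Kb; apply: (@xgetPex _ x0 [set x | W x /\ annih (u x) (M b)]).
  by have [x Wx zx] := eM b Kb; exists x.
exists f; split=> //; apply/within_contP => b Kb N fN.
have [Wf zf] := fP b Kb; have [Mp M0] := pM b Kb.
have WN : nbhs (f b) (fun x => W x /\ N x).
  by apply: nbhsI2 => //; exact: open_nbhs_nbhs.
have [W' [U' [e [_ W'N [U'f _] e0 [_ hU']]]]] := local_zeros hu cover_chart WN.
have d0 : 0 < e * \tr (M b) by rewrite mulr_gt0 // psd_tr_gt0.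
apply: nbhsS (cM b Kb _ d0) => b' h Kb'.
have [Mp' M0'] := pM b' Kb'; have [Wf' zf'] := fP b' Kb'.
have [x' W'x' zx'] := hU' _ _ _ Mp M0 Mp' (nbhs_singleton U'f) zf (h Kb').
have [Wx' Nx'] := W'N _ W'x'.
by rewrite (uW _ _ _ Mp' M0' Wf' Wx' zf' zx').
Qed.

Lemma zero_uniq_loc (x : X) : exists2 W, nbhs x W & forall B x1 x2, possemidef B -> B != 0 ->
  W x1 -> W x2 -> annih (u x1) B -> annih (u x2) B -> x1 = x2.
Proof.
have [W [U [e [_ _ [Ux UW] _ [h _]]]]] := local_zeros hu cover_chart (filterT : nbhs x setT).
by exists W => //; exact: nbhsS Ux.
Qed.

(** Local lifting asks for one neighbourhood of [a] valid for all zeros of [M a], wherever they lie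
    in the non-compact [X]; this is what the uniform threshold provides. *)
Lemma zero_liftable (M : R * R -> 'M[R]_m) : mx_continuous_on setT M ->
  (forall a, rect 0 1 0 1 a -> posdef (M a)) ->
  liftable (fun a x => annih (u x) (M a)) (rect 0 1 0 1).
Proof.
move=> cM pM; apply: (square_liftable hX).
  move=> a z _ _; have [W Wz hW] := zero_uniq_loc z.
  exists setT, W; split=> //; first exact: filterT.
  move=> b z1 z2 _ Qb W1 W2; apply: hW => //; first exact/posdef_psd/pM.
  exact: posdef_neq0 m_gt0 (pM b Qb).
move=> a Qa; have [l [W [U [K [e [e0 hWU hcl hun hex]]]]]] := uniform_local_zeros.
have [d d0 hd] := posdef_close (pM a Qa) e0.
pose N b := rect 0 1 0 1 b -> `|M b - M a| <= d.
have Na : nbhs a N by apply: nbhsS (cM a I d d0) => b h _; exact: h.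
exists N => // b z [Nb Qb] zz.
have ps b' : rect 0 1 0 1 b' -> possemidef (M b') /\ M b' != 0.
  by move=> /pM h; split; [exact: posdef_psd | exact: posdef_neq0].
have [k [c [kl /nbhs_singleton Uz]]] := hcl z; have [oW UW _ _] := hWU k.
have [||||f [cf hf]] := @zero_branch _ (N `&` rect 0 1 0 1) M (act c @^-1` W k)
   (ex_intro _ b (conj Nb Qb)) _
   (fun B x x' Bp B0 => hun k c B x x' Bp B0).
- by apply: open_comp => // x _; exact: (act_continuous hact).
- by move=> b' _ d' d'0; apply: nbhsS (cM b' I d' d'0) => b'' h _; exact: h.
- by move=> b' [_]; exact: ps.
- move=> b' [Nb' Qb']; have [Mp M0] := ps b Qb.
  have [_ cl] := hd (M b) (M b') Mp.1 (ps b' Qb').1.1 (Nb Qb) (Nb' Qb').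
  exact: (hex k c (M b) (M b') z kl Mp M0 (ps b' Qb').1 Uz zz cl).
exists f; first by split=> // b' hb'; exact: (hf b' hb').2.
have [Wf zf] := hf b (conj Nb Qb).
have [Mp M0] := ps b Qb.
by apply: (hun k c (M b)) => //; exact: UW.
Qed.

Definition zero_lift (B B' : 'M[R]_m) (x x' : X) := exists f : R -> X,
  [/\ {within `[0, 1], continuous f}, f 0 = x, f 1 = x'
    & forall t, 0 <= t <= 1 -> annih (u (f t)) ((1 - t) *: B + t *: B')].

Lemma posdef_segment (B B' : 'M[R]_m) t : posdef B -> posdef B' -> 0 <= t <= 1 ->
  posdef ((1 - t) *: B + t *: B').
Proof.
move=> Bp Bp' /andP[t0 t1]; have [->|t1'] := eqVneq t 1.
  by rewrite subrr scale0r add0r scale1r.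
apply: posdefDpsd; last by apply: psdZ => //; exact: posdef_psd.
by apply: posdefZ => //; rewrite subr_gt0 lt_def eq_sym t1'.
Qed.

Lemma zero_path_unique (M : R -> 'M[R]_m) (f g : R -> X) t0 :
  (forall t, 0 <= t <= 1 -> posdef (M t)) ->
  {within `[0, 1], continuous f} -> {within `[0, 1], continuous g} ->
  (forall t, 0 <= t <= 1 -> annih (u (f t)) (M t)) ->
  (forall t, 0 <= t <= 1 -> annih (u (g t)) (M t)) ->
  0 <= t0 <= 1 -> f t0 = g t0 -> forall t, 0 <= t <= 1 -> f t = g t.
Proof.
move=> pM cf cg zf zg t01 e0; apply: (agree_on_path hX cf cg) t01 e0 => t t01.
have [W Wz hW] := zero_uniq_loc (f t); exists W => //.
apply: filterE => t' t'01 W1 W2; apply: (hW (M t')) => //.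
- exact/posdef_psd/pM.
- by apply: posdef_neq0 => //; exact: pM.
- exact: zf.
- exact: zg.
Qed.

Lemma zero_lift_unique B B' x y1 y2 : posdef B -> posdef B' ->
  zero_lift B B' x y1 -> zero_lift B B' x y2 -> y1 = y2.
Proof.
move=> Bp Bp' [f [cf f0 f1 zf]] [g [cg g0 g1 zg]]; rewrite -f1 -g1.
apply: (zero_path_unique (M := fun t => (1 - t) *: B + t *: B') (t0 := 0)) => //.
- by move=> t; exact: posdef_segment.
- by apply/andP; split; lra.
- by rewrite f0 g0.
- by apply/andP; split; lra.
Qed.

Lemma zero_lift_const B B' x : annih (u x) B -> annih (u x) B' -> zero_lift B B' x x.
Proof.
move=> zB zB'; exists (fun=> x); split=> //.
  by apply: continuous_subspaceT => t; exact: cvg_cst.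
by move=> t _ q qu; rewrite ipDl !ipZl zB // zB' // !mulr0 addr0.
Qed.

Lemma bilinear_continuous (B00 B01 B1 : 'M[R]_m) : mx_continuous_on setT
  (fun z : R * R => (1 - z.2) *: ((1 - z.1) *: B00 + z.1 *: B01) + z.2 *: B1).
Proof.
move=> b _ d d0.
have ce i j : {for b, continuous (fun z : R * R =>
    (1 - z.2) * ((1 - z.1) * B00 i j + z.1 * B01 i j) + z.2 * B1 i j)}.
  have c1 : (fun z : R * R => z.1) @ nbhs b --> b.1 by exact: cvg_fst.
  have c2 : (fun z : R * R => z.2) @ nbhs b --> b.2 by exact: cvg_snd.
  have k1 (a : R) : (fun z : R * R => a) @ nbhs b --> a by exact: cvg_cst.
  apply: cvgD; last exact: cvgM c2 (k1 _).
  apply: cvgM; first exact: cvgB (k1 _) c2.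
  apply: cvgD; last exact: cvgM c1 (k1 _).
  exact: cvgM (cvgB (k1 _) c1) (k1 _).
have : nbhs b (fun z => forall ij : 'I_m * 'I_m,
   `|((1 - z.2) *: ((1 - z.1) *: B00 + z.1 *: B01) + z.2 *: B1) ij.1 ij.2 -
     ((1 - b.2) *: ((1 - b.1) *: B00 + b.1 *: B01) + b.2 *: B1) ij.1 ij.2| < d).
  apply: nbhs_forall => -[i j] /=; have := ce i j _ (nbhsx_ballx _ _ d0).
  by apply: nbhsS => z; rewrite /= -ball_normE /= distrC !mxE.
apply: nbhsS => z h _; apply: mx_norm_leP => [|i j]; first exact: ltW.
by rewrite [X in `|X|]addmxE [X in _ + X]mxE; apply/ltW/(h (i, j)).
Qed.

(** A triangle with apex [C], parametrised by a square whose side at height 1 collapses to [C]. The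
    lift follows [f] and [g] on two sides, is constant on the collapsed one by uniqueness, and its
    last side runs from [x'] to [z]. *)
Lemma zero_lift_square B B' C x x' z : posdef B -> posdef B' -> posdef C -> annih (u x) B ->
  zero_lift B B' x x' -> zero_lift B C x z -> zero_lift B' C x' z.
Proof.
move=> Bp Bp' Cp zx [f [cf f0 f1 zf]] [g [cg g0 g1 zg]].
pose M (a : R * R) := (1 - a.2) *: ((1 - a.1) *: B + a.1 *: B') + a.2 *: C.
have pM a : rect 0 1 0 1 a -> posdef (M a).
  by move=> [h1 h2]; apply: posdef_segment => //; exact: posdef_segment.
have Q (s t : R) : 0 <= s <= 1 -> 0 <= t <= 1 -> rect 0 1 0 1 (s, t) by [].
have h0 : 0 <= (0 : R) <= 1 by apply/andP; split; lra.
have h1 : 0 <= (1 : R) <= 1 by apply/andP; split; lra.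
have [||F [cF zF] F0] := zero_liftable (@bilinear_continuous B B' C) pM (a := (0, 0)) (z := x).
- exact: Q.
- by rewrite /= !subr0 !scale1r !scale0r !addr0.
have cs := segpt_within (@rect_convex R 0 1 0 1).
have Qs a b (t : R) : rect 0 1 0 1 a -> rect 0 1 0 1 b -> 0 <= t <= 1 ->
    rect 0 1 0 1 (segpt a b t) by exact: rect_convex.
have F10 : F (1, 0) = x'.
  have := zero_path_unique (M := fun t => M (segpt (0, 0) (1, 0) t)) _
    (cs _ _ _ _ (Q _ _ h0 h0) (Q _ _ h1 h0) cF) cf _ _ h0 _ h1.
  rewrite /= segpt0 segpt1 F0 f0 f1; apply=> //.
  - by move=> t t01; apply/pM/Qs => //; exact: Q.
  - by move=> t t01; apply/zF/Qs => //; exact: Q.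
  - move=> t t01; rewrite /M /segpt /= !subr0 !add0r mulr1 mulr0 subr0 scale1r scale0r addr0.
    exact: zf.
have F01 : F (0, 1) = z.
  have := zero_path_unique (M := fun t => M (segpt (0, 0) (0, 1) t)) _
    (cs _ _ _ _ (Q _ _ h0 h0) (Q _ _ h0 h1) cF) cg _ _ h0 _ h1.
  rewrite /= segpt0 segpt1 F0 g0 g1; apply=> //.
  - by move=> t t01; apply/pM/Qs => //; exact: Q.
  - by move=> t t01; apply/zF/Qs => //; exact: Q.
  - move=> t t01; rewrite /M /segpt /= !subr0 !add0r mulr1 mulr0 subr0 scale1r scale0r addr0.
    exact: zg.
have zz : annih (u z) C by rewrite -g1; have := zg 1 h1; rewrite subrr scale0r add0r scale1r.
have cz : {within `[(0 : R), 1], continuous (fun=> z)}.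
  by apply: continuous_subspaceT => t; exact: cvg_cst.
have F11 : F (1, 1) = z.
  have := zero_path_unique (M := fun t => M (segpt (0, 1) (1, 1) t)) _
    (cs _ _ _ _ (Q _ _ h0 h1) (Q _ _ h1 h1) cF) cz _ _ h0 _ h1.
  rewrite /= segpt0 segpt1 F01; apply=> //.
  - by move=> t t01; apply/pM/Qs => //; exact: Q.
  - by move=> t t01; apply/zF/Qs => //; exact: Q.
  - by move=> t t01; rewrite /M /segpt /= subrr mulr0 addr0 subrr scale0r add0r scale1r.
exists (F \o segpt (1, 0) (1, 1)); rewrite /= segpt0 segpt1; split=> //.
  by apply: cs => //; exact: Q.
move=> t t01; have := zF (segpt (1, 0) (1, 1) t) (Qs _ _ _ (Q _ _ h1 h0) (Q _ _ h1 h1) t01).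
by rewrite /M /segpt /= subrr mulr0 addr0 subr0 mulr1 add0r subrr scale0r add0r scale1r.
Qed.

Lemma zero_lift_exists B C x : posdef B -> posdef C -> annih (u x) B -> exists z, zero_lift B C x z.
Proof.
move=> Bp Cp zx.
(* A square constant in its first coordinate, in order to reuse [zero_liftable] for a segment. *)
pose M (a : R * R) := (1 - a.2) *: ((1 - a.1) *: B + a.1 *: B) + a.2 *: C.
have pM a : rect 0 1 0 1 a -> posdef (M a).
  by move=> [h1 h2]; apply: posdef_segment => //; exact: posdef_segment.
have Q (s t : R) : 0 <= s <= 1 -> 0 <= t <= 1 -> rect 0 1 0 1 (s, t) by [].
have h0 : 0 <= (0 : R) <= 1 by apply/andP; split; lra.
have h1 : 0 <= (1 : R) <= 1 by apply/andP; split; lra.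
have [||F [cF zF] F0] := zero_liftable (@bilinear_continuous B B C) pM (a := (0, 0)) (z := x).
- exact: Q.
- by rewrite /= !subr0 !scale1r !scale0r !addr0.
exists (F (0, 1)), (F \o segpt (0, 0) (0, 1)); rewrite /= segpt0 segpt1; split=> //.
  by apply: (segpt_within (@rect_convex R 0 1 0 1)) => //; exact: Q.
move=> t t01; have := zF (segpt (0, 0) (0, 1) t) (rect_convex (Q _ _ h0 h0) (Q _ _ h0 h1) t01).
by rewrite /M /segpt /= !subr0 !add0r mulr1 mulr0 subr0 scale1r scale0r addr0.
Qed.

Definition endpoint C z := [set x | exists B, [/\ posdef B, annih (u x) B & zero_lift B C x z]].

(** Two positive definite forms vanishing at [x] are joined by a segment of such forms, along which
    the zero stays at [x]; the triangle with apex [C] compares the two endpoints. *)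
Lemma endpoint_fun C x z z' : posdef C -> endpoint C z x -> endpoint C z' x -> z = z'.
Proof.
move=> Cp [B [Bp zB lB]] [B' [Bp' zB' lB']].
have := zero_lift_square Bp Bp' Cp zB (zero_lift_const zB zB') lB => lB2.
exact: (zero_lift_unique Bp' Cp lB2 lB').
Qed.

Lemma endpoint_total C x : posdef C -> exists z, endpoint C z x.
Proof.
move=> Cp; case: (hu) => hpen hno _ _.
have [B [Bp zB]] := posdef_annih (hpen x) (hno x).
by have [z lB] := zero_lift_exists Bp Cp zB; exists z, B.
Qed.

(** For [x'] near [x], [B] is perturbed to a positive definite [B'] vanishing at [x']. The zero of
    the short segment from [B] to [B'] moves from [x] to [x'] inside [W], and [zero_lift_square]
    transfers the endpoint. *)
Lemma endpoint_nbhs C x z : posdef C -> endpoint C z x -> nbhs x (endpoint C z).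
Proof.
move=> Cp [B [Bp zB lB]].
have B0 := posdef_neq0 m_gt0 Bp; have Bs := posdef_psd Bp.
have [W [U [e [oW _ [Ux UW] e0 [uW hU]]]]] := local_zeros hu cover_chart (filterT : nbhs x setT).
have tB := psd_tr_gt0 Bs B0.
have [d d0 hd] := posdef_open Bp.
(* [d] keeps [B'] positive definite, and [e * \tr B] keeps the segment within the range where the
   zero persists. *)
pose f := Num.min d (e * \tr B).
have f0 : 0 < f by rewrite lt_min d0 mulr_gt0.
have := nbhsI2 (open_nbhs_nbhs (conj oW (UW _ (nbhs_singleton Ux)))) (annih_perturb hu cover_chart zB Bp.1 f0).
apply: nbhsS => x' [Wx' [B' [Bs' zB' hB']]].
have Bp' : posdef B' by apply: hd => //; apply: le_trans hB' _; rewrite ge_min lexx.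
exists B'; split=> //; apply: (zero_lift_square Bp Bp' Cp zB _ lB).
pose M t := (1 - t) *: B + t *: B'.
have pM (t : R) : `[(0 : R), 1]%classic t -> possemidef (M t) /\ M t != 0.
  rewrite /= in_itv /= => t01; have h := posdef_segment Bp Bp' t01.
  by split; [exact: posdef_psd | exact: posdef_neq0].
have cM : mx_continuous_on (T := R) `[(0 : R), 1]%classic M.
  move=> t _ g g0; have := @bilinear_continuous B B B' (0, t) I g g0.
  move=> [[N1 N2] /= [h1 h2] hN]; apply: nbhsS h2 => t' N2t' _.
  have := hN (0, t') (conj (nbhs_singleton h1) N2t') I.
  by rewrite /= !subr0 !scale1r !scale0r !addr0.
have h00 : `[0, 1]%classic (0 : R) by rewrite /= in_itv /=; apply/andP; split; lra.
have h11 : `[0, 1]%classic (1 : R) by rewrite /= in_itv /=; apply/andP; split; lra.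
have [|h [ch hh]] := zero_branch (ex_intro _ 0 h00) oW uW cM pM.
  move=> t t01; apply: (hU _ _ _ Bs B0 (pM t t01).1 (nbhs_singleton Ux) zB).
  have -> : M t - B = t *: (B' - B) by apply/matrixP => i j; rewrite !mxE; ring.
  move: t01; rewrite /= in_itv /= => /andP[t0 t1].
  rewrite normrZ ger0_norm //; apply: (@le_trans _ _ (1 * f)).
    by apply: ler_pM.
  by rewrite mul1r ge_min lexx orbT.
have [Wh0 zh0] := hh 0 h00; have [Wh1 zh1] := hh 1 h11.
rewrite /M subr0 scale1r scale0r addr0 in zh0.
rewrite /M subrr scale0r add0r scale1r in zh1.
exists h; split=> //.
- exact: (uW _ _ _ Bs B0 Wh0 (UW _ (nbhs_singleton Ux)) zh0 zB).
- exact: (uW _ _ _ (posdef_psd Bp') (posdef_neq0 m_gt0 Bp') Wh1 Wx' zh1 zB').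
- by move=> t t01; apply: (hh t _).2; rewrite /= in_itv.
Qed.

Lemma zero_unique_posdef C x y : posdef C -> annih (u x) C -> annih (u y) C -> x = y.
Proof.
move=> Cp zx zy; have [c [cc c0 c1]] := sc.1 x y.
pose P s t := forall z, endpoint C z (c s) -> endpoint C z (c t).
have P01 : P 0 1.
  apply: interval_induction => [r s t _ _ Prs Pst z h|t t01]; first exact/Pst/Prs.
  have [z hz] := endpoint_total (c t) Cp.
  have ti : `[0, 1]%classic t by rewrite /= in_itv.
  move/within_contP: cc => /(_ t ti _ (endpoint_nbhs Cp hz)) /nbhs_ballP[d /= d0 hd].
  have hd' s : 0 <= s <= 1 -> `|t - s| < d -> endpoint C z (c s).
    by move=> s01 ts; apply: hd; rewrite /= ?in_itv.
  exists d => // a b a0 at_ tb b1 ad bd z' hz'.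
  have ha : endpoint C z (c a).
    by apply: hd'; [apply/andP; split; lra | rewrite ltr_distl; apply/andP; split; lra].
  rewrite (endpoint_fun Cp hz' ha); apply: hd'; first by apply/andP; split; lra.
  by rewrite ltr_distl; apply/andP; split; lra.
(* At a zero of [C] itself one may take [B = C], so the endpoint there is the zero. *)
have ex : endpoint C x (c 0) by rewrite c0; exists C; split=> //; exact: zero_lift_const.
have ey : endpoint C y (c 1) by rewrite c1; exists C; split=> //; exact: zero_lift_const.
exact: endpoint_fun Cp (P01 _ ex) ey.
Qed.

(** Two distinct zeros would persist, in disjoint neighbourhoods, for the positive definite form
    [C + d I]. *)
Lemma zero_unique C x y : possemidef C -> C != 0 -> annih (u x) C -> annih (u y) C -> x = y.
Proof.
move=> Cp C0 zx zy; apply: contrapT => xy.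
have [Nx [Ny [hNx hNy disj]]] := hausdorff_sep hX xy.
have [W1 [U1 [e1 [_ W1N [U1x _] e10 [_ h1]]]]] := local_zeros hu cover_chart hNx.
have [W2 [U2 [e2 [_ W2N [U2y _] e20 [_ h2]]]]] := local_zeros hu cover_chart hNy.
have tC := psd_tr_gt0 Cp C0.
pose e := Num.min e1 e2; have e0 : 0 < e by rewrite lt_min e10 e20.
pose n1 : R := `|1%:M : 'M[R]_m| + 1.
have n10 : 0 < n1 by rewrite ltr_wpDl.
pose d := e * \tr C / n1; have d0 : 0 < d by rewrite divr_gt0 // mulr_gt0.
pose C' := C + d *: 1%:M.
have Cp' : posdef C' by rewrite /C' addrC; apply: posdefDpsd => //; apply: posdefZ => //; exact: posdef1.
have dC : `|C' - C| <= e * \tr C.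
  rewrite /C' addrC addKr normrZ gtr0_norm // /d mulrAC ler_pdivrMr //.
  by rewrite ler_wpM2l ?lerDl // mulr_ge0 // ltW.
have [|x' /W1N Nx' zx'] := h1 _ _ _ Cp C0 (posdef_psd Cp') (nbhs_singleton U1x) zx.
  by apply: le_trans dC _; rewrite ler_wpM2r ?(ltW tC) // ge_min lexx.
have [|y' /W2N Ny' zy'] := h2 _ _ _ Cp C0 (posdef_psd Cp') (nbhs_singleton U2y) zy.
  by apply: le_trans dC _; rewrite ler_wpM2r ?(ltW tC) // ge_min lexx orbT.
by apply: (disj x') => //; rewrite (zero_unique_posdef Cp' zx' zy').
Qed.

Lemma overlaps_finite (l : seq X) (K : X -> set X) : (forall k, compact (K k)) ->
  exists F : seq G, forall j k a v, j \in l -> k \in l ->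
    K j v -> K k (act a v) -> a \in F.
Proof.
move=> cK; have : forall jk : X * X, exists F : seq G,
    forall a v, K jk.1 v -> K jk.2 (act a v) -> a \in F.
  by move=> [j k]; exact: (act_proper cov hsS cover_path sc hact (cK j) (cK k)).
move=> /choice[f hf]; exists (flatten [seq f (j, k) | j <- l, k <- l]) => j k a v jl kl Kv Kav.
by apply/flattenP; exists (f (j, k)); [apply/allpairsP; exists (j, k) | exact: (hf (j, k) a v Kv Kav)].
Qed.

(* The translated sets covering a path from o to a o form a chain of overlaps. *)
Lemma overlaps_generate (F : seq G) (l : seq X) (U : X -> set X) :
  (forall x, exists k a, k \in l /\ nbhs (act a x) (U k)) ->
  (forall j k a b x, j \in l -> k \in l -> U j (act a x) -> U k (act b x) -> (b * a^-1)%g \in F) ->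
  forall o : X, generates F.
Proof.
move=> hcov hF o.
pose P (c : R -> X) s t := forall j k a b, j \in l -> k \in l -> U j (act a (c s)) ->
  U k (act b (c t)) -> exists n, is_word F n (b * a^-1)%g.
have hP (c : R -> X) : {within `[0, 1], continuous c} -> P c 0 1.
  move=> /within_contP cc; apply: interval_induction.
    move=> r s t _ _ Prs Pst j k a b jl kl Uj Uk.
    have [i [d [il /nbhs_singleton Ui]]] := hcov (c s).
    have [n1 w1] := Prs _ _ _ _ jl il Uj Ui; have [n2 w2] := Pst _ _ _ _ il kl Ui Uk.
    by exists (n2 + n1)%N; rewrite -(mulgVK d b) -mulgA; exact: is_wordM.
  move=> t t01; have [i [d [il Ui]]] := hcov (c t).
  have ti : `[0, 1]%classic t by rewrite /= in_itv.
  have := cc t ti _ (act_continuous hact Ui) => /nbhs_ballP[e /= e0 he].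
  have he' s : 0 <= s <= 1 -> `|t - s| < e -> U i (act d (c s)).
    by move=> s01 ts; apply: he; rewrite /= ?in_itv.
  exists e => // s1 s2 s10 s1t ts2 s21 h1 h2 j k a b jl kl Uj Uk.
  have w1 : U i (act d (c s1)).
    by apply: he'; [apply/andP; split; lra | rewrite ltr_distl; apply/andP; split; lra].
  have w2 : U i (act d (c s2)).
    by apply: he'; [apply/andP; split; lra | rewrite ltr_distl; apply/andP; split; lra].
  exists 2%N; rewrite -(mulgVK d b) -mulgA.
  by apply: (is_wordM (j := 1) (k := 1)); apply: is_word_gen;
     [exact: hF il kl w2 Uk | exact: hF jl il Uj w1].
have [j [b [jl /nbhs_singleton Uj]]] := hcov o.
move=> a; have [c [cc c0 c1]] := sc.1 o (act (b^-1 * a^-1 * b)%g o).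
have [||n hn] := hP c cc j j b (a * b)%g jl jl; rewrite ?c0 ?c1 //.
  by rewrite -(actM hact) !mulgA mulgK mulgV mul1g.
exists n; apply/asboolP; by rewrite mulgK in hn.
Qed.

(** Each step moves the zero inside one translate of some [W i], and a change of translate costs one
    letter of [F]. The element [b] brings the base point into a reference set [U j], whence the
    conjugation. *)
Lemma zero_chain (o : X) : exists (F : seq G) (b : G) (e : R), [/\ 0 < e, generates F &
  forall N a (M : nat -> 'M[R]_m),
    (forall k, (k <= N)%N -> possemidef (M k) /\ M k != 0) ->
    (forall k, (k < N)%N -> psd_close e (M k) (M k.+1)) ->
    annih (u (act a o)) (M 0%N) -> annih (u o) (M N) -> is_word F N.+1 (b * a * b^-1)%g].
Proof.
have [l [W [U [K [e [e0 hWU hcl hun hex]]]]]] := uniform_local_zeros.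
have [F hF] := @overlaps_finite l K (fun k => let: And4 _ _ _ cK := hWU k in cK).
have WK k x : W k x -> K k x by have [_ _ h _] := hWU k; exact: h.
have UW k x : U k x -> W k x by have [_ h _ _] := hWU k; exact: h.
have hFW j k a b x : j \in l -> k \in l -> W j (act a x) -> W k (act b x) -> (b * a^-1)%g \in F.
  move=> jl kl /WK Wj /WK Wk; apply: (hF j k _ (act a x)) => //.
  by rewrite -(actM hact) mulgVK.
have [j [b [jl /nbhs_singleton Uj]]] := hcl o.
exists F, b, e; split=> //.
  apply: (overlaps_generate hcl _ o) => j' k a a' x jl' kl /UW Uj' /UW Uk.
  exact: hFW jl' kl Uj' Uk.
move=> N a M pM cM z0 zN.
(* The induction allows every label [(i, d)] of the current zero. The extra letter in [k.+1]
   compares the label of the starting point [act a o] with that of [o]. *)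
have step k : (k <= N)%N -> exists2 x, annih (u x) (M k) &
    forall i d, i \in l -> W i (act d x) -> is_word F k.+1 (d * a * b^-1)%g.
  elim: k => [_|k IH kN].
    exists (act a o) => // i d il Wd; apply: is_word_gen.
    by apply: (hFW j i b (d * a)%g o) => //; [exact: UW | rewrite (actM hact)].
  have [x zx hx] := IH (ltnW kN).
  have [i [d [il /nbhs_singleton Ui]]] := hcl x.
  have [Mp M0] := pM k (ltnW kN); have [Mp' M0'] := pM k.+1 kN.
  have [x' Wx' zx'] := hex i d _ _ x il Mp M0 Mp' Ui zx (cM k kN).
  exists x' => // i' d' il' Wd'.
  have w := hx i d il (UW _ _ Ui).
  have -> : (d' * a * b^-1 = (d' * d^-1) * (d * a * b^-1))%g by rewrite !mulgA mulgVK.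
  apply: (is_wordM (j := 1)) w; apply: is_word_gen; exact: hFW il il' Wx' Wd'.
have [x zx hx] := step N (leqnn N).
have [Mp M0] := pM N (leqnn N).
(* Global uniqueness: the zero that was followed has arrived at the base point. *)
have xo : x = o by exact: (zero_unique Mp M0 zx zN).
by apply: (hx j b jl); rewrite xo; exact: UW.
Qed.

End Global.

(** * Signature and singular values *)

Section Signature.
Variable R : realType.

Lemma nsq_mulmx_le m (B : 'M[R]_m) : exists2 K, 0 < K & forall v, nsq (B *m v) <= K * nsq v.
Proof.
exists (m%:R ^+ 2 * `|B^T *m B| + 1).
  by rewrite ltr_wpDl // mulr_ge0 // sqr_ge0.
move=> v; have -> : nsq (B *m v) = qf (B^T *m B) v.
  by rewrite nsqE -qf_congr mulmx1.
apply: le_trans (ler_norm _) _; apply: le_trans (qf_norm _ _) _.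
by rewrite ler_wpM2r ?nsq_ge0 // lerDl.
Qed.

Lemma qf_diag m (d : 'rV[R]_m) v : qf (diag_mx d) v = \sum_i d 0 i * v i 0 ^+ 2.
Proof.
have := @spectral_qf R m 1%:M d v; rewrite trmx1 mul1mx mulmx1 => ->.
by apply: eq_bigr => i _; rewrite mul1mx.
Qed.

(** The columns of [B] selected by [f] span a subspace where [s q] is positive; [K] bounds the
    distortion of [B]. The sign [s] treats both kinds of definite subspace at once. *)
Lemma definite_subspace m n (q B : 'M[R]_m) (d : 'rV[R]_m) (f : 'I_n -> 'I_m) (s : R) :
  B^T *m q *m B = diag_mx d -> injective f -> s ^+ 2 = 1 -> (forall j, d 0 (f j) = s) ->
  exists c (E : 'M[R]_(m, n)), [/\ 0 < c, forall y : 'cV_n, E *m y = 0 -> y = 0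
    & forall y, c * nsq (E *m y) <= s * qf q (E *m y)].
Proof.
move=> qB fI s1 ds; have [K K0 hK] := nsq_mulmx_le B.
pose E0 : 'M[R]_(m, n) := colsub f 1%:M.
have E0D (D : 'rV[R]_m) y : qf (diag_mx D) (E0 *m y) = \sum_j D 0 (f j) * y j 0 ^+ 2.
  have -> : \sum_j D 0 (f j) * y j 0 ^+ 2 = qf (diag_mx (\row_j D 0 (f j))) y.
    by rewrite qf_diag; apply: eq_bigr => j _; rewrite mxE.
  rewrite -qf_congr /E0 trmx_mxsub trmx1 mul_rowsub_mx mul1mx mulmx_colsub mulmx1.
  congr (qf _ y); apply/matrixP => i j; rewrite !mxE; congr (_ *+ _).
  by rewrite (inj_eq fI).
have qE y : s * qf q (B *m E0 *m y) = nsq y.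
  rewrite -mulmxA -(qf_congr q B) qB E0D big_distrr /=; apply: eq_bigr => j _.
  by rewrite ds mulrA -expr2 s1 mul1r.
have nE y : nsq (E0 *m y) = nsq y.
  rewrite nsqE -diag_const_mx E0D; apply: eq_bigr => j _.
  by rewrite mxE mul1r.
exists K^-1, (B *m E0); split.
- by rewrite invr_gt0.
- by move=> y h; apply/eqP; rewrite -nsq_eq0 -qE h qf0 mulr0.
- move=> y; rewrite qE mulrC ler_pdivrMr // -[in leRHS]nE mulrC -mulmxA; exact: hK.
Qed.

(** Signature [(n, n)] with explicit constants, which makes it stable under perturbation and uniform
    on compact families. *)
Definition split_form m n (q : 'M[R]_m) (c C : R) := exists Ep Em : 'M[R]_(m, n),
  [/\ forall y : 'cV_n, Ep *m y = 0 -> y = 0, forall y : 'cV_n, Em *m y = 0 -> y = 0,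
      forall y, c * nsq (Ep *m y) <= qf q (Ep *m y),
      forall y, c * nsq (Em *m y) <= - qf q (Em *m y)
    & forall v, `|qf q v| <= C * nsq v].

Lemma split_formZ m n (q : 'M[R]_m) c C s : 0 <= s -> split_form n q c C ->
  split_form n (s *: q) (s * c) (s * C).
Proof.
move=> s0 [Ep [Em [iEp iEm hp hm hC]]]; exists Ep, Em; split=> //.
- by move=> y; rewrite qfZ -mulrA ler_wpM2l.
- by move=> y; rewrite qfZ -mulrN -mulrA ler_wpM2l.
- by move=> v; rewrite qfZ normrM ger0_norm // -mulrA ler_wpM2l.
Qed.

Lemma split_formW m n (q : 'M[R]_m) c C c' C' : c' <= c -> C <= C' ->
  split_form n q c C -> split_form n q c' C'.
Proof.
move=> cc CC [Ep [Em [iEp iEm hp hm hC]]]; exists Ep, Em; split=> //.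
- by move=> y; apply: le_trans (hp y); rewrite ler_wpM2r // nsq_ge0.
- by move=> y; apply: le_trans (hm y); rewrite ler_wpM2r // nsq_ge0.
- by move=> v; apply: le_trans (hC v) _; rewrite ler_wpM2r // nsq_ge0.
Qed.

Lemma pos_lower_bound (s : seq R) : exists2 c, 0 < c & forall x, x \in s -> 0 < x -> c <= x.
Proof.
elim: s => [|x s [c c0 hc]]; first by exists 1.
have [x0|x0] := ltP 0 x.
  exists (Num.min x c); first by rewrite lt_min x0.
  by move=> y; rewrite in_cons => /orP[/eqP ->|/hc h /h h'] => [_|]; rewrite ge_min ?lexx ?h' ?orbT.
exists c => // y; rewrite in_cons => /orP[/eqP ->|/hc //].
by rewrite ltNge x0.
Qed.

Lemma signature_split n (q : 'M[R]_(2 * n)) : has_signature n n q ->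
  exists2 c, 0 < c & exists2 e, 0 < e & forall q', `|q' - q| <= e ->
    split_form n q' c ((2 * n)%:R ^+ 2 * `|q'|).
Proof.
move=> [_ [B _ qB]].
have lt1 (j : 'I_n) : (j < 2 * n)%N by case: j => j /= h; lia.
have lt2 (j : 'I_n) : (n + j < 2 * n)%N by case: j => j /= h; lia.
pose f1 j := Ordinal (lt1 j); pose f2 j := Ordinal (lt2 j).
have f1I : injective f1 by move=> i j [h]; apply: val_inj.
have f2I : injective f2 by move=> i j [/addnI h]; apply: val_inj.
have [|j|c1 [Ep [c10 iEp hp]]] := definite_subspace qB f1I (s := 1).
- by rewrite expr1n.
- by rewrite mxE /= ltn_ord.
have [|j|c2 [Em [c20 iEm hm]]] := definite_subspace qB f2I (s := -1).
- by rewrite sqrrN expr1n.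
- by rewrite mxE /= ltnNge leq_addr /= ltn_add2l ltn_ord.
(* Half of the definiteness constant is left as room for the perturbation. *)
pose c := Num.min c1 c2 / 2; have c0 : 0 < c by rewrite divr_gt0 // lt_min c10.
pose M : R := (2 * n)%:R ^+ 2 + 1; have M0 : 0 < M by rewrite ltr_wpDl // sqr_ge0.
exists c => //; exists (c / M); first by rewrite divr_gt0.
have cc1 : c + c <= c1 by rewrite -splitr ge_min lexx.
have cc2 : c + c <= c2 by rewrite -splitr ge_min lexx orbT.
move=> q' hq; have dq v : `|qf q' v - qf q v| <= c * nsq v.
  rewrite -qfB; apply: le_trans (qf_norm _ _) _; rewrite ler_wpM2r ?nsq_ge0 //.
  apply: (@le_trans _ _ (M * (c / M))); last by rewrite mulrCA mulfV ?mulr1 // gt_eqF.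
  by apply: ler_pM => //; rewrite ?sqr_ge0 // lerDl.
exists Ep, Em; split=> //.
- move=> y; have := hp y; have := dq (Ep *m y); rewrite ler_norml => /andP[h _].
  have := ler_wpM2r (nsq_ge0 (Ep *m y)) cc1; move: h; rewrite mulrDl; lra.
- move=> y; have := hm y; have := dq (Em *m y); rewrite ler_norml => /andP[_ h].
  have := ler_wpM2r (nsq_ge0 (Em *m y)) cc2; move: h; rewrite mulrDl; lra.
- by move=> v; exact: qf_norm.
Qed.

Lemma pencil_basis m (P : {vspace 'M[R]_m}) : \dim P = 2 -> exists a b, P = <<[:: a; b]>>%VS.
Proof.
move=> dP; have := span_basis (vbasisP P).
have : size (vbasis P) = 2 by rewrite size_tuple.
by case: (tval (vbasis P)) => [|a [|b [|? ?]]] //= _ <-; exists a, b.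
Qed.

(** The constants are uniform on the compact unit circle of the pencil, and homogeneity accounts for
    the scale [s]. *)
Lemma pencil_split n (P : {vspace 'M[R]_(2 * n)}) : pencil_of_signature n n P ->
  exists c C, [/\ 0 < c, 0 < C & forall q, q \in P -> q != 0 ->
    exists2 s, 0 < s & split_form n q (s * c) (s * C)].
Proof.
move=> [[dP _] hP].
have [a [b eP]] := pencil_basis dP.
pose Q (w : 'rV[R]_2) := w 0 0 *: a + w 0 1 *: b.
have QP w : Q w \in P by rewrite eP; apply/span2P; exists (w 0 0), (w 0 1).
have Q0 w : nsq w^T = 1 -> Q w != 0.
  move=> w1; apply/eqP => Qw; have [b0 ab] := pencil_free dP eP.
  have w0 := ab _ _ Qw; move: Qw; rewrite /Q w0 scale0r add0r => /eqP.
  rewrite scaler_eq0 (negPf b0) orbF => /eqP w1'.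
  move/eqP: w1; rewrite /nsq big_ord_recl big_ord1 !mxE w0.
  have -> : lift ord0 ord0 = 1 :> 'I_2 by apply: val_inj.
  by rewrite w1' expr0n addr0 eq_sym oner_eq0.
pose L : R := `|a| + `|b| + 1; have L0 : 0 < L by rewrite ltr_wpDl // addr_ge0.
have QL (w : 'rV[R]_2) : `|Q w| <= `|w| * L.
  apply: le_trans (ler_normD _ _) _; rewrite !normrZ /L !mulrDr mulr1.
  rewrite -[leLHS]addr0; apply: lerD => //; apply: lerD; rewrite ler_wpM2r //; exact: entry_le_norm.
pose C : R := (2 * n)%:R ^+ 2 * L + 1.
have C0 : 0 < C by rewrite ltr_wpDl // mulr_ge0 ?sqr_ge0 // ltW.
have [s hs] : exists s : seq R, forall w, [set w : 'rV[R]_2 | nsq w^T = 1] w ->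
    exists2 c, c \in s & 0 < c /\ split_form n (Q w) c C.
  (* The condition is conditional on the circle because [compact_finite] asks for neighbourhoods in
     the whole plane. *)
  pose good c w := nsq w^T = 1 -> 0 < c /\ split_form n (Q w) c C.
  have [||l hl] := @compact_finite 'rV[R]_2 [set w | nsq w^T = 1] R good.
  - exact: unit_sphere_compact.
  - move=> w w1; have [c c0 [e e0 hce]] := signature_split (hP _ (QP w) (Q0 w w1)).
    exists c; have := nbhsx_ballx w (e / L) (divr_gt0 e0 L0).
    apply: nbhsS => w'; rewrite -ball_normE /= distrC => ww w'1; split=> //.
    apply: (split_formW (lexx c) _ (hce _ _)).
      rewrite /C ler_wpDr // ler_wpM2l ?sqr_ge0 //; apply: le_trans (QL _) _.
      rewrite -[leRHS]mul1r ler_wpM2r ?(ltW L0) //.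
      apply: mx_norm_leP => // i j; rewrite ord1 -(@expr_le1 _ 2) //.
      by rewrite real_normK ?num_real // -w'1; have := coord_le_nsq w'^T j; rewrite mxE.
    have -> : Q w' - Q w = Q (w' - w).
      by rewrite /Q !mxE !scalerBl opprD addrACA.
    by apply: le_trans (QL _) _; rewrite -ler_pdivlMr // ltW.
  by exists l => w w1; have [c cl /(_ w1) h] := hl w w1; exists c.
have [c c0 hc] := pos_lower_bound s.
exists c, C; split=> // q; rewrite eP => /span2P[l1 [l2 eq]] q0.
pose w : 'rV[R]_2 := \row_i (if i == 0 then l1 else l2).
have qw : q = Q w by rewrite eq /Q !mxE.
have w0 : w^T != 0.
  apply/negP => /eqP /(congr1 (@trmx _ _ _)); rewrite trmxK trmx0 => w0.
  by move/negP: q0; apply; rewrite qw /Q w0 !mxE !scale0r addr0.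
pose t := Num.sqrt (nsq w^T); have t0 : 0 < t by rewrite sqrtr_gt0 nsq_gt0.
have w1 : nsq (t^-1 *: w)^T = 1.
  by rewrite linearZ /= nsqZ exprVn sqr_sqrtr ?nsq_ge0 // mulVf // gt_eqF // nsq_gt0.
have qt : q = t *: Q (t^-1 *: w).
  by rewrite qw /Q scalerDr !scalerA ![(_ *: w) _ _]mxE !mulrA !mulfV ?gt_eqF // !mul1r.
exists t => //; rewrite qt; apply: split_formZ; first exact: ltW.
have [c' c's [c'0 h]] := hs _ w1; exact: split_formW (hc _ c's c'0) (lexx C) h.
Qed.

(** On the preimage under [g] of a positive subspace of [q], [h1] gives an upper bound for [|g v|^2]
    with factor [(s' / s) (C / c) / T]. On a negative subspace of [q'], [h2] gives a lower bound
    with factor [(s' / s) (c / C) T]. Min-max turns these into bounds on two consecutive singular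
    values, and [s' / s] cancels. *)
Lemma split_ratio n (g q q' : 'M[R]_(2 * n)) (c C s s' T : R) : (0 < n)%N ->
  \det g != 0 -> 0 < c -> 0 < C -> 0 < s -> 0 < s' -> 0 < T ->
  split_form n q (s * c) (s * C) -> split_form n q' (s' * c) (s' * C) ->
  (forall v, T * qf q (g *m v) <= qf q' v) -> (forall v, T^-1 * qf q (g *m v) <= qf q' v) ->
  c / C * T <= sigma n g / sigma n.+1 g.
Proof.
move=> n0 dg c0 C0 s0 s'0 T0 [Ep [_ [iEp _ hp _ hC]]] [_ [Em [_ iEm _ hm hC']]] h1 h2.
have gu : g \in unitmx by rewrite unitmxE unitfE.
have n2 : (0 < n <= 2 * n)%N by rewrite n0; lia.
pose r := s' / s; have r0 : 0 < r by rewrite divr_gt0.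
have up : sigma n.+1 g ^+ 2 <= r * (C / c) / T.
  have e2 : ((2 * n - n) = n)%N by lia.
  have := @sigma_upper R (2 * n) n g (invmx g *m Ep) (r * (C / c) / T) n2; rewrite e2; apply.
    move=> y h; apply: iEp; rewrite -[Ep](mulKVmx gu) -mulmxA h mulmx0 //.
  move=> y; set v := _ *m y.
  have gv : g *m v = Ep *m y by rewrite /v !mulmxA mulmxV // mul1mx.
  have k1 := ler_wpM2l (ltW T0) (hp y).
  have k2 := h1 v; have k3 := le_trans (ler_norm _) (hC' v).
  rewrite gv in k2 *; have k4 := le_trans k1 (le_trans k2 k3).
  have k0 : 0 < T * (s * c) by rewrite !mulr_gt0.
  rewrite -(ler_pM2l k0); have -> : T * (s * c) * (r * (C / c) / T * nsq v) = s' * C * nsq v.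
    by rewrite /r; field; rewrite !gt_eqF.
  by move: k4; rewrite !mulrA.
have low : r * (c / C) * T <= sigma n g ^+ 2.
  apply: (@sigma_lower R (2 * n) n g Em _ n2 iEm) => y; set v := Em *m y.
  have k2 := h2 v; have := hC (g *m v); rewrite ler_norml => /andP[k3 _].
  have k1 := hm y; rewrite -/v in k1.
  have k4 := ler_wpM2l (ltW T0) k2; rewrite mulrA mulfV ?gt_eqF // mul1r in k4.
  have k5 := ler_wpM2l (ltW T0) k1.
  have k0 : 0 < s * C by rewrite mulr_gt0.
  rewrite -(ler_pM2l k0); have -> : s * C * (r * (c / C) * T * nsq v) = T * (s' * c * nsq v).
    by rewrite /r; field; rewrite !gt_eqF.
  by apply: le_trans k5 _; rewrite mulrN lerNl; exact: le_trans k3 k4.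
have sg : 0 < sigma n.+1 g by apply: sigma_gt0 => //; lia.
rewrite ler_pdivlMr // -(@ler_pXn2r _ 2) // ?nnegrE ?sigma_ge0 //.
  apply: le_trans low; rewrite exprMn.
  apply: le_trans (ler_wpM2l (sqr_ge0 _) up) _.
  by rewrite le_eqVlt; apply/orP; left; apply/eqP; field; rewrite !gt_eqF.
by rewrite mulr_ge0 ?ltW // mulr_gt0 // divr_gt0.
Qed.

End Signature.

(** * From the duality alternative to exponential growth *)

Section Final.
Variable R : realType.

Lemma frame_at_mem m (a b : 'M[R]_m) k : frame_at a b k \in <<[:: a; b]>>%VS.
Proof.
by rewrite /frame_at; case: ifP => _; apply/span2P; [exists 1, 0 | exists 0, 1];
   rewrite scale1r scale0r ?addr0 ?add0r.
Qed.

(** Both [q' - T q] and [q' - T^-1 q] are linear in the pair [(q', q)], so [psd_pair_alternative]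
    applies with frames of the two pencils as parameters. Testing the certificate on [q'] and on [q]
    separately gives the two annihilation conditions. *)
Lemma pencil_pair_alternative m (P P' : {vspace 'M[R]_m}) (T : R) : pencil P -> pencil P' ->
  0 < T ->
  (exists q q', [/\ q \in P, q' \in P', posdef (q' - T *: q) & posdef (q' - T^-1 *: q)]) \/
  (exists A B, [/\ possemidef A, possemidef B, A + B != 0, annih P' (A + B)
     & annih P (T *: A + T^-1 *: B)]).
Proof.
move=> [dP sP] [dP' sP'] T0.
have [a [b eP]] := pencil_basis dP; have [a' [b' eP']] := pencil_basis dP'.
have fP k : frame_at a b k \in P by rewrite eP; exact: frame_at_mem.
have fP' k : frame_at a' b' k \in P' by rewrite eP'; exact: frame_at_mem.
pose v t (i : 'I_2 + 'I_2) :=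
  match i with inl k => frame_at a' b' k | inr k => - t *: frame_at a b k end.
have vs t i : (v t i)^T = v t i.
  by case: i => k /=; rewrite ?[(_ *: _)^T]linearZ /= ?(sP _ (fP k)) ?(sP' _ (fP' k)).
have vE (c : 'I_2 + 'I_2 -> R) t : \sum_i c i *: v t i =
    \sum_k c (inl k) *: frame_at a' b' k - t *: \sum_k c (inr k) *: frame_at a b k.
  rewrite big_sumType /=; congr (_ + _); rewrite scaler_sumr -sumrN.
  by apply: eq_bigr => k _; rewrite scalerA mulrN scaleNr scalerA mulrC.
have [[c [c1 c2]]|no] := pselect (exists c : 'I_2 + 'I_2 -> R,
   posdef (\sum_i c i *: v T i) /\ posdef (\sum_i c i *: v T^-1 i)).
  left; exists (\sum_k c (inr k) *: frame_at a b k), (\sum_k c (inl k) *: frame_at a' b' k).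
  by rewrite -!vE; split=> //; apply: rpred_sum => k _; apply: rpredZ.
right; have [A [B [Ap Bp AB h]]] := psd_pair_alternative (vs T) (vs T^-1)
  (fun c hc => no (ex_intro _ c hc)).
exists A, B; split=> //; rewrite ?eP ?eP'; apply/annih_frame => k.
  by have := h (inl k); rewrite /= ipDl.
have := h (inr k); rewrite /= !ipZr ipDl !ipZl => /eqP.
by rewrite !mulNr -opprD oppr_eq0 => /eqP.
Qed.

(** One step multiplies [A] by [1 + e] and [B] by its inverse, and [1 - e <= 1 / (1 + e)]. *)
Lemma interpolation_close m (A B : 'M[R]_m) (e : R) k : 0 < e -> possemidef A -> possemidef B ->
  psd_close e ((1 + e) ^+ k *: A + (1 + e) ^- k *: B)
    ((1 + e) ^+ k.+1 *: A + (1 + e) ^- k.+1 *: B).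
Proof.
move=> e0 Ap Bp; set t := 1 + e; have t1 : 1 < t by rewrite ltrDl.
have t0 : 0 < t by apply: lt_trans t1.
have tk : 0 < t ^+ k by rewrite exprn_gt0.
have ti : t^-1 <= 1 by rewrite invf_le1 // ltW.
have te : 1 - e <= t^-1.
  by rewrite -(ler_pM2r t0) mulVf ?gt_eqF // /t; have := sqr_ge0 e; rewrite expr2; nra.
split; rewrite /psd_le.
  have -> : t ^+ k.+1 *: A + t ^- k.+1 *: B - (1 - e) *: (t ^+ k *: A + t ^- k *: B) =
      (t ^+ k * (t - (1 - e))) *: A + (t ^- k * (t^-1 - (1 - e))) *: B.
    by apply/matrixP => i j; rewrite !mxE exprS invfM; ring.
  apply: psdD; apply: psdZ => //; apply: mulr_ge0; rewrite ?invr_ge0 ?(ltW tk) ?subr_ge0 //.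
  by rewrite /t; lra.
have -> : t *: (t ^+ k *: A + t ^- k *: B) - (t ^+ k.+1 *: A + t ^- k.+1 *: B) =
    (t ^- k * (t - t^-1)) *: B.
  by apply/matrixP => i j; rewrite !mxE exprS invfM; ring.
apply: psdZ => //; apply: mulr_ge0; first by rewrite invr_ge0 ltW.
by rewrite subr_ge0; apply: le_trans ti (ltW t1).
Qed.

Lemma psd_comb_neq0 m (A B : 'M[R]_m) (s t : R) : possemidef A -> possemidef B -> A + B != 0 ->
  0 < s -> 0 < t -> possemidef (s *: A + t *: B) /\ s *: A + t *: B != 0.
Proof.
move=> Ap Bp AB s0 t0; have ps := psdZ (ltW s0) Ap; have pt := psdZ (ltW t0) Bp.
split; first exact: psdD; apply: contra_neq AB => h.
have := congr1 (@mxtrace _ _) h; rewrite mxtrace0 mxtraceD !mxtraceZ => /eqP.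
rewrite paddr_eq0 ?mulr_ge0 ?psd_tr_ge0 ?(ltW s0) ?(ltW t0) //.
rewrite !mulf_eq0 (gt_eqF s0) (gt_eqF t0) /= => /andP[/eqP h1 /eqP h2].
by rewrite (psd_tr_eq0 Ap h1) (psd_tr_eq0 Bp h2) addr0.
Qed.

(** The hypothesis is used for the largest admissible [N]. Rounding costs at most two steps, hence
    [2 * ln tau]; when no [N] is admissible, [1 <= r] suffices. *)
Lemma exp_growth (L D l : nat) (tau kap r : R) : (0 < L)%N -> 1 < tau -> 0 < kap -> 1 <= r ->
  (forall N, (D + L * N.+1 < l)%N -> kap * tau ^+ N <= r) ->
  expR (ln tau / L%:R * l%:R - (ln tau / L%:R * D%:R + 2 * ln tau + `|ln kap| + 1)) <= r.
Proof.
move=> L0 t1 k0 r1 h; have t0 : 0 < tau by apply: lt_trans t1.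
have lt0 : 0 < ln tau by rewrite ln_gt0.
have L0' : 0 < (L%:R : R) by rewrite ltr0n.
pose a := ln tau / L%:R; have a0 : 0 < a by rewrite divr_gt0.
have aL : a * L%:R = ln tau by rewrite /a divfK // gt_eqF.
have nk := normr_ge0 (ln kap); rewrite -/a.
have key N : (l <= D + L * N)%N -> a * l%:R <= a * D%:R + N%:R * ln tau.
  move=> lN; have -> : a * D%:R + N%:R * ln tau = a * (D + L * N)%:R.
    by rewrite natrD natrM -aL; ring.
  by rewrite ler_pM2l // ler_nat.
have [lD|lD] := leqP l (D + L).
  apply: le_trans r1; rewrite -[leRHS]expR0 ler_expR.
  have := key 1%N; rewrite muln1 => /(_ lD); lra.
(* The largest integer with [L * M < l - D]; the exponent used is [M - 1]. *)
pose M := ((l - D).-1 %/ L)%N.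
have M0 : (0 < M)%N by rewrite divn_gt0 //; lia.
have hM := leq_trunc_div (l - D).-1 L.
have hM' := ltn_ceil (l - D).-1 L0.
apply: (@le_trans _ _ (kap * tau ^+ M.-1)); last first.
  by apply: h; rewrite prednK // mulnC -/M; rewrite -/M in hM; lia.
have -> : kap * tau ^+ M.-1 = expR (ln kap + M.-1%:R * ln tau).
  by rewrite expRD lnK // expRM_natl lnK.
rewrite ler_expR; have := key M.+1; rewrite mulnC => /(_ _).
have -> : M.+1%:R = M.-1%:R + 2 :> R by rewrite -{1}(prednK M0) -natr1 -natr1; ring.
rewrite mulrDl => hk; have := ler_norm (- ln kap); rewrite normrN => nk'.
have : a * l%:R <= a * D%:R + (M.-1%:R * ln tau + 2 * ln tau).
  by apply: hk; rewrite -/M in hM'; lia.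
lra.
Qed.

End Final.

Theorem theorem1p3 (R : realType) (n g : nat)
  (S : topologicalType) (A : set (chart R S))
  (X : topologicalType) (p : X -> S)
  (G : groupType) (act : G -> X -> X)
  (rho : G -> 'M[R]_(2 * n)) (u : X -> {vspace 'M[R]_(2 * n)})
  (hg : (2 <= g)%N)
  (hS : closed_oriented_surface A)
  (hSg : has_genus R g S)
  (hp : universal_cover R p)
  (hact : deck_group p act)
  (hrho : SL_representation rho)
  (hu : fitting_immersion (lift_atlas p A) u)
  (hunn : forall x, pencil_of_signature n n (u x))
  (hequi : equivariant act rho u) :
  anosov n rho.
Proof.
have [x0 _] : exists x : X, True.
  case: hSg => f _; case: (hp) => _ [_ sur _]; have [x _] := sur (f (0, 0)); by exists x.
(* There is no plane in the space of matrices of size 0. *)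
have n0 : (0 < n)%N.
  case: (hunn x0) => -[dP _] _; rewrite lt0n; apply/eqP => n0; move: dP.
  have -> : u x0 = 0%VS; last by rewrite dimv0.
  apply/eqP; rewrite -subv0; apply/subvP => q _; rewrite memv0; apply/eqP/matrixP => i.
  by have h := leq_ltn_trans (leq0n i) (ltn_ord i); rewrite n0 in h.
have m0 : (0 < 2 * n)%N by rewrite muln_gt0.
case: (hu) => hpen hno _ _.
have [F [b [e [e0 hF chain]]]] := zero_chain hS hp hact hrho hu hequi m0 x0.
have [c [C [c0 C0 hsplit]]] := pencil_split (hunn x0).
have dr a : \det (rho a) != 0 by case: hrho => _ _ ->; exact: oner_neq0.
have sig a : 0 < sigma n.+1 (rho a) by apply: sigma_gt0 => //; lia.
have ratio1 a : 1 <= sigma n (rho a) / sigma n.+1 (rho a).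
  by rewrite ler_pdivlMr // mul1r; apply: sigma_decr; rewrite n0; lia.
pose tau : R := 1 + e; have t1 : 1 < tau by rewrite ltrDl.
have t0 : 0 < tau by apply: lt_trans t1.
have main N a : c / C * tau ^+ N <= sigma n (rho a) / sigma n.+1 (rho a) \/
    is_word F N.+1 (b * a * b^-1)%g.
  have T0 : 0 < tau ^+ N by rewrite exprn_gt0.
  have [[q [q' [qu q'u p1 p2]]]|[A1 [A2 [pA1 pA2 A12 z1 z2]]]] :=
    pencil_pair_alternative (hpen x0) (hpen (act a x0)) T0; last first.
    right; apply: (chain N a (fun k => tau ^+ k *: A1 + tau ^- k *: A2)) => //.
    - by move=> k _; apply: psd_comb_neq0 => //; rewrite ?invr_gt0 exprn_gt0.
    - by move=> k _; exact: interpolation_close.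
    - by rewrite expr0 invr1 !scale1r.
  left; have : [set` u (act a x0)] q' by [].
  rewrite hequi => -[r ru qr].
  (* A pencil without nonzero semi-definite elements has no positive definite one; hence neither [q]
     nor [r] can vanish, and both have definite subspaces. *)
  have nopos x s : s \in u x -> ~ posdef s.
    by move=> su sp; have := posdef_neq0 m0 sp; rewrite (hno x s su (posdef_psd sp)) eqxx.
  have q0 : q != 0.
    by apply/eqP => q0; move: p1; rewrite q0 scaler0 subr0; exact: nopos q'u.
  have r0 : r != 0.
    apply/eqP => r0; move: p1; rewrite -qr r0 /quadric_act mulmx0 mul0mx sub0r -scaleNr.
    by apply: (nopos x0); apply: rpredZ.
  have [s s0 hs] := hsplit q qu q0; have [s' s'0 hs'] := hsplit r ru r0.
  have gu : rho a \in unitmx by rewrite unitmxE unitfE.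
  (* Equivariance pulls [q'] back to the element [r] of the base pencil, so the same constants [c]
     and [C] serve both forms. *)
  have qfr v : qf q' (rho a *m v) = qf r v.
    by rewrite -qr /quadric_act qf_congr mulmxA mulVmx // mul1mx.
  apply: (split_ratio n0 (dr a) c0 C0 s0 s'0 T0 hs hs') => v; rewrite -qfr -subr_ge0 -qfZ -qfB.
    by case: (posdef_psd p1) => _; exact.
  by case: (posdef_psd p2) => _; exact.
split; first by exists F.
move=> gens Hgen; have [L L0 hL] := word_length_bounded Hgen F.
(* The cost of undoing the conjugation by [b]. *)
pose D := (word_length Hgen b^-1%g + word_length Hgen b)%N.
exists (ln tau / L%:R), (ln tau / L%:R * D%:R + 2 * ln tau + `|ln (c / C)| + 1).
have lt0 : 0 < ln tau by rewrite ln_gt0.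
have at0 : 0 < ln tau / L%:R by rewrite divr_gt0 // ltr0n.
split=> //.
  by apply: ltr_wpDl => //; rewrite !addr_ge0 // !mulr_ge0 // ltW.
move=> a; apply: exp_growth => //; first by rewrite divr_gt0.
(* The word alternative would give [a] length at most [D + L * N.+1], against [lN]. *)
move=> N lN; have [//|w] := main N a.
have := hL _ _ w => h; move: lN; rewrite ltnNge.
have -> : a = (b^-1 * (b * a * b^-1) * b)%g by rewrite !mulgA mulVg mul1g mulgVK.
move=> /negP[]; apply: leq_trans (word_lengthM _ _ _) _.
rewrite /D addnAC leq_add2r; apply: leq_trans (word_lengthM _ _ _) _.
by rewrite leq_add2l.
Qed.
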